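(* Let $M=M^n$ be a Wintgen ideal submanifold of dimension $n\ge 4$ and codimension $m\ge 2$ in a real space form $\mathbb{R}^{n+m}(\widetilde{k})$. If $\widetilde{k}>0$, then the tensors $R\cdot C$ and $Q(g,R)$ are linearly dependent if and only if $M$ is totally umbilical in $\mathbb{R}^{n+m}(\widetilde{k})$ (and hence $M$ is conformally flat).
   Context: Manifolds are connected, Riemannian and of class $C^\infty$. $\mathbb{R}^{n+m}(\widetilde{k})$ is a real space form: a Riemannian manifold of dimension $n+m$ and constant curvature $\widetilde{k}$, with metric $\widetilde{g}$. The submanifold $M$ carries the induced metric $g$ with Levi-Civita connection $\nabla$; $h$ is its second fundamental form and the shape operator $A_\xi$ for a normal field $\xi$ is given by $g(A_\xi X,Y)=\widetilde{g}(\xi,h(X,Y))$. $\{E_i\}_{i=1}^n$ is any local orthonormal tangent frame and $\{\xi_\alpha\}_{\alpha=1}^m$ any local orthonormal normal frame; $A_\alpha=A_{\xi_\alpha}$. The mean curvature vector is $\vec{H}=\frac1n\sum_i h(E_i,E_i)$ and $H=\|\vec{H}\|$. $M$ is totally umbilical if $h(X,Y)=g(X,Y)\vec{H}$. For a symmetric $(0,2)$-tensor $A$: $(X\wedge_A Y)Z=A(Y,Z)X-A(X,Z)Y$. $\mathcal{R}(X,Y)Z=\nabla_X\nabla_YZ-\nabla_Y\nabla_XZ-\nabla_{[X,Y]}Z$, $R(X,Y,Z,W)=g(\mathcal{R}(X,Y)Z,W)$, $\mathrm{Ricc}(X,Y)=\mathrm{tr}\{Z\mapsto\mathcal{R}(Z,X)Y\}$,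 $g(\mathcal{S}X,Y)=\mathrm{Ricc}(X,Y)$, $\kappa=\mathrm{tr}\,\mathcal{S}$, and the Weyl tensor is $C(X,Y,Z,W)=g(\mathcal{C}(X,Y)Z,W)$ with $\mathcal{C}(X,Y)=\mathcal{R}(X,Y)-\frac1{n-2}\left(X\wedge_g\mathcal{S}Y+\mathcal{S}X\wedge_gY-\frac{\kappa}{n-1}X\wedge_gY\right)$. For a skew family of endomorphisms $\mathcal{B}(X,Y)$ and a $(0,k)$-tensor $T$ put $(\mathcal{B}(X,Y)\cdot T)(X_1,\dots,X_k)=-\sum_{j=1}^k T(X_1,\dots,\mathcal{B}(X,Y)X_j,\dots,X_k)$. The $(0,k+2)$-tensors $R\cdot T$, $C\cdot T$, $Q(A,T)$ are defined by $(X_1,\dots,X_k;X,Y)\mapsto(\mathcal{B}(X,Y)\cdot T)(X_1,\dots,X_k)$ with $\mathcal{B}(X,Y)=\mathcal{R}(X,Y)$, $\mathcal{C}(X,Y)$, $X\wedge_AY$ respectively. Two tensors $T_1,T_2$ are called linearly dependent (on $M$) if they are linearly dependent at every point of $M$; on the set where $T_2\neq0$ this means $T_1=L\,T_2$ for some function $L$. Normalized scalar curvature: $\rho=\frac{2}{n(n-1)}\sum_{i<j}R(E_i,E_j,E_j,E_i)$. Normal curvature: $R^\perp(X,Y;\xi,\eta)=g([A_\xi,A_\eta]X,Y)$, and $\rho^\perp=\frac{2}{n(n-1)}\sqrt{\sum_{i<j}\sum_{\alpha<\beta}R^\perp(E_i,E_j;\xi_\alpha,\xi_\beta)^2}$.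 $M$ is a Wintgen ideal submanifold if $\rho=H^2-\rho^\perp+\widetilde{k}$ everywhere on $M$ (equality in the Wintgen inequality $\rho\le H^2-\rho^\perp+\widetilde{k}$). *)

(* Defs.v *)
From HB Require Import structures.
From mathcomp Require Import all_boot all_order all_algebra.
From mathcomp Require Import all_classical all_reals all_analysis.

Set Implicit Arguments.
Unset Strict Implicit.
Unset Printing Implicit Defensive.

Import Order.TTheory GRing.Theory Num.Theory.
Import numFieldNormedType.Exports.

Local Open Scope classical_set_scope.
Local Open Scope ring_scope.

(* Only meaningful for open U: the derivatives are taken in the whole space. *)
Fixpoint Ck (R : realType) (V W : normedModType R) (k : nat)
    (U : set V) (f : V -> W) : Prop :=
  match k with
  | 0 => forall x, U x -> {for x, continuous f}
  | k'.+1 => (forall x, U x -> differentiable f x) /\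
             (forall v : V, Ck k' U (fun x => 'D_v f x))
  end.

Definition smooth_on (R : realType) (V W : normedModType R)
    (U : set V) (f : V -> W) : Prop :=
  forall k, Ck k U f.

(* Inverse homeomorphisms between an open set of T and an open set of R^n; the
   values of cmap and cinv outside cdom and cimg are irrelevant. *)
Record chart (R : realType) (T : topologicalType) (n : nat) := Chart {
  cdom : set T;
  cimg : set 'rV[R]_n;
  cmap : T -> 'rV[R]_n;
  cinv : 'rV[R]_n -> T;
  cdom_open : open cdom;
  cimg_open : open cimg;
  cmapP : forall p, cdom p -> cimg (cmap p) /\ cinv (cmap p) = p;
  cinvP : forall x, cimg x -> cdom (cinv x) /\ cmap (cinv x) = x;
  cmap_continuous : forall p, cdom p -> {for p, continuous cmap};
  cinv_continuous : forall x, cimg x -> {for x, continuous cinv}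
}.

Definition transition (R : realType) (T : topologicalType) (n : nat)
    (c d : chart R T n) : 'rV[R]_n -> 'rV[R]_n :=
  cmap d \o cinv c.

Definition overlap (R : realType) (T : topologicalType) (n : nat)
    (c d : chart R T n) : set 'rV[R]_n :=
  cmap c @` (cdom c `&` cdom d).

Record manifold (R : realType) (n : nat) := Manifold {
  carrier :> topologicalType;
  manifold_hausdorff : hausdorff_space carrier;
  manifold_second_countable : @second_countable carrier;
  manifold_connected : connected [set: carrier];
  atlas : set (chart R carrier n);
  atlas_cover : forall p : carrier, exists2 c, atlas c & cdom c p;
  atlas_smooth : forall c d, atlas c -> atlas d ->
    smooth_on (overlap c d) (transition c d)
}.

(* In a chart, a tangent vector is the row vector of its components in the
   coordinate basis, and G is the Gram matrix of that basis. *)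
Definition form (R : realType) (n : nat) (G : 'M[R]_n) (u v : 'rV[R]_n) : R :=
  (u *m G *m v^T) 0 0.

(* Given in every chart of the atlas by its Gram matrix, as a function of the
   coordinates. *)
Record riemannian (R : realType) (n : nat) := Riemannian {
  base :> manifold R n;
  metric : chart R base n -> 'rV[R]_n -> 'M[R]_n;
  metric_smooth : forall c, atlas c -> smooth_on (cimg c) (metric c);
  metric_sym : forall c x, atlas c -> cimg c x ->
    forall u v, form (metric c x) u v = form (metric c x) v u;
  metric_pos : forall c x, atlas c -> cimg c x ->
    forall u, u != 0 -> 0 < form (metric c x) u u;
  metric_compat : forall c d x, atlas c -> atlas d -> overlap c d x ->
    forall u v, form (metric c x) u v =
      form (metric d (transition c d x))
        ('D_u (transition c d) x) ('D_v (transition c d) x)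
}.

(* The vector w such that form G w v = phi v for all v, when phi is linear and
   G is invertible. *)
Definition sharp (R : realType) (n : nat) (G : 'M[R]_n)
    (phi : 'rV[R]_n -> R) : 'rV[R]_n :=
  (\row_j phi (delta_mx 0 j)) *m invmx G.

(* Koszul's formula for constant (hence commuting) vector fields u, v, w. *)
Definition christoffel (R : realType) (n : nat) (g : 'rV[R]_n -> 'M[R]_n)
    (x u v : 'rV[R]_n) : 'rV[R]_n :=
  sharp (g x) (fun w : 'rV[R]_n =>
    2^-1 * ('D_u (fun y => form (g y) v w) x
            + 'D_v (fun y => form (g y) u w) x
            - 'D_w (fun y => form (g y) u v) x)).

Definition nabla (R : realType) (n : nat) (g : 'rV[R]_n -> 'M[R]_n)
    (X Y : 'rV[R]_n -> 'rV[R]_n) (x : 'rV[R]_n) : 'rV[R]_n :=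
  'D_(X x) Y x + christoffel g x (X x) (Y x).

Definition lie_bracket (R : realType) (n : nat)
    (X Y : 'rV[R]_n -> 'rV[R]_n) (x : 'rV[R]_n) : 'rV[R]_n :=
  'D_(X x) Y x - 'D_(Y x) X x.

Definition curvature_field (R : realType) (n : nat) (g : 'rV[R]_n -> 'M[R]_n)
    (X Y Z : 'rV[R]_n -> 'rV[R]_n) (x : 'rV[R]_n) : 'rV[R]_n :=
  nabla g X (nabla g Y Z) x - nabla g Y (nabla g X Z) x
  - nabla g (lie_bracket X Y) Z x.

(* By tensoriality the value at x may be computed on constant extensions. *)
Definition curvature (R : realType) (n : nat) (g : 'rV[R]_n -> 'M[R]_n)
    (x u v w : 'rV[R]_n) : 'rV[R]_n :=
  curvature_field g (fun=> u) (fun=> v) (fun=> w) x.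

(* B X Y Z is the image of Z by the endomorphism B(X,Y). *)
Definition endo2 (R : realType) (n : nat) :=
  'rV[R]_n -> 'rV[R]_n -> 'rV[R]_n -> 'rV[R]_n.

Definition tensor4 (R : realType) (n : nat) :=
  'rV[R]_n -> 'rV[R]_n -> 'rV[R]_n -> 'rV[R]_n -> R.

Definition tensor6 (R : realType) (n : nat) :=
  'rV[R]_n -> 'rV[R]_n -> 'rV[R]_n -> 'rV[R]_n -> 'rV[R]_n -> 'rV[R]_n -> R.

Definition wedge (R : realType) (n : nat) (A : 'rV[R]_n -> 'rV[R]_n -> R)
    : endo2 R n :=
  fun X Y Z => A Y Z *: X - A X Z *: Y.

Definition lower (R : realType) (n : nat) (G : 'M[R]_n) (B : endo2 R n)
    : tensor4 R n :=
  fun X Y Z W => form G (B X Y Z) W.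

Definition ricci (R : realType) (n : nat) (Rm : endo2 R n)
    (X Y : 'rV[R]_n) : R :=
  \tr (lin1_mx (fun Z => Rm Z X Y)).

Definition ricci_op (R : realType) (n : nat) (G : 'M[R]_n) (Rm : endo2 R n)
    (X : 'rV[R]_n) : 'rV[R]_n :=
  sharp G (ricci Rm X).

Definition scalar_curv (R : realType) (n : nat) (G : 'M[R]_n) (Rm : endo2 R n)
    : R :=
  \tr (lin1_mx (ricci_op G Rm)).

Definition weyl_op (R : realType) (n : nat) (G : 'M[R]_n) (Rm : endo2 R n)
    : endo2 R n :=
  fun X Y Z => let S := ricci_op G Rm in
    Rm X Y Z - (n%:R - 2)^-1 *:
      (wedge (form G) X (S Y) Z + wedge (form G) (S X) Y Z
       - (scalar_curv G Rm / (n%:R - 1)) *: wedge (form G) X Y Z).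

Definition dot (R : realType) (n : nat) (B : endo2 R n) (T : tensor4 R n)
    : tensor6 R n :=
  fun X1 X2 X3 X4 X Y =>
    - (T (B X Y X1) X2 X3 X4 + T X1 (B X Y X2) X3 X4
       + T X1 X2 (B X Y X3) X4 + T X1 X2 X3 (B X Y X4)).

Definition lin_dep6 (R : realType) (n : nat) (T1 T2 : tensor6 R n) : Prop :=
  exists a b : R, (a != 0 \/ b != 0) /\
    forall X1 X2 X3 X4 X Y : 'rV[R]_n,
      a * T1 X1 X2 X3 X4 X Y + b * T2 X1 X2 X3 X4 X Y = 0.

Section Intrinsic.
Context (R : realType) (n : nat) (M : riemannian R n).
Implicit Types (c : chart R M n) (p : M).

(* From here on, tangent vectors at p are given by their components in the
   chart c, and tangent vectors of N at f p by their components in d. *)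
Definition gram c p : 'M[R]_n := metric c (cmap c p).

Definition Rop c p : endo2 R n := curvature (metric c) (cmap c p).

Definition Rtensor c p : tensor4 R n := lower (gram c p) (Rop c p).

Definition Ctensor c p : tensor4 R n :=
  lower (gram c p) (weyl_op (gram c p) (Rop c p)).

Definition RdotC c p : tensor6 R n := dot (Rop c p) (Ctensor c p).

Definition QgR c p : tensor6 R n :=
  dot (wedge (form (gram c p))) (Rtensor c p).

Definition sectional c p (X Y : 'rV[R]_n) : R :=
  Rtensor c p X Y Y X /
  (form (gram c p) X X * form (gram c p) Y Y - form (gram c p) X Y ^+ 2).

(* The Gram determinant below vanishes exactly when X and Y are linearly
   dependent. *)
Definition constant_curvature (k : R) : Prop :=
  forall c p, atlas c -> cdom c p -> forall X Y : 'rV[R]_n,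
    form (gram c p) X X * form (gram c p) Y Y - form (gram c p) X Y ^+ 2 != 0 ->
    sectional c p X Y = k.

Definition linearly_dependent
    (T1 T2 : forall (c : chart R M n) (p : M), tensor6 R n) : Prop :=
  forall c p, atlas c -> cdom c p -> lin_dep6 (T1 c p) (T2 c p).

(* The definition used for dimension n >= 4: the Weyl tensor vanishes. *)
Definition conformally_flat : Prop :=
  forall c p, atlas c -> cdom c p ->
    forall X Y Z W : 'rV[R]_n, Ctensor c p X Y Z W = 0.

(* Only the values of a local orthonormal frame at p enter the definitions
   below, and every orthonormal basis at p extends to a local frame. *)
Definition orthonormal_basis c p (E : 'I_n -> 'rV[R]_n) : Prop :=
  forall i j, form (gram c p) (E i) (E j) = (i == j)%:R.

Definition rho c p (E : 'I_n -> 'rV[R]_n) : R :=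
  2 / (n%:R * (n%:R - 1)) *
  \sum_(i < n) \sum_(j < n | (i < j)%N) Rtensor c p (E i) (E j) (E j) (E i).

End Intrinsic.

Section Extrinsic.
Context (R : realType) (n m : nat).
Context (M : riemannian R n) (N : riemannian R (n + m)) (f : M -> N).
Implicit Types (c : chart R M n) (d : chart R N (n + m)) (p : M).

Definition local_rep c d : 'rV[R]_n -> 'rV[R]_(n + m) :=
  cmap d \o f \o cinv c.

(* Preservation of the metrics makes the differential injective and the metric
   of M the induced one. *)
Definition isometric_immersion : Prop :=
  continuous f /\
  forall c d, atlas c -> atlas d ->
    smooth_on (cmap c @` (cdom c `&` f @^-1` cdom d)) (local_rep c d) /\
    (forall p, cdom c p -> cdom d (f p) -> forall u v : 'rV[R]_n,
      form (gram c p) u v =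
      form (gram d (f p)) ('D_u (local_rep c d) (cmap c p))
                          ('D_v (local_rep c d) (cmap c p))).

(* Gauss formula: the covariant derivative along f (in N) of df(Y) in the
   direction X, minus df(nabla_X Y), for constant X and Y. *)
Definition second_ff c d p (X Y : 'rV[R]_n) : 'rV[R]_(n + m) :=
  let F := local_rep c d in
  let x := cmap c p in
  'D_X (fun y => 'D_Y F y) x
  + christoffel (metric d) (cmap d (f p)) ('D_X F x) ('D_Y F x)
  - 'D_(christoffel (metric c) x X Y) F x.

Definition shape c d p (xi : 'rV[R]_(n + m)) (X : 'rV[R]_n) : 'rV[R]_n :=
  sharp (gram c p) (fun Y => form (gram d (f p)) xi (second_ff c d p X Y)).

Definition orthonormal_normal_basis c d p (xi : 'I_m -> 'rV[R]_(n + m)) : Prop :=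
  (forall a b, form (gram d (f p)) (xi a) (xi b) = (a == b)%:R) /\
  (forall a (u : 'rV[R]_n),
    form (gram d (f p)) (xi a) ('D_u (local_rep c d) (cmap c p)) = 0).

Definition mean_curv_vec c d p (E : 'I_n -> 'rV[R]_n) : 'rV[R]_(n + m) :=
  n%:R^-1 *: \sum_(i < n) second_ff c d p (E i) (E i).

Definition mean_curv c d p (E : 'I_n -> 'rV[R]_n) : R :=
  Num.sqrt (form (gram d (f p)) (mean_curv_vec c d p E)
                                (mean_curv_vec c d p E)).

Definition Rperp c d p (X Y : 'rV[R]_n) (xi eta : 'rV[R]_(n + m)) : R :=
  form (gram c p)
    (shape c d p xi (shape c d p eta X) - shape c d p eta (shape c d p xi X)) Y.

Definition rho_perp c d p (E : 'I_n -> 'rV[R]_n)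
    (xi : 'I_m -> 'rV[R]_(n + m)) : R :=
  2 / (n%:R * (n%:R - 1)) *
  Num.sqrt (\sum_(i < n) \sum_(j < n | (i < j)%N)
            \sum_(a < m) \sum_(b < m | (a < b)%N)
              Rperp c d p (E i) (E j) (xi a) (xi b) ^+ 2).

Definition wintgen_ideal (k : R) : Prop :=
  forall c d p, atlas c -> cdom c p -> atlas d -> cdom d (f p) ->
  forall (E : 'I_n -> 'rV[R]_n) (xi : 'I_m -> 'rV[R]_(n + m)),
    orthonormal_basis c p E -> orthonormal_normal_basis c d p xi ->
    rho c p E = mean_curv c d p E ^+ 2 - rho_perp c d p E xi + k.

Definition totally_umbilical : Prop :=
  forall c d p, atlas c -> cdom c p -> atlas d -> cdom d (f p) ->
  forall E : 'I_n -> 'rV[R]_n, orthonormal_basis c p E ->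
  forall X Y : 'rV[R]_n,
    second_ff c d p X Y = form (gram c p) X Y *: mean_curv_vec c d p E.

End Extrinsic.

(* Main.v *)
(* Fix a point and orthonormal frames, and let B_a be the traceless parts of
   the shape operators A_a.  By the Gauss equation, equality in the Wintgen
   inequality says (sum |B_a|^2)^2 = sum |[B_a, B_b]|^2, the equality case of
   the DDVV inequality.  The latter follows from a bound
   sum_b |[a, b]|^2 <= r for unit vectors a of the span of an orthonormal family
   of r symmetric matrices: with a diagonal this is an Anderson-Morley bound for
   a weighted graph Laplacian.  In the equality case all B_a lie in the span of
   E_ii - E_jj and E_ij + E_ji for one pair i, j.  Hence the curvature tensor of
   M is K times the constant curvature tensor, plus g wedge T with T traceless
   in the plane (i, j), plus P times the square of the area form of that plane,
   where K >= k > 0 and P <= 0 vanishes exactly at umbilical points.  Four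
   components of the linear dependence of R.C and Q(g, R), which involve two
   directions orthogonal to the plane, force P = 0.  Conversely, at umbilical
   points R has constant curvature type, so C = 0. *)

(* Only the equality case of DDVV is wanted, so the inequality is proved in a form whose slack can
   be followed. Diagonalizing the Gram matrix of the B_a replaces them by sqrt(x_g) a_g with
   orthonormal a_g and x >= 0. The inequality becomes sum c_gh x_g x_h <= (sum x_g)^2 with c_gh =
   |[a_g, a_h]|^2, and x is peeled into indicator vectors. For these only the row bounds sum_h c_gh
   <= r count, and they must be known for every subfamily. Equality makes the bound sharp on the
   whole span of the family. A saturated edge (i, j) of the graph puts E_ij + E_ji into this span;
   sharpness at that one matrix forces the family to have exactly two members, spanning E_ii - E_jj
   and E_ij + E_ji. The sign of k enters through K = k + sum t_a^2 > 0. Write al for the diagonal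
   entry of T. The linear dependence controls (K + al) P and (K - al) P, neither of whose first
   factors has a known sign; their sum 2 K P does. On the analytic side everything is computed in
   one pair of charts with constant coordinate fields, so that the Gauss equation reduces to
   derivatives of the Koszul formula and to the symmetry of second derivatives. *)
From HB Require Import structures.
From mathcomp Require Import all_boot all_order all_algebra.
From mathcomp Require Import complex ring lra.

Set Implicit Arguments.
Unset Strict Implicit.
Unset Printing Implicit Defensive.

Import Order.TTheory GRing.Theory Num.Theory.

Local Open Scope ring_scope.

(** * Orthonormal completion and the real spectral theorem *)

Section Orthonormal.
Variables (R : rcfType) (N : nat) (G : 'M[R]_N).
Hypothesis G_sym : G^T = G.
Hypothesis G_pos : forall u : 'rV[R]_N, u != 0 -> 0 < (u *m G *m u^T) 0 0.

Lemma exists_unit_orthogonal k (U : 'M[R]_(k, N)) : (k < N)%N ->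
  exists w : 'rV[R]_N, w *m G *m w^T = 1%:M /\ w *m G *m U^T = 0.
Proof.
move=> kN; set M := G *m U^T.
have kM : kermx M != 0.
  rewrite -mxrank_eq0 mxrank_ker -lt0n subn_gt0.
  exact: leq_ltn_trans (rank_leq_col _) kN.
pose w := nz_row (kermx M).
have w0 : w != 0 by rewrite nz_row_eq0.
have wM : w *m G *m U^T = 0.
  by rewrite -mulmxA; apply/sub_kermxP; exact: nz_row_sub.
have := G_pos w0; set c := (w *m G *m w^T) 0 0 => c0.
exists ((Num.sqrt c)^-1 *: w); split; last first.
  by rewrite -!scalemxAl wM scaler0.
rewrite linearZ /= -!scalemxAl -!scalemxAr scalerA [w *m G *m w^T]mx11_scalar.
rewrite -/c -mul_scalar_mx -scalar_mxM; congr (_%:M).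
rewrite -expr2 exprVn sqr_sqrtr ?ltW // mulVf //; exact: lt0r_neq0.
Qed.

(** The form [G] is arbitrary because the lemma serves three purposes: the spectral theorem (with
    [G = 1]), tangent frames, and normal frames completing the image of a tangent frame. *)
Lemma orthonormal_completion q k (U : 'M[R]_(k, N)) : (k + q <= N)%N ->
  U *m G *m U^T = 1%:M ->
  exists W : 'M[R]_(q, N), W *m G *m W^T = 1%:M /\ W *m G *m U^T = 0.
Proof.
elim: q k U => [|q IH] k U kN UU.
  by exists 0; split; rewrite ?mul0mx //; apply/matrixP => -[].
have [|w [ww wU]] := @exists_unit_orthogonal k U.
  by rewrite (leq_trans _ kN) // addnS ltnS leq_addr.
have Uw : U *m G *m w^T = 0.
  by apply: trmx_inj; rewrite !trmx_mul trmxK G_sym mulmxA wU trmx0.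
have [||W [WW WU]] := IH (1 + k)%N (col_mx w U).
- by rewrite add1n addSnnS.
- by rewrite mul_col_mx tr_col_mx mul_col_row ww wU Uw UU -scalar_mx_block.
move: WU; rewrite tr_col_mx mul_mx_row => /eqP.
rewrite row_mx_eq0 => /andP[/eqP Ww /eqP WU].
have wW : w *m G *m W^T = 0.
  by apply: trmx_inj; rewrite !trmx_mul trmxK G_sym mulmxA Ww trmx0.
pose C : 'M[R]_(1 + q, N) := col_mx w W.
have CC : C *m G *m C^T = 1%:M.
  by rewrite mul_col_mx tr_col_mx mul_col_row ww wW Ww WW -scalar_mx_block.
have CU : C *m G *m U^T = 0 by rewrite !mul_col_mx wU WU col_mx0.
by exists C.
Qed.

End Orthonormal.

Lemma form1_pos (R : realDomainType) n (u : 'rV[R]_n) :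
  u != 0 -> 0 < (u *m u^T) 0 0.
Proof.
move=> u0; rewrite lt_neqAle; apply/andP; split; last first.
  by rewrite mxE sumr_ge0 // => i _; rewrite mxE -expr2 sqr_ge0.
apply: contraNneq u0 => /esym; rewrite mxE => /eqP.
rewrite psumr_eq0 => [/allP h|i _]; last by rewrite mxE -expr2 sqr_ge0.
apply/eqP/rowP => i; move: (h i); rewrite mem_index_enum => /(_ isT).
by rewrite !mxE -expr2 sqrf_eq0 => /eqP.
Qed.

(** An eigenvalue exists over the closed field [R[i]]. It is real because v A v^* equals both a
    |v|^2 and its conjugate, and a real root of the characteristic polynomial has a real
    eigenvector. *)
Lemma symmetric_eigenvector (R : rcfType) n (A : 'M[R]_n.+1) : A^T = A ->
  exists a (v : 'rV[R]_n.+1), v != 0 /\ v *m A = a *: v.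
Proof.
move=> As.
pose f : {rmorphism R -> R[i]} := real_complex R.
have [a /eigenvalueP[v vA v0]] := eigenvalue_closed (map_mx f A) isT.
have ra : a^* = a.
  pose vs := map_mx Num.conj v.
  have n0 : (v *m vs^T) 0 0 != 0.
    rewrite mxE; apply: contra v0 => /eqP.
    under eq_bigr do rewrite !mxE -normCK.
    move=> /eqP; rewrite psumr_eq0 => [/allP h|i _]; last by rewrite exprn_ge0.
    apply/eqP/rowP => i; move: (h i); rewrite mem_index_enum => /(_ isT).
    by rewrite !mxE sqrf_eq0 normr_eq0 => /eqP.
  have cA : map_mx Num.conj (map_mx f A) = map_mx f A.
    apply/matrixP => i j; rewrite !mxE; apply/CrealP.
    by rewrite complex_real.
  have vAs : vs *m map_mx f A = a^* *: vs.
    by rewrite -{1}cA -map_mxM vA map_mxZ.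
  have : (v *m map_mx f A) *m vs^T = v *m (vs *m map_mx f A)^T.
    rewrite trmx_mul (_ : (map_mx f A)^T = map_mx f A) ?mulmxA //.
    by apply/matrixP => i j; rewrite !mxE -{1}As mxE.
  rewrite vA vAs linearZ /= -scalemxAl -scalemxAr => /(congr1 (fun M : 'M_1 => M 0 0)).
  by rewrite mxE [RHS]mxE => /(mulIf n0).
have [b ab] : exists b, a = f b.
  exists (complex.Re a); apply/esym/RRe_real; exact/CrealP.
have : eigenvalue A b.
  rewrite eigenvalue_root_char -(fmorph_root f) -/(map_poly f _).
  rewrite map_char_poly -ab -eigenvalue_root_char.
  by apply/eigenvalueP; exists v.
by move=> /eigenvalueP[u uA u0]; exists b, u.
Qed.

Lemma symmetric_spectral (R : rcfType) n (A : 'M[R]_n) : A^T = A ->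
  exists (P : 'M[R]_n) (d : 'rV[R]_n),
    P *m P^T = 1%:M /\ P *m A *m P^T = diag_mx d.
Proof.
elim: n A => [|n IH] A As.
  by exists 0, 0; split; apply/matrixP => -[].
have [a [v0 [v00 v0A]]] := symmetric_eigenvector As.
set c := (v0 *m v0^T) 0 0.
have c0 : 0 < c := form1_pos v00.
pose v := (Num.sqrt c)^-1 *: v0.
have vv : v *m 1%:M *m v^T = 1%:M.
  rewrite mulmx1 linearZ /= -!scalemxAl -!scalemxAr scalerA [v0 *m v0^T]mx11_scalar.
  rewrite -/c -mul_scalar_mx -scalar_mxM; congr (_%:M).
  by rewrite -expr2 exprVn sqr_sqrtr ?ltW // mulVf // lt0r_neq0.
have vA : v *m A = a *: v by rewrite -scalemxAl v0A scalerA mulrC -scalerA.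
clearbody v.
have G_pos (u : 'rV[R]_n.+1) : u != 0 -> 0 < (u *m 1%:M *m u^T) 0 0.
  by rewrite mulmx1; exact: form1_pos.
have [W [WW Wv]] :=
  orthonormal_completion (trmx1 _ _) G_pos (leqnn (1 + n)) vv.
move: WW Wv vv; rewrite !mulmx1 => WW Wv vv.
have vW : v *m W^T = 0 by apply: trmx_inj; rewrite trmx_mul trmxK Wv trmx0.
(* The rows of [W] span the orthogonal complement of the eigenvector, which [A] preserves by
   symmetry; the induction diagonalizes [A] there. *)
have [|Q [d [QQ QA]]] := IH (W *m A *m W^T).
  by rewrite !trmx_mul trmxK As mulmxA.
pose P0 : 'M[R]_(1 + n, n.+1) := col_mx v W.
have P0P : P0 *m P0^T = 1%:M.
  by rewrite /P0 tr_col_mx mul_col_row vv vW Wv WW -scalar_mx_block.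
have P0A : P0 *m A *m P0^T = block_mx a%:M 0 0 (W *m A *m W^T).
  rewrite /P0 tr_col_mx mul_col_mx mul_col_row vA -!scalemxAl vv vW scaler0.
  rewrite scalemx1 -mulmxA; congr block_mx.
  have -> : A *m v^T = a *: v^T by rewrite -{1}As -trmx_mul vA linearZ.
  by rewrite -scalemxAr Wv scaler0.
pose B : 'M[R]_(1 + n) := block_mx 1%:M 0 0 Q.
have BB : B *m B^T = 1%:M.
  rewrite /B tr_block_mx mulmx_block.
  by rewrite !(trmx0, trmx1, mulmx0, mul0mx, mulmx1, addr0, add0r) QQ -scalar_mx_block.
have BA : B *m block_mx a%:M 0 0 (W *m A *m W^T) *m B^T
    = diag_mx (row_mx a%:M d).
  rewrite /B tr_block_mx !mulmx_block.
  rewrite !(trmx0, trmx1, mulmx0, mul0mx, mulmx1, mul1mx, addr0, add0r) QA.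
  rewrite diag_mx_row; congr block_mx.
  by apply/matrixP => i j; rewrite !ord1 !mxE.
exists (B *m P0), (row_mx a%:M d); split.
  by rewrite trmx_mul mulmxA -(mulmxA B) P0P mulmx1; exact: BB.
by rewrite trmx_mul !mulmxA -(mulmxA B) -(mulmxA B) P0A; exact: BA.
Qed.

(** * The equality case of the DDVV inequality *)

(** Lagrange's identity: twice the gap between the two sides is the sum of w_i w_j (x_i y_j - x_j
    y_i)^2. *)
Lemma weighted_cauchy_schwarz (R : realFieldType) (I : finType)
    (w x y : I -> R) : (forall i, 0 <= w i) ->
  (\sum_i w i * (x i * y i)) ^+ 2 <=
  (\sum_i w i * x i ^+ 2) * (\sum_i w i * y i ^+ 2).
Proof.
move=> w0.
have S0 : 0 <= \sum_i \sum_j w i * w j * (x i * y j - x j * y i) ^+ 2.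
  apply: sumr_ge0 => i _; apply: sumr_ge0 => j _.
  by rewrite mulr_ge0 ?sqr_ge0 ?mulr_ge0.
have SE : \sum_i \sum_j w i * w j * (x i * y j - x j * y i) ^+ 2 =
  2 * ((\sum_i w i * x i ^+ 2) * (\sum_i w i * y i ^+ 2))
  - 2 * (\sum_i w i * (x i * y i)) ^+ 2.
  have E : \sum_i \sum_j w i * w j * (x i * y j - x j * y i) ^+ 2 =
    \sum_i \sum_j ((w i * x i ^+ 2) * (w j * y j ^+ 2))
    + \sum_i \sum_j ((w j * x j ^+ 2) * (w i * y i ^+ 2))
    - 2 * \sum_i \sum_j ((w i * (x i * y i)) * (w j * (x j * y j))).
    rewrite mulr_sumr -big_split -sumrB; apply: eq_bigr => i _ /=.
    rewrite mulr_sumr -big_split -sumrB; apply: eq_bigr => j _ /=; ring.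
  rewrite E [X in _ + X - _]exchange_big /= expr2 !big_distrlr /=; ring.
by move: S0; rewrite SE; lra.
Qed.

(** * The edge-degree bound for a weighted graph Laplacian *)

Section Laplacian.
Variables (R : realFieldType) (n : nat) (w : 'I_n -> 'I_n -> R).
Hypothesis w_sym : forall i j, w i j = w j i.
Hypothesis w_diag : forall i, w i i = 0.
Hypothesis w_ge0 : forall i j, 0 <= w i j.
Local Notation deg i := (\sum_j w i j).

(** The degrees add up to twice the total weight, of which the edges meeting i or j make up
    [deg i + deg j - w i j]. *)
Lemma edge_degree_le i j : i != j ->
  2 * (deg i + deg j) <= \sum_k deg k + 2 * w i j.
Proof.
move=> ij.
have split2 (F : 'I_n -> R) :
    \sum_k F k = F i + F j + \sum_(k | (k != i) && (k != j)) F k.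
  by rewrite (bigD1 i) //= (bigD1 j) ?[j == i]eq_sym //= addrA.
rewrite [X in _ <= X + _]split2.
have : \sum_(k | (k != i) && (k != j)) (w i k + w j k)
    <= \sum_(k | (k != i) && (k != j)) deg k.
  apply: ler_sum => k _; rewrite split2 !(w_sym k) lerDl.
  by apply: sumr_ge0.
rewrite big_split /=.
have := split2 (w i); have := split2 (w j); rewrite !w_diag (w_sym j i); lra.
Qed.

Variables (l : 'I_n -> R) (s : R).
Hypothesis w_le1 : forall i j, w i j <= 1.
Hypothesis w_sum : \sum_i deg i <= 2 * s.
Hypothesis l_unit : \sum_i l i ^+ 2 = 1.
Local Notation energy := (\sum_i \sum_j w i j * (l i - l j) ^+ 2).

(** By [edge_degree_le], [w_sum] and [w_le1], every edge degree is at most s + w_ij <= s + 1. *)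
Let edge_term i j :
  0 <= w i j * (l i - l j) ^+ 2 * (s + 1 - (deg i + deg j)).
Proof.
have [->|ij] := eqVneq i j; first by rewrite subrr expr0n mulr0 mul0r.
apply: mulr_ge0; first by rewrite mulr_ge0 ?sqr_ge0.
by have := edge_degree_le ij; have := w_le1 i j; move: w_sum; lra.
Qed.

(* The Anderson-Morley bound on the largest Laplacian eigenvalue by the maximal
   edge degree, in the form E^2 <= |L l|^2 <= (Laplacian energy weighted by
   edge degrees). *)
Lemma energy_sqr_le :
  energy ^+ 2 <=
  2 * \sum_i \sum_j w i j * (l i - l j) ^+ 2 * (deg i + deg j).
Proof.
pose g i := \sum_j w i j * (l i - l j).
have Eg : energy = 2 * \sum_i 1 * (l i * g i).
  have -> : \sum_i 1 * (l i * g i) = \sum_i \sum_j w i j * (l i * (l i - l j)).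
    apply: eq_bigr => i _; rewrite mul1r mulr_sumr; apply: eq_bigr => j _; ring.
  rewrite mulr_natl mulr2n [X in _ = _ + X]exchange_big /= -big_split.
  apply: eq_bigr => i _ /=; rewrite -big_split; apply: eq_bigr => j _ /=.
  by rewrite (w_sym j i); ring.
have cs1 := weighted_cauchy_schwarz l g (fun _ => ler01).
have cs2 i : g i ^+ 2 <= deg i * \sum_j w i j * (l i - l j) ^+ 2.
  have := weighted_cauchy_schwarz (fun _ => 1) (fun j => l i - l j) (w_ge0 i).
  rewrite /g; under [X in X ^+ 2 <= _]eq_bigr do rewrite mul1r.
  by under [X in X * _]eq_bigr do rewrite expr1n mulr1.
have D : \sum_i \sum_j w i j * (l i - l j) ^+ 2 * (deg i + deg j) =
    2 * \sum_i deg i * \sum_j w i j * (l i - l j) ^+ 2.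
  rewrite mulr_natl mulr2n.
  under eq_bigr do under eq_bigr do rewrite mulrDr.
  under eq_bigr do rewrite big_split /=.
  rewrite big_split /= [X in _ + X]exchange_big /=; congr (_ + _).
    by apply: eq_bigr => i _; rewrite mulr_sumr; apply: eq_bigr => j _; ring.
  apply: eq_bigr => i _; rewrite mulr_sumr; apply: eq_bigr => j _.
  by rewrite (w_sym j i); ring.
have cs2s : \sum_i 1 * g i ^+ 2 <=
    \sum_i deg i * \sum_j w i j * (l i - l j) ^+ 2.
  by apply: ler_sum => i _; rewrite mul1r.
rewrite Eg D exprMn; move: cs1.
under [X in X * _]eq_bigr do rewrite mul1r.
rewrite l_unit mul1r; lra.
Qed.

(** With edge degrees bounded by s + 1, [energy_sqr_le] reads E^2 <= 2 (s + 1) E. *)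
Lemma energy_le : 0 <= s + 1 -> energy <= 2 * (s + 1).
Proof.
move=> s1.
have E0 : 0 <= energy.
  by do 2!(apply: sumr_ge0 => ? _); rewrite mulr_ge0 ?sqr_ge0.
have : \sum_i \sum_j w i j * (l i - l j) ^+ 2 * (deg i + deg j)
    <= (s + 1) * energy.
  rewrite mulr_sumr; apply: ler_sum => i _; rewrite mulr_sumr.
  by apply: ler_sum => j _; have := edge_term i j; lra.
by have := energy_sqr_le; nra.
Qed.

(** Equality annihilates every term of [edge_term]. Some edge carries energy, so its edge degree is
    exactly s + 1, and [edge_degree_le] then leaves no room for a weight below 1. *)
Lemma energy_eq : 0 < s + 1 -> energy = 2 * (s + 1) ->
  exists i j, [/\ i != j, w i j = 1 & deg i + deg j = s + 1].
Proof.
move=> s1 Es.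
have : \sum_i \sum_j w i j * (l i - l j) ^+ 2 * (s + 1 - (deg i + deg j)) <= 0.
  have -> : \sum_i \sum_j w i j * (l i - l j) ^+ 2 * (s + 1 - (deg i + deg j))
    = (s + 1) * energy
      - \sum_i \sum_j w i j * (l i - l j) ^+ 2 * (deg i + deg j).
    rewrite mulr_sumr -sumrB; apply: eq_bigr => i _.
    by rewrite mulr_sumr -sumrB; apply: eq_bigr => j _; ring.
  by have := energy_sqr_le; rewrite Es; nra.
move=> le0.
have term0 i j : w i j * (l i - l j) ^+ 2 * (s + 1 - (deg i + deg j)) = 0.
  have sum0 k : 0 <=
      \sum_j w k j * (l k - l j) ^+ 2 * (s + 1 - (deg k + deg j)).
    by apply: sumr_ge0.
  have /eqP : \sum_i \sum_j
      w i j * (l i - l j) ^+ 2 * (s + 1 - (deg i + deg j)) = 0.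
    by apply/eqP; rewrite eq_le le0 sumr_ge0.
  rewrite psumr_eq0 // => /allP/(_ i (mem_index_enum _)) /=.
  by rewrite psumr_eq0 // => /allP/(_ j (mem_index_enum _)) /= /eqP.
have [/forallP h0|] := boolP [forall i, forall j, w i j * (l i - l j) ^+ 2 == 0].
  suff : energy = 0 by rewrite Es => /eqP; lra.
  by apply: big1 => i _; apply: big1 => j _; have /forallP/(_ j)/eqP := h0 i.
move=> /forallPn[i /forallPn[j nz]].
have ij : i != j by apply: contraNneq nz => ->; rewrite subrr expr0n mulr0.
have /eqP := term0 i j; rewrite mulf_eq0 (negbTE nz) /= => /eqP dE.
exists i, j; split => //; last by lra.
have := edge_degree_le ij; have := w_le1 i j; move: w_sum dE; lra.
Qed.

End Laplacian.

(** * The Frobenius product, commutators and orthogonal conjugation *)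

Section Frobenius.
Variables (R : realFieldType) (n : nat).
Implicit Types A B C P : 'M[R]_n.

Definition mxdot A B : R := \tr (A *m B^T).

Lemma mxdotE A B : mxdot A B = \sum_i \sum_j A i j * B i j.
Proof.
by apply: eq_bigr => i _; rewrite mxE; apply: eq_bigr => j _; rewrite mxE.
Qed.

Lemma mxdotC A B : mxdot A B = mxdot B A.
Proof. by rewrite /mxdot -mxtrace_tr trmx_mul trmxK. Qed.

Lemma mxdotDl A B C : mxdot (A + B) C = mxdot A C + mxdot B C.
Proof. by rewrite /mxdot mulmxDl mxtraceD. Qed.

Lemma mxdotZl c A B : mxdot (c *: A) B = c * mxdot A B.
Proof. by rewrite /mxdot -scalemxAl mxtraceZ. Qed.

Lemma mxdotBl A B C : mxdot (A - B) C = mxdot A C - mxdot B C.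
Proof. by rewrite -scaleN1r mxdotDl mxdotZl mulN1r. Qed.

Lemma mxdotDr A B C : mxdot A (B + C) = mxdot A B + mxdot A C.
Proof. by rewrite mxdotC mxdotDl !(mxdotC A). Qed.

Lemma mxdotZr c A B : mxdot A (c *: B) = c * mxdot A B.
Proof. by rewrite mxdotC mxdotZl mxdotC. Qed.

Lemma mxdotBr A B C : mxdot A (B - C) = mxdot A B - mxdot A C.
Proof. by rewrite mxdotC mxdotBl !(mxdotC A). Qed.

Lemma mxdot_suml (I : finType) (S : pred I) (F : I -> 'M[R]_n) B :
  mxdot (\sum_(i | S i) F i) B = \sum_(i | S i) mxdot (F i) B.
Proof. by rewrite /mxdot mulmx_suml raddf_sum. Qed.

Lemma mxdot_sumr (I : finType) (S : pred I) A (F : I -> 'M[R]_n) :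
  mxdot A (\sum_(i | S i) F i) = \sum_(i | S i) mxdot A (F i).
Proof. by rewrite mxdotC mxdot_suml; apply: eq_bigr => i _; rewrite mxdotC. Qed.

Lemma mxdot_ge0 A : 0 <= mxdot A A.
Proof. by rewrite mxdotE; do 2!apply: sumr_ge0 => ? _; rewrite -expr2 sqr_ge0. Qed.

Lemma mxdot_eq0 A : mxdot A A = 0 -> A = 0.
Proof.
move=> /eqP; rewrite mxdotE psumr_eq0 => [/allP h|i _]; last first.
  by apply: sumr_ge0 => ? _; rewrite -expr2 sqr_ge0.
apply/matrixP => i j; have := h i (mem_index_enum _).
rewrite psumr_eq0 => [/allP/(_ j (mem_index_enum _))|k _].
  by rewrite -expr2 sqrf_eq0 mxE => /eqP.
by rewrite -expr2 sqr_ge0.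
Qed.

Definition commutator A B := A *m B - B *m A.

Lemma commutatorC A B : commutator A B = - commutator B A.
Proof. by rewrite /commutator opprB. Qed.

Lemma commutator_suml (I : finType) (S : pred I) (F : I -> 'M[R]_n) B :
  commutator (\sum_(i | S i) F i) B = \sum_(i | S i) commutator (F i) B.
Proof. by rewrite /commutator mulmx_suml mulmx_sumr -sumrB. Qed.

Lemma commutatorDl A B C :
  commutator (A + B) C = commutator A C + commutator B C.
Proof. by rewrite /commutator mulmxDl mulmxDr opprD addrACA. Qed.

Lemma commutatorZl c A B : commutator (c *: A) B = c *: commutator A B.
Proof. by rewrite /commutator -scalemxAl -scalemxAr scalerBr. Qed.

Lemma commutatorZr c A B : commutator A (c *: B) = c *: commutator A B.
Proof. by rewrite commutatorC commutatorZl commutatorC scalerN opprK. Qed.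

Definition cjmx P A := P *m A *m P^T.

Lemma mxdot_cj P A B : P *m P^T = 1%:M -> mxdot (cjmx P A) (cjmx P B) = mxdot A B.
Proof.
move=> /mulmx1C PP; rewrite /mxdot /cjmx !trmx_mul trmxK.
rewrite !mulmxA -(mulmxA (P *m A)) PP mulmx1 -!mulmxA mxtrace_mulC.
by rewrite -!mulmxA PP mulmx1.
Qed.

Lemma commutator_cj P A B : P *m P^T = 1%:M ->
  commutator (cjmx P A) (cjmx P B) = cjmx P (commutator A B).
Proof.
move=> /mulmx1C PP; rewrite /commutator /cjmx !mulmxA.
rewrite -(mulmxA (P *m A)) -(mulmxA (P *m B)) PP !mulmx1.
by rewrite mulmxBr mulmxBl !mulmxA.
Qed.

Lemma cjmx_sym P A : A^T = A -> (cjmx P A)^T = cjmx P A.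
Proof. by move=> As; rewrite /cjmx !trmx_mul trmxK As mulmxA. Qed.

Lemma cjmxD P A B : cjmx P (A + B) = cjmx P A + cjmx P B.
Proof. by rewrite /cjmx mulmxDr mulmxDl. Qed.

Lemma cjmxZ c P A : cjmx P (c *: A) = c *: cjmx P A.
Proof. by rewrite /cjmx -scalemxAr -scalemxAl. Qed.

Lemma cjmx_sum (I : finType) (S : pred I) P (F : I -> 'M[R]_n) :
  cjmx P (\sum_(i | S i) F i) = \sum_(i | S i) cjmx P (F i).
Proof. by rewrite /cjmx mulmx_sumr mulmx_suml. Qed.

End Frobenius.

(** * Orthonormal families of symmetric matrices and their weighted graph *)

Section OrthonormalFamily.
Variables (R : realFieldType) (n : nat) (I : finType) (S : {set I}).
Variable a : I -> 'M[R]_n.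
Hypothesis a_on : {in S &, forall i j, mxdot (a i) (a j) = (i == j)%:R}.

Lemma orthonormal_coef (x : I -> R) j : j \in S ->
  mxdot (\sum_(i in S) x i *: a i) (a j) = x j.
Proof.
move=> jS; rewrite mxdot_suml (bigD1 j) //= mxdotZl a_on // eqxx mulr1.
rewrite big1 ?addr0 // => i /andP[iS ij].
by rewrite mxdotZl a_on // (negbTE ij) mulr0.
Qed.

(** The slack in Bessel's inequality is the squared norm of the residual, so equality there detects
    membership in the span. *)
Lemma bessel_residual e :
  let e' := e - \sum_(i in S) mxdot e (a i) *: a i in
  mxdot e' e' = mxdot e e - \sum_(i in S) mxdot e (a i) ^+ 2.
Proof.
move=> e'; set p := \sum_(i in S) _ in e' *.
have ep : mxdot e p = \sum_(i in S) mxdot e (a i) ^+ 2.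
  by rewrite mxdot_sumr; apply: eq_bigr => i _; rewrite mxdotZr expr2.
have pp : mxdot p p = \sum_(i in S) mxdot e (a i) ^+ 2.
  rewrite {2}/p mxdot_sumr; apply: eq_bigr => i iS.
  by rewrite mxdotZr orthonormal_coef // expr2.
by rewrite mxdotBl !mxdotBr (mxdotC p e) ep pp; ring.
Qed.

Lemma bessel e : \sum_(i in S) mxdot e (a i) ^+ 2 <= mxdot e e.
Proof. by rewrite -subr_ge0 -bessel_residual mxdot_ge0. Qed.

Lemma bessel_eq e : \sum_(i in S) mxdot e (a i) ^+ 2 = mxdot e e ->
  e = \sum_(i in S) mxdot e (a i) *: a i.
Proof.
move=> E; apply/eqP; rewrite -subr_eq0; apply/eqP/mxdot_eq0.
by rewrite bessel_residual E subrr.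
Qed.

Lemma orthonormal_norm (x : I -> R) :
  mxdot (\sum_(i in S) x i *: a i) (\sum_(i in S) x i *: a i)
  = \sum_(i in S) x i ^+ 2.
Proof.
rewrite mxdot_sumr; apply: eq_bigr => j jS.
by rewrite mxdotZr orthonormal_coef // expr2.
Qed.

(** Weights of a graph on the indices, chosen so that its Laplacian energy at the eigenvalues of a
    diagonal matrix measures the commutators with the family. The factor 2 normalizes the largest
    possible weight to 1. *)
Definition offdiag_weight i j : R :=
  if i == j then 0 else 2 * \sum_(k in S) a k i j ^+ 2.
Local Notation w := offdiag_weight.

Hypothesis a_sym : forall k, (a k)^T = a k.

Let aC k i j : a k i j = a k j i.
Proof. by rewrite -{1}a_sym mxE. Qed.

Lemma mxdot_delta i j (M : 'M[R]_n) : mxdot (delta_mx i j) M = M i j.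
Proof.
rewrite mxdotE (bigD1 i) //= (bigD1 j) //= mxE !eqxx mul1r.
rewrite !big1 ?addr0 // => [k ki|l lj].
  by rewrite big1 // => l _; rewrite mxE (negbTE ki) mul0r.
by rewrite mxE eqxx (negbTE lj) mul0r.
Qed.

Lemma offdiag_weight_sym i j : w i j = w j i.
Proof.
rewrite /offdiag_weight eq_sym; case: ifP => // _; congr (_ * _).
by apply: eq_bigr => k _; rewrite aC.
Qed.

Lemma offdiag_weight_diag i : w i i = 0.
Proof. by rewrite /offdiag_weight eqxx. Qed.

Lemma offdiag_weight_ge0 i j : 0 <= w i j.
Proof.
rewrite /offdiag_weight; case: ifP => // _; rewrite mulr_ge0 ?ler0n //.
by rewrite sumr_ge0 // => k _; rewrite sqr_ge0.
Qed.

Lemma offdiag_weight_swap i j : i != j ->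
  2 * w i j = \sum_(k in S) mxdot (delta_mx i j + delta_mx j i) (a k) ^+ 2.
Proof.
move=> ij; rewrite /offdiag_weight (negbTE ij) mulrA mulr_sumr.
by apply: eq_bigr => k _; rewrite mxdotDl !mxdot_delta (aC k j); ring.
Qed.

Lemma mxdot_swap (i j : 'I_n) : i != j ->
  mxdot (delta_mx i j + delta_mx j i : 'M[R]_n)
        (delta_mx i j + delta_mx j i) = 2.
Proof.
move=> ij; rewrite mxdotDl !mxdot_delta !mxE !eqxx (negbTE ij).
by rewrite [j == i]eq_sym (negbTE ij) /=; ring.
Qed.

(** Bessel's inequality for E_ij + E_ji, whose squared norm is 2. *)
Lemma offdiag_weight_le1 i j : w i j <= 1.
Proof.
have [->|ij] := eqVneq i j; first by rewrite offdiag_weight_diag ler01.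
have := bessel (delta_mx i j + delta_mx j i).
by rewrite mxdot_swap // -offdiag_weight_swap //; lra.
Qed.

Variable l : 'rV[R]_n.
Hypothesis l_unit : mxdot (diag_mx l) (diag_mx l) = 1.
Hypothesis l_span : \sum_(k in S) mxdot (diag_mx l) (a k) ^+ 2 = 1.

Lemma mxdot_diag (M : 'M[R]_n) : mxdot (diag_mx l) M = \sum_i l 0 i * M i i.
Proof.
rewrite mxdotE; apply: eq_bigr => i _; rewrite (bigD1 i) //= mxE eqxx mulr1n.
rewrite big1 ?addr0 // => j ji.
by rewrite mxE eq_sym (negbTE ji) mulr0n mul0r.
Qed.

Let l_unitE : \sum_i l 0 i ^+ 2 = 1.
Proof.
rewrite -l_unit mxdot_diag; apply: eq_bigr => i _.
by rewrite mxE eqxx mulr1n expr2.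
Qed.

(** The family has total squared norm |S|, and the weights omit the diagonal entries. These account
    for at least 1, because the unit vector [diag_mx l] lies in the span and pairs with diagonal
    entries only. Hence the parameter s of the Laplacian bound is |S| - 1. *)
Lemma offdiag_weight_sum : \sum_i \sum_j w i j <= 2 * (#|S|%:R - 1).
Proof.
have sumE : \sum_i \sum_j w i j
    = 2 * \sum_(k in S) (mxdot (a k) (a k) - \sum_i a k i i ^+ 2).
  have -> : \sum_i \sum_j w i j
      = \sum_i \sum_(k in S) 2 * (\sum_j a k i j * a k i j - a k i i ^+ 2).
    apply: eq_bigr => i _; rewrite -mulr_sumr sumrB exchange_big /=.
    rewrite (bigD1 i) //= offdiag_weight_diag add0r.
    rewrite [X in _ = 2 * (X - _)](bigD1 i) //=.
    under [X in _ = 2 * (X + _ - _)]eq_bigr do rewrite -expr2.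
    rewrite addrAC subrr add0r mulr_sumr; apply: eq_bigr => j ji.
    rewrite /offdiag_weight eq_sym (negbTE ji); congr (_ * _).
  rewrite exchange_big mulr_sumr; apply: eq_bigr => k _ /=.
  by rewrite -mulr_sumr mxdotE sumrB.
have diag1 : 1 <= \sum_(k in S) \sum_i a k i i ^+ 2.
  rewrite -l_span; apply: ler_sum => k _; rewrite mxdot_diag.
  have := weighted_cauchy_schwarz (fun i => l 0 i) (fun i => a k i i)
    (fun _ => ler01).
  under eq_bigr do rewrite mul1r.
  under [X in _ <= X * _]eq_bigr do rewrite mul1r.
  under [X in _ <= _ * X]eq_bigr do rewrite mul1r.
  by rewrite l_unitE mul1r.
rewrite sumE sumrB (eq_bigr (fun=> 1)); last first.
  by move=> k kS; rewrite a_on // eqxx.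
by rewrite sumr_const; lra.
Qed.

(** The (i, j) entry of [diag l, a_k] is (l_i - l_j) a_k(i, j). *)
Lemma commutator_diag_energy :
  2 * (\sum_(k in S) mxdot (commutator (diag_mx l) (a k))
                           (commutator (diag_mx l) (a k)))
  = \sum_i \sum_j w i j * (l 0 i - l 0 j) ^+ 2.
Proof.
transitivity (2 * \sum_i \sum_j \sum_(k in S)
    (a k i j) ^+ 2 * (l 0 i - l 0 j) ^+ 2).
  congr (_ * _); under [RHS]eq_bigr do rewrite exchange_big /=.
  rewrite [RHS]exchange_big /=; apply: eq_bigr => k _.
  rewrite mxdotE; apply: eq_bigr => i _; apply: eq_bigr => j _.
  by rewrite /commutator mul_diag_mx mul_mx_diag !mxE; ring.
rewrite mulr_sumr; apply: eq_bigr => i _; rewrite mulr_sumr.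
apply: eq_bigr => j _; rewrite /offdiag_weight.
case: eqP => [->|_].
  by rewrite big1 ?mulr0 ?mul0r // => k _; rewrite subrr expr0n mulr0.
by rewrite -mulr_suml mulrA.
Qed.

Lemma commutator_diag_le :
  \sum_(k in S) mxdot (commutator (diag_mx l) (a k))
                      (commutator (diag_mx l) (a k)) <= #|S|%:R.
Proof.
have := energy_le offdiag_weight_sym offdiag_weight_diag offdiag_weight_ge0
  offdiag_weight_le1 offdiag_weight_sum l_unitE.
by rewrite -commutator_diag_energy subrK ler0n => /(_ isT); lra.
Qed.

Lemma commutator_diag_eq :
  \sum_(k in S) mxdot (commutator (diag_mx l) (a k))
                      (commutator (diag_mx l) (a k)) = #|S|%:R ->
  exists i j, [/\ i != j, w i j = 1 &
    \sum_k w i k + \sum_k w j k = #|S|%:R].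
Proof.
move=> E.
have S0 : 0 < #|S|%:R :> R.
  rewrite ltr0n card_gt0; apply: contra_eqT l_span => /negPn/eqP ->.
  by rewrite big_set0 eq_sym oner_eq0.
have := energy_eq offdiag_weight_sym offdiag_weight_diag offdiag_weight_ge0
  offdiag_weight_le1 offdiag_weight_sum l_unitE.
by rewrite -commutator_diag_energy subrK E; apply.
Qed.

End OrthonormalFamily.

(** * The commutator bound on the span of the family, and its sharpness *)

Section CommutatorBound.
Variables (R : rcfType) (n : nat) (I : finType) (S : {set I}).
Variable a : I -> 'M[R]_n.
Hypothesis a_on : {in S &, forall i j, mxdot (a i) (a j) = (i == j)%:R}.
Hypothesis a_sym : forall k, (a k)^T = a k.

(** Conjugation by an orthogonal matrix diagonalizing [u] respects inner products and commutators,
    which reduces the claim to diagonal [u]. *)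
Lemma commutator_unit_le (u : 'M[R]_n) : u^T = u -> mxdot u u = 1 ->
  \sum_(k in S) mxdot u (a k) ^+ 2 = 1 ->
  \sum_(k in S) mxdot (commutator u (a k)) (commutator u (a k)) <= #|S|%:R.
Proof.
move=> us u1 uS; have [P [l [PP Pu]]] := symmetric_spectral us.
pose b k := cjmx P (a k).
have b_on : {in S &, forall i j, mxdot (b i) (b j) = (i == j)%:R}.
  by move=> i j iS jS; rewrite mxdot_cj // a_on.
have b_sym k : (b k)^T = b k by exact: cjmx_sym.
have l1 : mxdot (diag_mx l) (diag_mx l) = 1 by rewrite -Pu mxdot_cj.
have lS : \sum_(k in S) mxdot (diag_mx l) (b k) ^+ 2 = 1.
  by rewrite -uS; apply: eq_bigr => k _; rewrite -Pu mxdot_cj.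
have := commutator_diag_le b_on b_sym l1 lS.
under eq_bigr do rewrite -Pu commutator_cj // mxdot_cj //.
by [].
Qed.

(** By Bessel, the second hypothesis says that [u] lies in the span of the family; both sides are
    homogeneous of degree 2 in [u]. *)
Lemma commutator_span_le (u : 'M[R]_n) : u^T = u ->
  \sum_(k in S) mxdot u (a k) ^+ 2 = mxdot u u ->
  \sum_(k in S) mxdot (commutator u (a k)) (commutator u (a k))
  <= #|S|%:R * mxdot u u.
Proof.
move=> us uS; have [/mxdot_eq0 ->|c0] := eqVneq (mxdot u u) 0.
  rewrite big1 => [|k _]; last first.
    by rewrite /commutator mul0mx mulmx0 subrr /mxdot mul0mx mxtrace0.
  by rewrite /mxdot mul0mx mxtrace0 mulr0.
have cp : 0 < mxdot u u by rewrite lt_neqAle eq_sym c0 mxdot_ge0.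
set c := mxdot u u in c0 cp *.
pose t := (Num.sqrt c)^-1.
have tt : t * t * c = 1.
  by rewrite -expr2 exprVn sqr_sqrtr ?ltW // mulVf.
have := @commutator_unit_le (t *: u).
rewrite linearZ /= us mxdotZl mxdotZr mulrA tt => /(_ erefl erefl).
under eq_bigr do rewrite mxdotZl exprMn.
rewrite -mulr_sumr uS expr2 tt => /(_ erefl).
under eq_bigr do rewrite commutatorZl mxdotZl mxdotZr mulrA.
rewrite -mulr_sumr; set X := \sum_(k in S) _ => le.
have -> : X = t * t * X * c by rewrite mulrAC tt mul1r.
by rewrite ler_pM2r.
Qed.

Lemma commutator_row_le i : i \in S ->
  \sum_(k in S) mxdot (commutator (a i) (a k)) (commutator (a i) (a k))
  <= #|S|%:R.
Proof.
move=> iS; have := @commutator_span_le (a i) (a_sym i).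
rewrite a_on // eqxx mulr1; apply.
rewrite (bigD1 i) //= a_on // eqxx expr1n big1 ?addr0 // => k /andP[kS ki].
by rewrite a_on // eq_sym (negbTE ki) expr0n.
Qed.

Hypothesis a_eq : #|S|%:R ^+ 2 <= \sum_(i in S) \sum_(k in S)
  mxdot (commutator (a i) (a k)) (commutator (a i) (a k)).

(** Matrix, with respect to the family, of the quadratic form u -> sum_k |[u, a_k]|^2. *)
Let N i j := \sum_(k in S) mxdot (commutator (a i) (a k)) (commutator (a j) (a k)).

(** The deficits |S| - N j j are nonnegative, while [a_eq] makes their sum nonpositive. *)
Lemma commutator_row_eq i : i \in S -> N i i = #|S|%:R.
Proof.
move=> iS; have : \sum_(j in S) (#|S|%:R - N j j) = 0.
  apply/eqP; rewrite eq_le; apply/andP; split; last first.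
    by apply: sumr_ge0 => j jS; rewrite subr_ge0 commutator_row_le.
  rewrite sumrB (_ : \sum_(j in S) #|S|%:R = #|S|%:R ^+ 2) ?subr_le0 //.
  by rewrite sumr_const expr2 mulr_natr.
move/eqP; rewrite psumr_eq0 => [/allP|j jS]; last first.
  by rewrite subr_ge0 commutator_row_le.
by move=> /(_ i (mem_index_enum _)); rewrite iS subr_eq0 => /eqP <-.
Qed.

(** The span bound at a_i + t a_j; once the diagonal of [N] is known, t = 1 and t = -1 bound [N i j]
    from both sides by 0. *)
Let N_pair i j (t : R) : i \in S -> j \in S -> i != j ->
  N i i + t ^+ 2 * N j j + 2 * t * N i j <= #|S|%:R * (1 + t ^+ 2).
Proof.
move=> iS jS ij; have := @commutator_span_le (a i + t *: a j).
have -> : mxdot (a i + t *: a j) (a i + t *: a j) = 1 + t ^+ 2.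
  rewrite !mxdotDl !mxdotDr !mxdotZl !mxdotZr !a_on // !eqxx.
  by rewrite [j == i]eq_sym (negbTE ij) /=; ring.
rewrite linearD linearZ /= !a_sym => /(_ erefl).
rewrite (bigD1 i) //= (bigD1 j) /=; last by rewrite jS eq_sym.
rewrite big1 => [|k /andP[/andP[kS ki] kj]]; last first.
  rewrite mxdotDl mxdotZl !a_on // eq_sym (negbTE ki) eq_sym (negbTE kj).
  by rewrite mulr0 addr0 expr0n.
rewrite !mxdotDl !mxdotZl !a_on // !eqxx [j == i]eq_sym (negbTE ij).
rewrite !mulr0 !addr0 mulr1 add0r expr1n => /(_ erefl).
congr (_ <= _); rewrite /N !mulr_sumr -!big_split; apply: eq_bigr => k _ /=.
rewrite !commutatorDl !commutatorZl.
move: (commutator (a i) (a k)) (commutator (a j) (a k)) => X Y.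
by rewrite !mxdotDl !mxdotDr !mxdotZl !mxdotZr (mxdotC Y X); ring.
Qed.

Let N_off i j : i \in S -> j \in S -> i != j -> N i j = 0.
Proof.
move=> iS jS ij; have := N_pair 1 iS jS ij; have := N_pair (-1) iS jS ij.
rewrite !commutator_row_eq //; lra.
Qed.

(* |S| |u|^2 minus the left-hand side is a nonnegative quadratic form in x, of
   trace zero by a_eq, hence zero. *)
Lemma commutator_span_eq (x : I -> R) :
  let u := \sum_(i in S) x i *: a i in
  \sum_(k in S) mxdot (commutator u (a k)) (commutator u (a k))
  = #|S|%:R * mxdot u u.
Proof.
move=> u; rewrite orthonormal_norm //.
have -> : \sum_(k in S) mxdot (commutator u (a k)) (commutator u (a k))
    = \sum_(i in S) \sum_(j in S) x i * x j * N i j.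
  under [RHS]eq_bigr do under eq_bigr do rewrite mulr_sumr.
  under [RHS]eq_bigr do rewrite exchange_big /=.
  rewrite [RHS]exchange_big; apply: eq_bigr => k _ /=.
  rewrite commutator_suml mxdot_suml; apply: eq_bigr => i _.
  rewrite mxdot_sumr; apply: eq_bigr => j _.
  by rewrite !commutatorZl mxdotZl mxdotZr mulrA.
rewrite mulr_sumr; apply: eq_bigr => i iS; rewrite (bigD1 i) //=.
rewrite commutator_row_eq // big1 => [|j /andP[jS ji]]; last first.
  by rewrite N_off ?mulr0 // eq_sym.
by rewrite addr0 -expr2 mulrC.
Qed.

End CommutatorBound.

Section Swap.
Variables (R : realFieldType) (n : nat) (i j : 'I_n) (M : 'M[R]_n).
Hypothesis ij : i != j.
Hypothesis Ms : M^T = M.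
Local Notation e := (delta_mx i j + delta_mx j i : 'M[R]_n).

Let MC k l : M k l = M l k.
Proof. by rewrite -{1}Ms mxE. Qed.

Let mul_delta (k l p q : 'I_n) : (M *m delta_mx k l *m M) p q = M p k * M l q.
Proof.
rewrite mxE (bigD1 l) //= big1 ?addr0 => [|r rl].
  rewrite mxE (bigD1 k) //= big1 ?addr0 => [|r rk]; rewrite mxE ?eqxx ?mulr1 //.
  by rewrite (negbTE rk) mulr0.
rewrite mxE big1 ?mul0r // => s _; rewrite mxE (negbTE rl) andbF mulr0.
by [].
Qed.

Lemma swap_sym : e^T = e.
Proof. by rewrite linearD /= !trmx_delta addrC. Qed.

(** For symmetric matrices |[e, M]|^2 = 2 tr(e^2 M^2) - 2 tr(e M e M), and here e^2 is the
    projection onto the coordinates i and j. The row norms of [M] that appear are what ties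
    sharpness at [e] to the degrees of i and j. *)
Lemma commutator_swap :
  mxdot (commutator e M) (commutator e M) =
  2 * (\sum_k M i k ^+ 2 + \sum_k M j k ^+ 2)
  - 4 * (M i j ^+ 2 + M i i * M j j).
Proof.
have es := swap_sym.
have ee : e *m e = delta_mx i i + delta_mx j j.
  rewrite mulmxDl !mulmxDr !mul_delta_mx_cond !eqxx.
  by rewrite [j == i]eq_sym (negbTE ij) !mulr0n !mulr1n add0r addr0.
have -> : mxdot (commutator e M) (commutator e M)
    = 2 * mxdot (e *m e) (M *m M) - 2 * mxdot e (M *m e *m M).
  rewrite /commutator mxdotBl !mxdotBr.
  have -> : mxdot (e *m M) (e *m M) = mxdot (e *m e) (M *m M).
    by rewrite /mxdot !trmx_mul es Ms mulmxA mxtrace_mulC !mulmxA.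
  have -> : mxdot (M *m e) (M *m e) = mxdot (e *m e) (M *m M).
    by rewrite /mxdot !trmx_mul es Ms -mulmxA mxtrace_mulC !mulmxA.
  have -> : mxdot (M *m e) (e *m M) = mxdot e (M *m e *m M).
    rewrite /mxdot !trmx_mul es Ms !mulmxA.
    by rewrite [LHS]mxtrace_mulC !mulmxA.
  have -> : mxdot (e *m M) (M *m e) = mxdot e (M *m e *m M).
    by rewrite /mxdot !trmx_mul es Ms !mulmxA.
  ring.
rewrite ee !mxdotDl !mxdot_delta mulmxDr mulmxDl !mxE -!/(_ *m _).
have sq k : \sum_l M k l * M l k = \sum_l M k l ^+ 2.
  by apply: eq_bigr => l _; rewrite (MC l k) expr2.
rewrite !sq.
have := mul_delta i j i j; have := mul_delta j i i j.
have := mul_delta i j j i; have := mul_delta j i j i.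
rewrite !mxE => -> -> -> ->; rewrite (MC j i); ring.
Qed.
End Swap.

Section Structure.
Variables (R : rcfType) (n : nat) (I : finType) (S : {set I}).
Variable a : I -> 'M[R]_n.
Hypothesis a_on : {in S &, forall i j, mxdot (a i) (a j) = (i == j)%:R}.
Hypothesis a_sym : forall k, (a k)^T = a k.

Lemma offdiag_weight_deg i :
  \sum_k offdiag_weight S a i k =
  2 * \sum_(k in S) \sum_l a k i l ^+ 2 - 2 * \sum_(k in S) a k i i ^+ 2.
Proof.
rewrite (bigD1 i) //= offdiag_weight_diag add0r [in RHS]exchange_big /=.
rewrite (bigD1 i (F := fun l => \sum_(k in S) a k i l ^+ 2)) //= mulrDr.
rewrite addrAC subrr add0r mulr_sumr; apply: eq_bigr => j ji.
by rewrite /offdiag_weight eq_sym (negbTE ji).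
Qed.

Local Notation e i j := (delta_mx i j + delta_mx j i : 'M[R]_n).
Local Notation d i j := (delta_mx i i - delta_mx j j : 'M[R]_n).

Lemma mxdot_diff i j : i != j -> mxdot (d i j) (d i j) = 2.
Proof.
move=> ij; rewrite mxdotBl !mxdot_delta !mxE !eqxx (negbTE ij).
by rewrite [j == i]eq_sym (negbTE ij) /=; ring.
Qed.

Hypothesis a_eq : #|S|%:R ^+ 2 <= \sum_(i in S) \sum_(k in S)
  mxdot (commutator (a i) (a k)) (commutator (a i) (a k)).

(** Weight 1 is equality in Bessel, so e = E_ij + E_ji lies in the span and [commutator_span_eq]
    applies to it. Through [commutator_swap] and the degrees it becomes |S| + 2 = 2 sum_k <d, a_k>^2
    with d = E_ii - E_jj, and the right side is at most 4. Both degrees are at least 1 and add up to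
    |S|, whence |S| = 2 and d exhausts its Bessel bound as well. *)
Lemma saturated_edge i j : i != j -> offdiag_weight S a i j = 1 ->
  \sum_k offdiag_weight S a i k + \sum_k offdiag_weight S a j k = #|S|%:R ->
  {in S, forall k, a k = (mxdot (d i j) (a k) / 2) *: d i j
                       + (mxdot (e i j) (a k) / 2) *: e i j}.
Proof.
move=> ij wij deg.
have eS : \sum_(k in S) mxdot (e i j) (a k) ^+ 2 = 2.
  by rewrite -offdiag_weight_swap // wij mulr1.
have dS : \sum_(k in S) mxdot (d i j) (a k) ^+ 2 <= 2.
  by rewrite -(mxdot_diff ij) bessel.
have := commutator_span_eq a_on a_sym a_eq (fun k => mxdot (e i j) (a k)).
rewrite /= -bessel_eq ?eS ?mxdot_swap //.
under eq_bigr do rewrite commutator_swap //.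
have wE : 1 = 2 * \sum_(k in S) a k i j ^+ 2.
  by have := wij; rewrite /offdiag_weight (negbTE ij).
have dE : \sum_(k in S) mxdot (d i j) (a k) ^+ 2 =
    \sum_(k in S) a k i i ^+ 2 + \sum_(k in S) a k j j ^+ 2
    - 2 * \sum_(k in S) a k i i * a k j j.
  rewrite mulr_sumr -big_split -sumrB; apply: eq_bigr => k _ /=.
  by rewrite mxdotBl !mxdot_delta; ring.
rewrite sumrB -!mulr_sumr !big_split /=.
have := offdiag_weight_deg i; have := offdiag_weight_deg j => Ej Ei E.
have degw : 2 <= #|S|%:R :> R.
  have le k l : k != l -> offdiag_weight S a k l = 1 ->
      1 <= \sum_l offdiag_weight S a k l.
    move=> kl <-; rewrite (bigD1 l) //= lerDl.
    by apply: sumr_ge0 => ? _; exact: offdiag_weight_ge0.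
  have := le i j ij wij; have := le j i.
  rewrite eq_sym ij offdiag_weight_sym // wij => /(_ isT erefl).
  by move: deg; lra.
have [r2 dS2] : #|S|%:R = 2 :> R /\ \sum_(k in S) mxdot (d i j) (a k) ^+ 2 = 2.
  by split; move: dS; rewrite dE; lra.
pose res k := a k - ((mxdot (d i j) (a k) / 2) *: d i j
                     + (mxdot (e i j) (a k) / 2) *: e i j).
have resE k : k \in S -> mxdot (res k) (res k) =
    1 - mxdot (d i j) (a k) ^+ 2 / 2 - mxdot (e i j) (a k) ^+ 2 / 2.
  move=> kS.
  have de : mxdot (d i j) (e i j) = 0.
    rewrite mxdotBl !mxdot_delta !mxE !eqxx (negbTE ij).
    by rewrite [j == i]eq_sym (negbTE ij) /=; ring.
  rewrite /res; move: (mxdot_diff ij) (mxdot_swap R ij) de.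
  set D := d i j; set E' := e i j; move: D E' => D E' DD EE DE.
  rewrite !(mxdotBl, mxdotBr, mxdotDl, mxdotDr, mxdotZl, mxdotZr).
  rewrite (mxdotC E' D) !(mxdotC (a k)) DD EE DE -/(a k) a_on // eqxx /=.
  by field.
(* The total residual is |S| - 2/2 - 2/2 = 0. *)
have sum0 : \sum_(k in S) mxdot (res k) (res k) = 0.
  rewrite (eq_bigr _ resE) !sumrB -!mulr_suml dS2 eS sumr_const r2.
  by field.
move=> k kS; apply/eqP; rewrite -subr_eq0 -/(res k); apply/eqP/mxdot_eq0.
move/eqP: sum0; rewrite psumr_eq0 => [/allP/(_ k (mem_index_enum _))|? _].
  by rewrite kS => /eqP.
exact: mxdot_ge0.
Qed.

End Structure.

(** In a basis diagonalizing [a k0], that member attains the commutator bound by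
    [commutator_row_eq], and the equality case of the Laplacian bound supplies the saturated
    edge. *)
Lemma commutator_equality_structure (R : rcfType) n (I : finType) (S : {set I})
    (a : I -> 'M[R]_n) k0 : k0 \in S ->
  {in S &, forall i j, mxdot (a i) (a j) = (i == j)%:R} ->
  (forall k, (a k)^T = a k) ->
  #|S|%:R ^+ 2 <= \sum_(i in S) \sum_(k in S)
    mxdot (commutator (a i) (a k)) (commutator (a i) (a k)) ->
  exists (P : 'M[R]_n) i j, [/\ P *m P^T = 1%:M, i != j &
    {in S, forall k, exists p q, cjmx P (a k) =
      p *: (delta_mx i i - delta_mx j j) + q *: (delta_mx i j + delta_mx j i)}].
Proof.
move=> k0S a_on a_sym a_eq.
have [P [l [PP Pu]]] := symmetric_spectral (a_sym k0).
pose b k := cjmx P (a k).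
have b_on : {in S &, forall i j, mxdot (b i) (b j) = (i == j)%:R}.
  by move=> i j iS jS; rewrite mxdot_cj // a_on.
have b_sym k : (b k)^T = b k by exact: cjmx_sym.
have l1 : mxdot (diag_mx l) (diag_mx l) = 1.
  by rewrite -Pu mxdot_cj // a_on // eqxx.
have lS : \sum_(k in S) mxdot (diag_mx l) (b k) ^+ 2 = 1.
  rewrite (bigD1 k0) //= -Pu -/(b k0) b_on // eqxx expr1n big1 ?addr0 //.
  by move=> k /andP[kS kk]; rewrite b_on // eq_sym (negbTE kk) expr0n.
have b_eq : #|S|%:R ^+ 2 <= \sum_(i in S) \sum_(k in S)
    mxdot (commutator (b i) (b k)) (commutator (b i) (b k)).
  under eq_bigr do under eq_bigr do rewrite commutator_cj // mxdot_cj //.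
  exact: a_eq.
have [i [j [ij wij deg]]] : exists i j, [/\ i != j,
    offdiag_weight S b i j = 1 &
    \sum_k offdiag_weight S b i k + \sum_k offdiag_weight S b j k = #|S|%:R].
  apply: (commutator_diag_eq b_on b_sym l1 lS).
  by rewrite -Pu; exact: commutator_row_eq.
exists P, i, j; split => // k kS; rewrite -/(b k).
do 2 eexists; exact: (saturated_edge b_on b_sym b_eq ij wij deg kS).
Qed.

(* By induction on the support S of x: split x as t times the indicator of S,
   for t the least nonzero value of x, plus a vector of smaller support. *)
Lemma row_bounded_form (R : realFieldType) (I : finType) (c : I -> I -> R) :
  (forall i j, c i j = c j i) ->
  (forall (S : {set I}) i, i \in S -> \sum_(j in S) c i j <= #|S|%:R) ->
  forall x : I -> R, (forall i, 0 <= x i) ->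
  let S := [set i | x i != 0] in
  let F := (\sum_i x i) ^+ 2 - \sum_i \sum_j c i j * (x i * x j) in
  0 <= F /\
  (F <= 0 -> #|S|%:R ^+ 2 <= \sum_(i in S) \sum_(j in S) c i j).
Proof.
move=> c_sym c_row x; have [k] := ubnP #|[set i | x i != 0]|.
elim: k x => // k IH x; rewrite ltnS => Sk x0 S F.
have [S0|[i0 i0S]] := set_0Vmem S.
  have xz i : x i = 0.
    by apply/eqP; apply: contraT => xi; have := in_set0 i; rewrite -S0 inE xi.
  rewrite /F S0 cards0 expr0n big_set0 big1 // expr0n big1 ?subrr // => i _.
  by rewrite big1 // => j _; rewrite xz mul0r mulr0.
pose t := x [arg min_(i < i0 in S) x i]%O.
have [tS tmin] : t != 0 /\ {in S, forall i, t <= x i}.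
  rewrite /t; case: arg_minP => // i iS imin; split => //.
  by move: iS; rewrite inE.
have t0 : 0 < t by rewrite lt_neqAle eq_sym tS x0.
pose y i := if i \in S then x i - t else 0.
have y0 i : 0 <= y i.
  by rewrite /y; case: ifP => // iS; rewrite subr_ge0 tmin.
have xy i : x i = t * (i \in S)%:R + y i.
  rewrite /y; case: ifP => iS; first by rewrite mulr1 subrKC.
  by rewrite mulr0 addr0; move: iS; rewrite inE => /negbFE/eqP.
have sub : [set i | y i != 0] \proper S.
  apply/properP; split.
    by apply/fintype.subsetP => i; rewrite inE /y; case: ifP => //; rewrite eqxx.
  exists [arg min_(i < i0 in S) x i]%O; first by case: arg_minP.
  rewrite inE /y -/t; case: ifP => _; rewrite ?subrr eqxx //.
have [Fy _] := IH y (leq_trans (proper_card sub) Sk) y0.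
pose T i := \sum_(j in S) c i j.
have sumS (f : I -> R) : \sum_i (i \in S)%:R * f i = \sum_(i in S) f i.
  rewrite [RHS]big_mkcond; apply: eq_bigr => i _.
  by case: ifP; rewrite ?mul1r ?mul0r.
have sumy (f : I -> R) : \sum_i y i * f i = \sum_(i in S) y i * f i.
  rewrite [RHS]big_mkcond; apply: eq_bigr => i _.
  by rewrite /y; case: ifP => //; rewrite mul0r.
(* All three summands are nonnegative, the first two by the row bounds and the last by induction; so
   F <= 0 forces the first to vanish, which is equality for the support. *)
have FE : F = t ^+ 2 * (#|S|%:R ^+ 2 - \sum_(i in S) T i)
    + 2 * t * (\sum_(i in S) y i * (#|S|%:R - T i))
    + ((\sum_i y i) ^+ 2 - \sum_i \sum_j c i j * (y i * y j)).
  have s1 : \sum_i x i = t * #|S|%:R + \sum_i y i.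
    have sS : \sum_i (i \in S)%:R = #|S|%:R :> R.
      have := sumS (fun=> 1); under eq_bigr do rewrite mulr1.
      by rewrite sumr_const.
    by rewrite -sS mulr_sumr -big_split; apply: eq_bigr => i _; exact: xy.
  have s2 : \sum_i \sum_j c i j * (x i * x j) =
      t ^+ 2 * (\sum_(i in S) T i) + t * (\sum_(i in S) y i * T i)
      + t * \sum_i (\sum_j (i \in S)%:R * (c i j * y j))
      + \sum_i \sum_j c i j * (y i * y j).
    rewrite -sumS -sumy !mulr_sumr -!big_split; apply: eq_bigr => i _ /=.
    rewrite -[T i]sumS !mulr_sumr -!big_split; apply: eq_bigr => j _ /=.
    by rewrite (xy i) (xy j); ring.
  have s3 : \sum_i (\sum_j (i \in S)%:R * (c i j * y j)) = \sum_(i in S) y i * T i.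
    rewrite exchange_big -sumy; apply: eq_bigr => j _ /=.
    rewrite sumS /T mulr_sumr; apply: eq_bigr => i _.
    by rewrite (c_sym i) mulrC.
  have s4 : \sum_(i in S) y i * (#|S|%:R - T i)
      = (\sum_i y i) * #|S|%:R - \sum_(i in S) y i * T i.
    rewrite mulr_suml (sumy (fun=> #|S|%:R)) -sumrB.
    by apply: eq_bigr => i _; rewrite mulrBr.
  by rewrite /F s1 s2 s3 s4; ring.
have F1 : \sum_(i in S) T i <= #|S|%:R ^+ 2.
  apply: (le_trans (ler_sum _ (fun i iS => c_row S i iS))).
  by rewrite sumr_const expr2 mulr_natr.
have F2 : 0 <= \sum_(i in S) y i * (#|S|%:R - T i).
  by apply: sumr_ge0 => i iS; rewrite mulr_ge0 // subr_ge0 c_row.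
have F2t : 0 <= 2 * t * (\sum_(i in S) y i * (#|S|%:R - T i)).
  by rewrite mulr_ge0 // mulr_ge0 // ltW.
move: Fy; cbv zeta => Fy; split.
  have : 0 <= t ^+ 2 * (#|S|%:R ^+ 2 - \sum_(i in S) T i).
    by rewrite mulr_ge0 ?sqr_ge0 ?subr_ge0.
  by rewrite FE; move: F2t Fy; lra.
move=> F0; rewrite leNgt; apply/negP => lt.
have : 0 < t ^+ 2 * (#|S|%:R ^+ 2 - \sum_(i in S) T i).
  by rewrite mulr_gt0 ?exprn_gt0 // subr_gt0.
by move: F0 Fy F2t; rewrite FE; lra.
Qed.

Lemma mxdot_rotation (R : realFieldType) n m (O : 'M[R]_m) (X : 'I_m -> 'M[R]_n) :
  O *m O^T = 1%:M ->
  \sum_g mxdot (\sum_a O g a *: X a) (\sum_a O g a *: X a)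
  = \sum_a mxdot (X a) (X a).
Proof.
move=> /mulmx1C OO.
transitivity (\sum_a \sum_b (O^T *m O) a b * mxdot (X a) (X b)).
  under [RHS]eq_bigr do under eq_bigr do rewrite mxE mulr_suml.
  under [RHS]eq_bigr do rewrite exchange_big /=.
  rewrite [RHS]exchange_big; apply: eq_bigr => g _ /=.
  rewrite mxdot_suml; apply: eq_bigr => a _.
  rewrite mxdot_sumr; apply: eq_bigr => b _.
  by rewrite mxdotZl mxdotZr mulrA mxE.
apply: eq_bigr => a _; rewrite (bigD1 a) //= OO mxE eqxx mul1r.
rewrite big1 ?addr0 // => b ba; rewrite mxE eq_sym (negbTE ba).
exact: mul0r.
Qed.

(** An orthogonal change of the family alters neither side ([mxdot_rotation]). Choosing it to
    diagonalize the Gram matrix makes the members orthogonal with squared norms x_g, and both sides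
    become quadratic forms in x. *)
Lemma ddvv_equality (R : rcfType) n m (B : 'I_m -> 'M[R]_n) : (1 < n)%N ->
  (forall a, (B a)^T = B a) ->
  (\sum_a mxdot (B a) (B a)) ^+ 2 <=
    \sum_a \sum_b mxdot (commutator (B a) (B b)) (commutator (B a) (B b)) ->
  exists (P : 'M[R]_n) i j, [/\ P *m P^T = 1%:M, i != j &
    forall a, exists p q, cjmx P (B a) =
      p *: (delta_mx i i - delta_mx j j) + q *: (delta_mx i j + delta_mx j i)].
Proof.
move=> n1 B_sym B_eq.
pose Gm := \matrix_(a, b) mxdot (B a) (B b).
have Gs : Gm^T = Gm by apply/matrixP => a b; rewrite !mxE mxdotC.
have [O [x [OO Ox]]] := symmetric_spectral Gs.
pose B' g := \sum_a O g a *: B a.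
have B'B' g h : mxdot (B' g) (B' h) = x 0 g *+ (g == h).
  have -> : x 0 g *+ (g == h) = (O *m Gm *m O^T) g h by rewrite Ox mxE.
  rewrite mxE mxdot_sumr; apply: eq_bigr => b _.
  rewrite !mxE mxdotZr mxdot_suml mulrC; congr (_ * _).
  by apply: eq_bigr => a _; rewrite mxdotZl mxE.
have x0 g : 0 <= x 0 g by have := mxdot_ge0 (B' g); rewrite B'B' eqxx mulr1n.
have BB' a : B a = \sum_g O g a *: B' g.
  under eq_bigr do rewrite scaler_sumr.
  rewrite exchange_big (bigD1 a) //= [X in _ + X]big1 => [|b ba]; last first.
    under eq_bigr do rewrite scalerA.
    rewrite -scaler_suml (_ : \sum_g O g a * O g b = (O^T *m O) a b).
      by rewrite (mulmx1C OO) mxE eq_sym (negbTE ba) scale0r.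
    by rewrite mxE; apply: eq_bigr => g _; rewrite mxE.
  under eq_bigr do rewrite scalerA.
  rewrite -scaler_suml (_ : \sum_g O g a * O g a = (O^T *m O) a a).
    by rewrite (mulmx1C OO) mxE eqxx scale1r addr0.
  by rewrite mxE; apply: eq_bigr => g _; rewrite mxE.
have B'_sym g : (B' g)^T = B' g.
  by rewrite /B' linear_sum; apply: eq_bigr => a _; rewrite linearZ /= B_sym.
(* When x_g = 0 the convention 0^-1 = 0 gives [a g = 0], consistent with B'_g = 0. *)
pose a g := (Num.sqrt (x 0 g))^-1 *: B' g.
have B'a g : B' g = Num.sqrt (x 0 g) *: a g.
  have [xg|xg] := eqVneq (x 0 g) 0.
    rewrite xg sqrtr0 scale0r; apply: mxdot_eq0.
    by rewrite B'B' xg mul0rn.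
  by rewrite scalerA divff ?scale1r // sqrtr_eq0 -ltNge lt_neqAle eq_sym xg x0.
pose S := [set g | x 0 g != 0].
have a_sym g : (a g)^T = a g by rewrite /a linearZ /= B'_sym.
have a0 g : g \notin S -> a g = 0.
  rewrite inE negbK => /eqP xg.
  by rewrite /a xg sqrtr0 invr0 scale0r.
have a_on : {in S &, forall g h, mxdot (a g) (a h) = (g == h)%:R}.
  move=> g h; rewrite !inE => xg xh; rewrite mxdotZl mxdotZr B'B'.
  have [->|_] := eqVneq g h; last by rewrite mulr0n !mulr0.
  by rewrite mulr1n mulrA -expr2 exprVn sqr_sqrtr // mulVf.
pose c g h := mxdot (commutator (a g) (a h)) (commutator (a g) (a h)).
have c_sym g h : c g h = c h g.
  rewrite /c commutatorC; set X := commutator _ _.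
  by rewrite -scaleN1r mxdotZl mxdotZr !mulN1r opprK.
have c0 g h : g \notin S -> c g h = 0.
  move=> gS; rewrite /c /commutator a0 // mul0mx mulmx0 subrr.
  by rewrite /mxdot mul0mx mxtrace0.
(* [row_bounded_form] asks for all sets of indices; members outside [S] are zero, so [T] may be cut
   down to the orthonormal subfamily [T :&: S]. *)
have c_row (T : {set 'I_m}) g : g \in T -> \sum_(h in T) c g h <= #|T|%:R.
  move=> gT; have [gS|gS] := boolP (g \in S); last first.
    by rewrite big1 ?ler0n // => h _; rewrite c0.
  rewrite (bigID (mem S)) /= [X in _ + X]big1 ?addr0 => [|h /andP[_ hS]].
    have -> : \sum_(h in T | h \in S) c g h = \sum_(h in T :&: S) c g h.
      by apply: eq_bigl => h; rewrite in_setI.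
    apply: (@le_trans _ _ #|T :&: S|%:R); last first.
      by rewrite ler_nat subset_leq_card // subsetIl.
    apply: commutator_row_le; rewrite ?in_setI ?gT //.
    by move=> h k /setIP[_ hS] /setIP[_ kS]; exact: a_on.
  by rewrite c_sym c0.
have sum1 : \sum_a mxdot (B a) (B a) = \sum_g x 0 g.
  rewrite -(mxdot_rotation _ OO); apply: eq_bigr => g _.
  by rewrite -/(B' g) B'B' eqxx.
have sum2 : \sum_a \sum_b mxdot (commutator (B a) (B b)) (commutator (B a) (B b))
    = \sum_g \sum_h c g h * (x 0 g * x 0 h).
  transitivity (\sum_g \sum_h
      mxdot (commutator (B' g) (B' h)) (commutator (B' g) (B' h))).
    under eq_bigr do rewrite -(mxdot_rotation _ OO).
    rewrite exchange_big [RHS]exchange_big; apply: eq_bigr => h _ /=.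
    rewrite -[LHS](mxdot_rotation _ OO); apply: eq_bigr => g _.
    suff -> : \sum_a O g a *: (\sum_b O h b *: commutator (B a) (B b))
      = commutator (B' g) (B' h) by [].
    rewrite commutator_suml; apply: eq_bigr => k _.
    rewrite commutatorZl; congr (_ *: _).
    rewrite commutatorC commutator_suml -sumrN; apply: eq_bigr => l _.
    by rewrite commutatorZl -scalerN -commutatorC.
  apply: eq_bigr => g _; apply: eq_bigr => h _.
  rewrite /c -[in RHS](sqr_sqrtr (x0 g)) -[in RHS](sqr_sqrtr (x0 h)).
  rewrite (B'a g) (B'a h); move: (a g) (a h) => u v.
  by rewrite !commutatorZl !commutatorZr !mxdotZl !mxdotZr; ring.
have [_] := row_bounded_form c_sym c_row x0.
rewrite -sum1 -sum2 subr_le0 => /(_ B_eq) S_eq.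
have [S0|[g0 g0S]] := set_0Vmem S.
  (* All B_a vanish, and any two distinct indices will do. *)
  exists 1%:M, (Ordinal (ltnW n1)), (Ordinal n1); split => //.
    by rewrite trmx1 mulmx1.
  move=> k; exists 0, 0; rewrite !scale0r addr0 BB' big1.
    by rewrite /cjmx mulmx0 mul0mx.
  by move=> g _; rewrite B'a a0 ?scaler0 // S0 inE.
have [P [i [j [PP ij aP]]]] := commutator_equality_structure g0S a_on a_sym S_eq.
exists P, i, j; split => // k.
have aP' g : exists pq : R * R, cjmx P (a g) =
    pq.1 *: (delta_mx i i - delta_mx j j) + pq.2 *: (delta_mx i j + delta_mx j i).
  have [/aP[p [q E]]|gS] := boolP (g \in S); first by exists (p, q).
  by exists (0, 0); rewrite a0 // !scale0r addr0 /cjmx mulmx0 mul0mx.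
have [pq Epq] := fin_all_exists aP'.
pose s g := O g k * Num.sqrt (x 0 g).
exists (\sum_g s g * (pq g).1), (\sum_g s g * (pq g).2).
rewrite !scaler_suml -big_split BB' cjmx_sum; apply: eq_bigr => g _ /=.
by rewrite B'a 2!cjmxZ Epq !scalerA scalerDr !scalerA.
Qed.

From mathcomp Require Import all_classical all_reals all_analysis.
Require Import Defs.

Import numFieldNormedType.Exports.

Local Open Scope classical_set_scope.
Local Open Scope ring_scope.

(** * Curvature tensors concentrated in a plane *)

Lemma mul_mx_col (R : pzSemiRingType) m n p (A : 'M[R]_(m, n)) (B : 'M[R]_(n, p)) i j :
  (A *m col j B) i 0 = (A *m B) i j.
Proof. by rewrite !mxE; apply: eq_bigr => k _; rewrite mxE. Qed.

Section Form.
Variables (R : realType) (n : nat) (G : 'M[R]_n).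
Implicit Types u v w : 'rV[R]_n.

Lemma formDl u v w : form G (u + v) w = form G u w + form G v w.
Proof. by rewrite /form !mulmxDl mxE. Qed.

Lemma formZl a u w : form G (a *: u) w = a * form G u w.
Proof. by rewrite /form -!scalemxAl mxE. Qed.

Lemma formDr u v w : form G w (u + v) = form G w u + form G w v.
Proof. by rewrite /form linearD mulmxDr mxE. Qed.

Lemma formZr a u w : form G w (a *: u) = a * form G w u.
Proof. by rewrite /form linearZ /= -scalemxAr mxE. Qed.

Lemma form0l w : form G 0 w = 0.
Proof. by rewrite /form !mul0mx mxE. Qed.

Lemma form0r w : form G w 0 = 0.
Proof. by rewrite /form trmx0 mulmx0 mxE. Qed.

Lemma formNl u w : form G (- u) w = - form G u w.
Proof. by rewrite -scaleN1r formZl mulN1r. Qed.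

Lemma formNr u w : form G w (- u) = - form G w u.
Proof. by rewrite -scaleN1r formZr mulN1r. Qed.

Lemma formBl u v w : form G (u - v) w = form G u w - form G v w.
Proof. by rewrite formDl formNl. Qed.

Lemma form_suml (I : Type) (r : seq I) (P : pred I) (F : I -> 'rV[R]_n) w :
  form G (\sum_(i <- r | P i) F i) w = \sum_(i <- r | P i) form G (F i) w.
Proof. exact: (big_morph (form G ^~ w) (fun u v => formDl u v w) (form0l w)). Qed.

Lemma form_sumr (I : Type) (r : seq I) (P : pred I) (F : I -> 'rV[R]_n) w :
  form G w (\sum_(i <- r | P i) F i) = \sum_(i <- r | P i) form G w (F i).
Proof. exact: (big_morph (form G w) (fun u v => formDr u v w) (form0r w)). Qed.

Hypothesis G_pos : forall u, u != 0 -> 0 < form G u u.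

Lemma form_unit : G \in unitmx.
Proof.
rewrite -row_free_unit -kermx_eq0; apply: contraT => /negP k0.
have k1 : nz_row (kermx G) != 0 by rewrite nz_row_eq0; apply/negP.
have := G_pos k1; rewrite /form.
have -> : nz_row (kermx G) *m G = 0 by apply/sub_kermxP; exact: nz_row_sub.
by rewrite mul0mx mxE ltxx.
Qed.

Lemma form_nondeg u v : (forall w, form G u w = form G v w) -> u = v.
Proof.
move=> uv; apply/eqP; rewrite -subr_eq0; apply: contraT => /G_pos.
by rewrite formBl uv subrr ltxx.
Qed.

Lemma sharpP (phi : 'rV[R]_n -> R) :
  (forall a u v, phi (a *: u + v) = a * phi u + phi v) ->
  forall v, form G (sharp G phi) v = phi v.
Proof.
move=> phi_lin v; rewrite /form /sharp mulmxKV ?form_unit // mxE.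
have phi0 : phi 0 = 0.
  by have := phi_lin (-1) 0 0; rewrite scaler0 addr0 mulN1r addNr.
have phiD u w : phi (u + w) = phi u + phi w.
  by rewrite -{1}[u]scale1r phi_lin mul1r.
have -> : phi v = phi (\sum_j v 0 j *: delta_mx 0 j) by rewrite -row_sum_delta.
rewrite (big_morph phi phiD phi0).
by apply: eq_bigr => j _; rewrite !mxE -[_ *: _]addr0 phi_lin phi0 addr0 mulrC.
Qed.

Lemma lin1_mxP (phi : 'rV[R]_n -> 'rV[R]_n) : linear phi ->
  forall u, u *m lin1_mx phi = phi u.
Proof.
move=> phi_lin u.
pose f : {linear 'rV[R]_n -> 'rV[R]_n} :=
  HB.pack phi (GRing.isLinear.Build _ _ _ _ phi phi_lin).
exact: (mul_rV_lin1 f u).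
Qed.

Hypothesis G_sym : forall u v, form G u v = form G v u.

Section Basis.
Variable E : 'I_n -> 'rV[R]_n.
Hypothesis E_on : forall i j, form G (E i) (E j) = (i == j)%:R.

Let U := \matrix_i E i.

Lemma frame_mxP : U *m G *m U^T = 1%:M.
Proof.
apply/matrixP => i j; rewrite [RHS]mxE -E_on /form.
have -> : E i = row i U by rewrite rowK.
have -> : E j = row j U by rewrite rowK.
by rewrite tr_row mul_mx_col -!row_mul [RHS]mxE.
Qed.

Lemma parseval u v : \sum_k form G (E k) u * form G (E k) v = form G u v.
Proof.
(* The one-sided inverse U (G U^T) = 1 is two-sided, and G U^T U = 1 is Parseval's identity in
   matrix form. *)
have := frame_mxP; rewrite -mulmxA => /mulmx1C GUU.
transitivity (form G (u *m (G *m U^T *m U)) v); last by rewrite GUU mulmx1.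
rewrite [RHS]/form mulmxA -(mulmxA _ U) -mulmxA [RHS]mxE; apply: eq_bigr => k _.
rewrite G_sym; congr (_ * _).
  rewrite /form -mulmxA.
  have -> : (E k)^T = col k U^T by rewrite -tr_row rowK.
  by rewrite mulmxA mul_mx_col !mulmxA.
have -> : E k = row k U by rewrite rowK.
by rewrite /form -!row_mul mxE.
Qed.

Lemma mxtrace_lin1 (phi : 'rV[R]_n -> 'rV[R]_n) : linear phi ->
  \tr (lin1_mx phi) = \sum_k form G (phi (E k)) (E k).
Proof.
move=> phi_lin.
have := frame_mxP; rewrite -mulmxA => /mulmx1C GUU.
rewrite -[lin1_mx phi]mulmx1 -GUU mulmxA mxtrace_mulC.
apply: eq_bigr => k _; rewrite -(lin1_mxP phi_lin) /form.
have -> : (E k)^T = col k U^T by rewrite -tr_row rowK.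
have -> : E k = row k U by rewrite rowK.
by rewrite mul_mx_col -!row_mul [RHS]mxE !mulmxA.
Qed.

End Basis.
End Form.

Section PlaneCurvature.
Variables (R : realType) (n : nat) (G : 'M[R]_n).
Hypothesis G_pos : forall u, u != 0 -> 0 < form G u u.
Hypothesis G_sym : forall u v, form G u v = form G v u.
Variable E : 'I_n -> 'rV[R]_n.
Hypothesis E_on : forall i j, form G (E i) (E j) = (i == j)%:R.
Variables (i j : 'I_n).
Hypothesis ij : i != j.
Local Notation g := (form G).

(** The general traceless symmetric form supported on the plane of E_i and E_j, with diagonal al,
    -al and off-diagonal entry be. *)
Definition plane_form (al be : R) (X Y : 'rV[R]_n) : R :=
  al * (g (E i) X * g (E i) Y - g (E j) X * g (E j) Y)
  + be * (g (E i) X * g (E j) Y + g (E j) X * g (E i) Y).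

(** Area form of the plane, extended by zero to its orthogonal complement. *)
Definition plane_vol (X Y : 'rV[R]_n) : R :=
  g (E i) X * g (E j) Y - g (E j) X * g (E i) Y.

(** The metric composed with the orthogonal projection onto the plane. *)
Definition plane_proj (X Y : 'rV[R]_n) : R :=
  g (E i) X * g (E i) Y + g (E j) X * g (E j) Y.

Variables (Rm : endo2 R n) (K P al be : R).
Local Notation T := (plane_form al be).
Hypothesis RmE : forall X Y Z W, g (Rm X Y Z) W =
  K * (g Y Z * g X W - g X Z * g Y W)
  + (g Y Z * T X W + T Y Z * g X W - g X Z * T Y W - T X Z * g Y W)
  + P * (plane_vol X Y * plane_vol W Z).

(** As T is traceless, the contraction of the middle term is (n - 2) T; contracting the squared area
    form leaves the metric of the plane. *)
Lemma plane_ricciE Y Z : ricci Rm Y Z =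
  (n%:R - 1) * K * g Y Z + (n%:R - 2) * T Y Z + P * plane_proj Y Z.
Proof.
have Rm_lin : linear (fun X => Rm X Y Z).
  move=> a X X'; apply: (form_nondeg G_pos) => W.
  rewrite formDl formZl !RmE /plane_form /plane_vol.
  by rewrite !(formDl, formDr, formZl, formZr); ring.
rewrite /ricci (mxtrace_lin1 E_on Rm_lin).
have S c A B : \sum_k c * (g (E k) A * g (E k) B) = c * g A B.
  by rewrite -mulr_sumr parseval.
have S1 c : \sum_(k < n) c = n%:R * c :> R by rewrite sumr_const card_ord mulr_natl.
(* Apart from one constant, every summand has the shape c g(E_k, A) g(E_k, B), which Parseval sums
   to c g(A, B). *)
have -> : \sum_k g (Rm (E k) Y Z) (E k) = \sum_k (
    (K * g Y Z + T Y Z)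
    + (- K) * (g (E k) Y * g (E k) Z)
    + g Y Z * al * (g (E k) (E i) * g (E k) (E i))
    + - (g Y Z * al) * (g (E k) (E j) * g (E k) (E j))
    + 2 * g Y Z * be * (g (E k) (E i) * g (E k) (E j))
    + - (al * g (E i) Y) * (g (E k) Z * g (E k) (E i))
    + al * g (E j) Y * (g (E k) Z * g (E k) (E j))
    + - (be * g (E i) Y) * (g (E k) Z * g (E k) (E j))
    + - (be * g (E j) Y) * (g (E k) Z * g (E k) (E i))
    + - (al * g (E i) Z) * (g (E k) Y * g (E k) (E i))
    + al * g (E j) Z * (g (E k) Y * g (E k) (E j))
    + - (be * g (E i) Z) * (g (E k) Y * g (E k) (E j))
    + - (be * g (E j) Z) * (g (E k) Y * g (E k) (E i))
    + P * (g (E j) Y * g (E j) Z) * (g (E k) (E i) * g (E k) (E i))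
    + - (P * (g (E j) Y * g (E i) Z)) * (g (E k) (E i) * g (E k) (E j))
    + - (P * (g (E i) Y * g (E j) Z)) * (g (E k) (E j) * g (E k) (E i))
    + P * (g (E i) Y * g (E i) Z) * (g (E k) (E j) * g (E k) (E j))).
  apply: eq_bigr => k _; rewrite RmE /plane_form /plane_vol.
  rewrite (E_on k k) eqxx (G_sym (E i) (E k)) (G_sym (E j) (E k)).
  by rewrite (G_sym Y (E k)) /=; ring.
rewrite !big_split /= !S !S1 !E_on !eqxx (negbTE ij) [j == i]eq_sym (negbTE ij).
rewrite !(G_sym Z) !(G_sym Y (E _)) /plane_form /plane_proj /=.
by ring.
Qed.

Lemma plane_ricci_opE X Y : g (ricci_op G Rm X) Y = ricci Rm X Y.
Proof.
rewrite /ricci_op sharpP // => a u v; rewrite !plane_ricciE /plane_form /plane_proj.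
by rewrite !(formDr, formZr); ring.
Qed.

Lemma plane_scalarE : scalar_curv G Rm = n%:R * (n%:R - 1) * K + 2 * P.
Proof.
have S_lin : linear (ricci_op G Rm).
  move=> a u v; apply: (form_nondeg G_pos) => w; rewrite formDl formZl.
  rewrite !plane_ricci_opE !plane_ricciE /plane_form /plane_proj.
  by rewrite !(formDl, formDr, formZl, formZr); ring.
rewrite /scalar_curv (mxtrace_lin1 E_on S_lin).
have S c A B : \sum_k c * (g (E k) A * g (E k) B) = c * g A B.
  by rewrite -mulr_sumr parseval.
have S1 c : \sum_(k < n) c = n%:R * c :> R by rewrite sumr_const card_ord mulr_natl.
have -> : \sum_k g (ricci_op G Rm (E k)) (E k) = \sum_k (
    (n%:R - 1) * K
    + ((n%:R - 2) * al + P) * (g (E k) (E i) * g (E k) (E i))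
    + (P - (n%:R - 2) * al) * (g (E k) (E j) * g (E k) (E j))
    + (2 * (n%:R - 2) * be) * (g (E k) (E i) * g (E k) (E j))).
  apply: eq_bigr => k _; rewrite plane_ricci_opE plane_ricciE.
  rewrite /plane_form /plane_proj (E_on k k) eqxx.
  by rewrite (G_sym (E i) (E k)) (G_sym (E j) (E k)) /=; ring.
rewrite !big_split /= !S !S1 !E_on !eqxx (negbTE ij) /=.
by ring.
Qed.

Hypothesis n_gt2 : (2 < n)%N.

(** The constant curvature part and the Kulkarni-Nomizu product of the metric with T have no Weyl
    part, so everything is proportional to P. *)
Lemma plane_weylE X Y Z W : g (weyl_op G Rm X Y Z) W = P *
  (plane_vol X Y * plane_vol W Z
   - (n%:R - 2)^-1 * (plane_proj Y Z * g X W - g X Z * plane_proj Y W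
                      + g Y Z * plane_proj X W - plane_proj X Z * g Y W)
   + 2 * (n%:R - 2)^-1 * (n%:R - 1)^-1 * (g Y Z * g X W - g X Z * g Y W)).
Proof.
rewrite /weyl_op /wedge !(formDl, formNl, formZl) !plane_ricci_opE.
rewrite RmE !plane_ricciE plane_scalarE.
have n2 : n%:R - 2 != 0 :> R by rewrite subr_eq0 (eqr_nat _ n 2); case: n n_gt2 => [|[|[]]].
have n1 : n%:R - 1 != 0 :> R by rewrite subr_eq0 (eqr_nat _ n 1); case: n n_gt2 => [|[|[]]].
rewrite /plane_form /plane_proj /plane_vol.
by field; rewrite n1 n2.
Qed.

Lemma weyl_constant : P = 0 ->
  forall X Y Z W, lower G (weyl_op G Rm) X Y Z W = 0.
Proof. by move=> P0 *; rewrite /lower plane_weylE P0 mul0r. Qed.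

Variables (k l : 'I_n).
Hypotheses (ki : k != i) (kj : k != j) (li : l != i) (lj : l != j) (kl : k != l).

(** The Weyl tensor is invariant under rotations of the plane (i, j) whereas T is not; this
    separates the two tensors. Rotations in (i, k) and (j, k) then see the Weyl tensor with
    coefficients K + al and K - al. *)
Lemma plane_rigidity : 0 < K ->
  lin_dep6 (dot Rm (lower G (weyl_op G Rm))) (dot (wedge (form G)) (lower G Rm)) ->
  P = 0.
Proof.
move=> K0 [a [b [ab0 dep]]].
have n2 : (n%:R - 2)^-1 != 0 :> R.
  by rewrite invr_eq0 subr_eq0 (eqr_nat _ n 2); case: n n_gt2 => [|[|[]]].
set nu := (n%:R - 2)^-1 in n2.
have deltas : ((k == i) = false) * ((i == k) = false) * ((k == j) = false)
  * ((j == k) = false) * ((l == i) = false) * ((i == l) = false)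
  * ((l == j) = false) * ((j == l) = false) * ((k == l) = false)
  * ((l == k) = false) * ((i == j) = false) * ((j == i) = false).
  by do ![split]; apply/negbTE; rewrite // eq_sym.
have wedgeE X Y Z W : g (wedge g X Y Z) W = g Y Z * g X W - g X Z * g Y W.
  by rewrite /wedge formBl !formZl.
have vecE (u v : 'rV[R]_n) : (forall W, g u W = g v W) -> u = v.
  exact: form_nondeg.
pose simpE := (formDl, formDr, formZl, formZr, form0l, form0r, formNl, formNr, E_on, eqxx, deltas).
have Rij : [/\ Rm (E i) (E j) (E i) = - (K + P) *: E j,
               Rm (E i) (E j) (E j) = (K + P) *: E i
             & Rm (E i) (E j) (E k) = 0].
  by split; apply: vecE => W; rewrite RmE /plane_form /plane_vol
    !simpE ?(G_sym W) /=; ring.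
have Rik : [/\ Rm (E i) (E k) (E i) = - (K + al) *: E k,
               Rm (E i) (E k) (E k) = (K + al) *: E i + be *: E j,
               Rm (E i) (E k) (E j) = - be *: E k
             & Rm (E i) (E k) (E l) = 0].
  by split; apply: vecE => W; rewrite RmE /plane_form /plane_vol
    !simpE ?(G_sym W) /=; ring.
have Rjk : [/\ Rm (E j) (E k) (E j) = - (K - al) *: E k,
               Rm (E j) (E k) (E k) = (K - al) *: E j + be *: E i
             & Rm (E j) (E k) (E l) = 0].
  by split; apply: vecE => W; rewrite RmE /plane_form /plane_vol
    !simpE ?(G_sym W) /=; ring.
have Wij : [/\ wedge g (E i) (E j) (E i) = - E j,
               wedge g (E i) (E j) (E j) = E i
             & wedge g (E i) (E j) (E k) = 0].
  by split; apply: vecE => W; rewrite wedgeE !simpE ?formNl /=; ring.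
have Wik : [/\ wedge g (E i) (E k) (E i) = - E k,
               wedge g (E i) (E k) (E k) = E i,
               wedge g (E i) (E k) (E j) = 0
             & wedge g (E i) (E k) (E l) = 0].
  by split; apply: vecE => W; rewrite wedgeE !simpE ?formNl /=; ring.
have Wjk : [/\ wedge g (E j) (E k) (E j) = - E k,
               wedge g (E j) (E k) (E k) = E j
             & wedge g (E j) (E k) (E l) = 0].
  by split; apply: vecE => W; rewrite wedgeE !simpE ?formNl /=; ring.
case: Rij Rik Rjk => Rij1 Rij2 Rij3 [Rik1 Rik2 Rik3 Rik4] [Rjk1 Rjk2 Rjk3].
case: Wij Wik Wjk => Wij1 Wij2 Wij3 [Wik1 Wik2 Wik3 Wik4] [Wjk1 Wjk2 Wjk3].
have : forall X Y Z W, lower G (weyl_op G Rm) X Y Z W = _ := plane_weylE.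
have : forall X Y Z W, lower G Rm X Y Z W = _ := RmE.
move: (lower G (weyl_op G Rm)) (lower G Rm) dep => Ct Rt dep RtE CtE.
have e1 : b * al = 0.
  have := dep (E i) (E k) (E k) (E j) (E i) (E j).
  rewrite /dot Rij1 Rij2 Rij3 Wij1 Wij2 Wij3 !CtE !RtE.
  rewrite /plane_form /plane_proj /plane_vol !simpE /=.
  rewrite !(mulr0, mul0r, addr0, add0r, subr0, sub0r, oppr0, mulr1, mul1r).
  by lra.
have e2 : b * be = 0.
  have := dep (E i) (E k) (E k) (E i) (E i) (E j).
  rewrite /dot Rij1 Rij3 Wij1 Wij3 !CtE !RtE.
  rewrite /plane_form /plane_proj /plane_vol !simpE /=.
  rewrite !(mulr0, mul0r, addr0, add0r, subr0, sub0r, oppr0, mulr1, mul1r).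
  by lra.
(* Here R.C has the value (K + al) P nu and Q(g, R) the value -al, which [e1] removes. *)
have e3 : a * ((K + al) * (P * nu)) = 0.
  have := dep (E i) (E l) (E l) (E k) (E i) (E k).
  rewrite /dot Rik1 Rik2 Rik4 Wik1 Wik2 Wik4 !CtE !RtE.
  rewrite /plane_form /plane_proj /plane_vol !simpE /= -/nu.
  rewrite !(mulr0, mul0r, addr0, add0r, subr0, sub0r, oppr0, mulr1, mul1r).
  by move: e1; lra.
have e4 : a * ((K - al) * (P * nu)) = 0.
  have := dep (E j) (E l) (E l) (E k) (E j) (E k).
  rewrite /dot Rjk1 Rjk2 Rjk3 Wjk1 Wjk2 Wjk3 !CtE !RtE.
  rewrite /plane_form /plane_proj /plane_vol !simpE /= -/nu.
  rewrite !(mulr0, mul0r, addr0, add0r, subr0, sub0r, oppr0, mulr1, mul1r).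
  by move: e1; lra.
(* Adding [e3] and [e4] eliminates al, and K > 0 makes the remaining factor nonzero. *)
have aP : a * P = 0.
  have : a * P * (2 * K * nu) = 0 by lra.
  move=> /eqP; rewrite mulf_eq0 => /orP[/eqP //|].
  by rewrite !mulf_eq0 (negbTE n2) (gt_eqF K0) pnatr_eq0.
have [//|P0] := eqVneq P 0; exfalso.
have a0 : a = 0 by move/eqP: aP; rewrite mulf_eq0 (negbTE P0) orbF => /eqP.
have b0 : b != 0 by case: ab0 => //; rewrite a0 eqxx.
(* With a = al = be = 0 this component of Q(g, R) is the difference of the sectional curvatures K
   and K + P. *)
have := dep (E i) (E j) (E j) (E k) (E i) (E k).
rewrite a0 mul0r add0r => /eqP; rewrite mulf_eq0 (negbTE b0) /= => /eqP.
rewrite /dot Wik1 Wik2 Wik3 !RtE /plane_form /plane_vol !simpE /=.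
have -> : al = 0 by move/eqP: e1; rewrite mulf_eq0 (negbTE b0) => /eqP.
have -> : be = 0 by move/eqP: e2; rewrite mulf_eq0 (negbTE b0) => /eqP.
by move=> h; move/eqP: P0; apply; lra.
Qed.

End PlaneCurvature.

(** * Differential calculus *)

Section Calculus.
Variables (R : realType) (V : normedModType R).
Implicit Types (x v : V).

(** Needed because the identities for Christoffel symbols and inverse matrices hold only on an open
    set, outside which the functions are arbitrary. *)
Lemma near_eq_differentiable (W : normedModType R) (f g : V -> W) x :
  (\near x, f x = g x) -> differentiable f x -> differentiable g x.
Proof.
move=> fg df.
have fgx : f x = g x by exact: nbhs_singleton fg.
have fgs : \forall y \near (0 : V), f (y + x) = g (y + x).
  by move: fg; rewrite (near_shift 0 x) subr0.
have [dfc dfo] := (diff_locallyP x f).1 df.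
have dgo : g \o shift x = cst (g x) + 'd f x +o_ 0 id.
  apply/eqaddoP => e e0; have := (eqaddoP _ _ _ _).1 dfo e e0.
  apply: filter_app; near=> y => /=.
  by rewrite !fctE /= -fgx -(near fgs y).
have dE : 'd g x = 'd f x :> (V -> W) by exact: diff_unique.
by apply/diff_locallyP; rewrite dE.
Unshelve. all: by end_near. Qed.

Lemma derive_comp (W Y : normedModType R) (f : V -> W) (g : W -> Y) x v :
  differentiable f x -> differentiable g (f x) ->
  'D_v (fun y => g (f y)) x = 'D_('D_v f x) g (f x).
Proof.
move=> df dg; rewrite !deriveE //; last exact: differentiable_comp.
by rewrite (diff_comp df dg).
Qed.

Lemma derive_dirP (W : normedModType R) (f : V -> W) x : differentiable f x ->
  forall a u v, 'D_(a *: u + v) f x = a *: 'D_u f x + 'D_v f x.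
Proof. by move=> df a u v; rewrite !deriveE // linearP. Qed.

Lemma derive_add (W : normedModType R) (f g : V -> W) x v :
  differentiable f x -> differentiable g x ->
  'D_v (fun y => f y + g y) x = 'D_v f x + 'D_v g x.
Proof. by move=> df dg; apply: deriveD; exact: diff_derivable. Qed.

Lemma derive_mul (f g : V -> R) x v :
  differentiable f x -> differentiable g x ->
  'D_v (fun y => f y * g y) x = 'D_v f x * g x + f x * 'D_v g x.
Proof.
move=> df dg; rewrite [LHS](deriveM (diff_derivable df) (diff_derivable dg)).
by rewrite addrC /GRing.scale /= [in X in X + _]mulrC.
Qed.

Lemma differentiable_bigsum (W : normedModType R) (I : Type) (r : seq I)
    (f : I -> V -> W) x : (forall i, differentiable (f i) x) ->
  differentiable (fun y => \sum_(i <- r) f i y) x.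
Proof.
move=> df; elim: r => [|i r IH].
  by under [X in differentiable X _]funext do rewrite big_nil; exact: differentiable_cst.
under [X in differentiable X _]funext do rewrite big_cons.
exact: differentiableD.
Qed.

Lemma derive_bigsum (W : normedModType R) (I : Type) (r : seq I)
    (f : I -> V -> W) x v : (forall i, differentiable (f i) x) ->
  'D_v (fun y => \sum_(i <- r) f i y) x = \sum_(i <- r) 'D_v (f i) x.
Proof.
move=> df; elim: r => [|i r IH].
  by under [X in derive X _ _]funext do rewrite big_nil; rewrite big_nil derive_cst.
under [X in derive X _ _]funext do rewrite big_cons.
by rewrite derive_add ?IH ?big_cons //; exact: differentiable_bigsum.
Qed.

Lemma differentiable_bigprod (I : Type) (r : seq I) (f : I -> V -> R) x :
  (forall i, differentiable (f i) x) ->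
  differentiable (fun y => \prod_(i <- r) f i y) x.
Proof.
move=> df; elim: r => [|i r IH].
  by under [X in differentiable X _]funext do rewrite big_nil; exact: differentiable_cst.
under [X in differentiable X _]funext do rewrite big_cons.
exact: differentiableM.
Qed.

Section Matrix.
Variables (p q : nat).
Implicit Type M : V -> 'M[R]_(p, q).

Lemma differentiable_entry M x i j :
  differentiable M x -> differentiable (fun y => M y i j) x.
Proof.
move=> dM; apply: (@differentiable_comp _ _ _ _ M (fun N => N i j : R)) => //.
exact: differentiable_coord.
Qed.

Lemma differentiable_mx M x :
  (forall i j, differentiable (fun y => M y i j) x) -> differentiable M x.
Proof.
move=> dM.
have -> : M = fun y => \sum_i \sum_j M y i j *: delta_mx i j.
  by apply/funext => y; rewrite -matrix_sum_delta.
do 2!apply: differentiable_bigsum => ?.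
exact: differentiableZl.
Qed.

Lemma derive_entry M x v i j : differentiable M x ->
  'D_v (fun y => M y i j) x = ('D_v M x) i j.
Proof. by move=> dM; rewrite derive_mx ?mxE //; exact: diff_derivable. Qed.

End Matrix.

Lemma differentiable_mulmx p q r (M : V -> 'M[R]_(p, q)) (N : V -> 'M[R]_(q, r)) x :
  differentiable M x -> differentiable N x -> differentiable (fun y => M y *m N y) x.
Proof.
move=> dM dN; apply: differentiable_mx => i j.
under [X in differentiable X _]funext do rewrite mxE.
apply: differentiable_bigsum => k.
by apply: differentiableM; exact: differentiable_entry.
Qed.

Lemma derive_mulmx p q r (M : V -> 'M[R]_(p, q)) (N : V -> 'M[R]_(q, r)) x v :
  differentiable M x -> differentiable N x ->
  'D_v (fun y => M y *m N y) x = 'D_v M x *m N x + M x *m 'D_v N x.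
Proof.
move=> dM dN; apply/matrixP => i j.
rewrite -derive_entry; last exact: differentiable_mulmx.
under [X in derive X _ _]funext do rewrite mxE.
rewrite derive_bigsum => [|k]; last first.
  by apply: differentiableM; exact: differentiable_entry.
rewrite !mxE -big_split; apply: eq_bigr => k _ /=.
rewrite derive_mul; [|exact: differentiable_entry..].
by rewrite !derive_entry.
Qed.

Lemma differentiable_trmx p q (M : V -> 'M[R]_(p, q)) x :
  differentiable M x -> differentiable (fun y => (M y)^T) x.
Proof.
move=> dM; apply: differentiable_mx => i j.
under [X in differentiable X _]funext do rewrite mxE.
exact: differentiable_entry.
Qed.

Lemma derive_trmx p q (M : V -> 'M[R]_(p, q)) x v :
  differentiable M x -> 'D_v (fun y => (M y)^T) x = ('D_v M x)^T.
Proof.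
move=> dM; apply/matrixP => i j.
rewrite -derive_entry; last exact: differentiable_trmx.
under [X in derive X _ _]funext do rewrite mxE.
by rewrite derive_entry // mxE.
Qed.

Lemma differentiable_det n (M : V -> 'M[R]_n) x :
  differentiable M x -> differentiable (fun y => \det (M y)) x.
Proof.
move=> dM; rewrite /determinant; apply: differentiable_bigsum => s.
apply: differentiableM; first exact: differentiable_cst.
by apply: differentiable_bigprod => i; exact: differentiable_entry.
Qed.

Lemma differentiable_form n (G : V -> 'M[R]_n) (a b : V -> 'rV[R]_n) x :
  differentiable G x -> differentiable a x -> differentiable b x ->
  differentiable (fun y => form (G y) (a y) (b y)) x.
Proof.
move=> dG da db; apply: differentiable_entry.
apply: differentiable_mulmx; last exact: differentiable_trmx.
exact: differentiable_mulmx.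
Qed.

Lemma derive_form n (G : V -> 'M[R]_n) (a b : V -> 'rV[R]_n) x v :
  differentiable G x -> differentiable a x -> differentiable b x ->
  'D_v (fun y => form (G y) (a y) (b y)) x =
  form ('D_v G x) (a x) (b x) + form (G x) ('D_v a x) (b x)
  + form (G x) (a x) ('D_v b x).
Proof.
move=> dG da db.
have dT := differentiable_trmx db.
have dm := differentiable_mulmx da dG.
rewrite /form derive_entry; last exact: differentiable_mulmx.
rewrite derive_mulmx // derive_mulmx // derive_trmx //.
by rewrite mulmxDl !mxE; ring.
Qed.
End Calculus.

Section Smooth.
Variables (R : realType) (V W : normedModType R) (U : set V).

Lemma Ck_sub k (U' : set V) (f : V -> W) : U' `<=` U -> Ck k U f -> Ck k U' f.
Proof.
move=> sub; elim: k f => [|k IH] f /=; first by move=> cf x /sub; exact: cf.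
move=> [df Df]; split; first by move=> x /sub; exact: df.
by move=> v; exact: IH.
Qed.

Lemma smooth_sub (U' : set V) (f : V -> W) :
  U' `<=` U -> smooth_on U f -> smooth_on U' f.
Proof. by move=> sub sf k; exact: Ck_sub (sf k). Qed.

Lemma smooth_differentiable (f : V -> W) x :
  smooth_on U f -> U x -> differentiable f x.
Proof. by move=> sf Ux; have [df _] := sf 1%N; exact: df. Qed.

Lemma smooth_derive (f : V -> W) v : smooth_on U f -> smooth_on U (fun x => 'D_v f x).
Proof. by move=> sf k; have [_ Df] := sf k.+1; exact: Df. Qed.

End Smooth.

(** * Symmetry of second derivatives *)

Section Schwarz.
Variables (R : realType) (V : normedModType R).

Lemma differentiable_id (W : normedModType R) (x : W) : differentiable (fun y => y) x.
Proof. exact: (@ex_diff _ _ _ _ _ id id (is_diff_id x)). Qed.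

Lemma differentiable_line (u z : V) (t : R) :
  differentiable (fun s : R => s *: u + z) t.
Proof.
apply: differentiableD; last exact: differentiable_cst.
by apply: differentiableZl; exact: differentiable_id.
Qed.

Lemma derive_line (u z : V) (t : R) : 'D_1 (fun s : R => s *: u + z) t = u.
Proof.
have ds : differentiable (fun s : R => s *: u) t.
  by apply: differentiableZl; exact: differentiable_id.
rewrite derive_add; [|exact: ds|exact: differentiable_cst].
by rewrite derive_cst addr0 deriveE // diff_val scale1r.
Qed.

Lemma is_derive_line (f : V -> R) (u z : V) (t : R) :
  differentiable f (t *: u + z) ->
  is_derive t (1 : R) (fun s : R => f (s *: u + z)) ('D_u f (t *: u + z)).
Proof.
move=> df.
have dln := differentiable_line u z t.
apply: DeriveDef.
  by apply: diff_derivable; exact: (@differentiable_comp _ _ _ _ (fun s : R => s *: u + z)).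
by rewrite (@derive_comp _ _ _ _ (fun s : R => s *: u + z)) // derive_line.
Qed.

Lemma mvt_line (f : V -> R) (u z : V) (s : R) : 0 < s ->
  (forall t, 0 <= t <= s -> differentiable f (t *: u + z)) ->
  exists2 c, 0 <= c <= s & f (s *: u + z) - f z = s * 'D_u f (c *: u + z).
Proof.
move=> s0 df.
have dl t : 0 <= t <= s ->
    is_derive t (1 : R) (fun t : R => f (t *: u + z)) ('D_u f (t *: u + z)).
  by move=> ts; apply: is_derive_line; exact: df.
have [||c cs E] := @MVT_segment R (fun t => f (t *: u + z))
    (fun t => 'D_u f (t *: u + z)) 0 s (ltW s0).
- by move=> t; rewrite in_itv /= => /andP[/ltW t0 /ltW ts]; apply: dl; rewrite t0.
- apply: derivable_within_continuous => t; rewrite in_itv /= => ts.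
  by have [] := dl t ts.
exists c; first by move: cs; rewrite in_itv.
by move: E; rewrite scale0r add0r subr0 mulrC.
Qed.

(** The mean value theorem along u for the increment z -> f(z + s v) - f(z), followed by the one
    along v for [fu]. *)
Lemma mvt_square (f fu : V -> R) (U : set V) (u v x : V) (s : R) : 0 < s ->
  (forall a b, 0 <= a <= s -> 0 <= b <= s -> U (a *: u + (b *: v + x))) ->
  (forall y, U y -> differentiable f y /\ 'D_u f y = fu y) ->
  (forall y, U y -> differentiable fu y) ->
  exists c d, [/\ 0 <= c <= s, 0 <= d <= s &
    (f (s *: u + (s *: v + x)) - f (s *: u + x)) - (f (s *: v + x) - f x)
    = s * (s * 'D_v fu (c *: u + (d *: v + x)))].
Proof.
move=> s0 sq df dfu.
pose g (z : V) := f (z + s *: v) - f z.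
have s0s : 0 <= s <= s by rewrite ltW //=.
have z0s : 0 <= (0 : R) <= s by rewrite lexx ltW.
have sqA a : 0 <= a <= s -> U (a *: u + x + s *: v).
  by move=> as_; rewrite -addrA [x + _]addrC; exact: sq.
have sq0 a : 0 <= a <= s -> U (a *: u + x).
  by move=> as_; have := sq a 0 as_ z0s; rewrite scale0r add0r.
have dg (a : R) : 0 <= a <= s -> differentiable g (a *: u + x) /\
    'D_u g (a *: u + x) = fu (a *: u + x + s *: v) - fu (a *: u + x).
  move=> as_.
  have dt : differentiable (fun z : V => z + s *: v) (a *: u + x).
    by apply: differentiableD; [exact: differentiable_id|exact: differentiable_cst].
  have [d1 e1] := df _ (sqA a as_); have [d2 e2] := df _ (sq0 a as_).
  have dc : differentiable (fun z => f (z + s *: v)) (a *: u + x).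
    exact: (@differentiable_comp _ _ _ _ (fun z : V => z + s *: v)).
  split; first exact: differentiableB.
  rewrite (@deriveB _ _ _ (fun z => f (z + s *: v)) f); [|exact: diff_derivable..].
  rewrite (@derive_comp _ _ _ _ (fun z : V => z + s *: v)) //.
  rewrite derive_add; [|exact: differentiable_id|exact: differentiable_cst].
  by rewrite derive_id derive_cst addr0 e1 e2.
have [c cs] := @mvt_line g u x s s0 (fun t ts => (dg t ts).1).
rewrite (dg c cs).2 => E.
have [|d ds E2] := @mvt_line fu v (c *: u + x) s s0.
  by move=> t ts; apply: dfu; rewrite addrCA; exact: sq.
exists c, d; split => //; move: E E2.
rewrite /g [d *: v + _]addrCA [s *: v + (c *: u + x)]addrC => E <-.
rewrite -E; congr (f _ - f _ - (f _ - f _)); first by rewrite addrAC addrA.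
by rewrite addrC.
Qed.

(** The second difference of f over a small square, taken in the two orders, is s^2 times either
    mixed derivative at some point of the square. The derivatives are separate parameters agreeing
    with those of f on U, so that entries of matrix-valued derivatives can be supplied directly. *)
Lemma schwarz (f fu fv fuv fvu : V -> R) (U : set V) (u v x : V) :
  open U -> U x ->
  (forall y, U y -> differentiable f y) ->
  (forall y, U y -> 'D_u f y = fu y) -> (forall y, U y -> 'D_v f y = fv y) ->
  (forall y, U y -> differentiable fu y /\ 'D_v fu y = fvu y) ->
  (forall y, U y -> differentiable fv y /\ 'D_u fv y = fuv y) ->
  {for x, continuous fvu} -> {for x, continuous fuv} ->
  fvu x = fuv x.
Proof.
move=> oU Ux df dfu dfv d2u d2v cvu cuv.
apply/eqP; rewrite -subr_eq0 -normr_le0; apply/ler_addgt0Pr => e e0.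
rewrite add0r.
have e2 : 0 < e / 2 by rewrite divr_gt0.
have n1 : \forall y \near x, U y by exact: open_nbhs_nbhs.
have n2 : \forall y \near x, `|fvu x - fvu y| < e / 2.
  by have /cvgrPdist_lt := cvu; apply.
have n3 : \forall y \near x, `|fuv x - fuv y| < e / 2.
  by have /cvgrPdist_lt := cuv; apply.
have : nbhs x [set y | U y /\ (`|fvu x - fvu y| < e / 2 /\
    `|fuv x - fuv y| < e / 2)] by exact: filterI n1 (filterI n2 n3).
move=> /nbhs_ballP[r /= r0 ball_r].
(* The square of side s stays strictly inside the ball; the 1 also covers u = v = 0. *)
pose s := r / (`|u| + `|v| + 1).
have den : 0 < `|u| + `|v| + 1 by rewrite ltr_wpDl // addr_ge0.
have s0 : 0 < s by rewrite divr_gt0.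
have inb a b : 0 <= a <= s -> 0 <= b <= s -> ball x r (a *: u + (b *: v + x)).
  move=> /andP[a0 as_] /andP[b0 bs]; rewrite -ball_normE /ball_ /=.
  have -> : x - (a *: u + (b *: v + x)) = - (a *: u + b *: v).
    by rewrite [a *: u + _]addrA opprD addrCA subrr addr0.
  rewrite normrN.
  apply: (le_lt_trans (ler_normD _ _)); rewrite !normrZ !ger0_norm //.
  apply: (@le_lt_trans _ _ (s * (`|u| + `|v|))).
    by rewrite mulrDr lerD // ler_wpM2r.
  by rewrite /s -mulrA gtr_pMr // ltr_pdivrMl // mulr1 ltrDl.
have inb' a b : 0 <= a <= s -> 0 <= b <= s -> ball x r (b *: v + (a *: u + x)).
  by move=> as_ bs; rewrite addrCA; exact: inb.
have [c [d [cs ds E1]]] := @mvt_square f fu (ball x r) u v x s s0 inb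
  (fun y yb => conj (df y (ball_r y yb).1) (dfu y (ball_r y yb).1))
  (fun y yb => (d2u y (ball_r y yb).1).1).
have [c' [d' [cs' ds' E2]]] := @mvt_square f fv (ball x r) v u x s s0
  (fun a b as_ bs => inb' b a bs as_)
  (fun y yb => conj (df y (ball_r y yb).1) (dfv y (ball_r y yb).1))
  (fun y yb => (d2v y (ball_r y yb).1).1).
have [Uy [b1 _]] := ball_r _ (inb c d cs ds).
have [Uz [_ b2]] := ball_r _ (inb' d' c' ds' cs').
move: E1 E2; rewrite (d2u _ Uy).2 (d2v _ Uz).2.
rewrite [s *: v + (s *: u + x)]addrCA => E1 E2.
(* Both values are the same second difference divided by s^2. *)
have E3 : fvu (c *: u + (d *: v + x)) = fuv (c' *: v + (d' *: u + x)).
  apply: (mulfI (lt0r_neq0 s0)); apply: (mulfI (lt0r_neq0 s0)).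
  by rewrite -E1 -E2; ring.
rewrite -(subrKA (fvu (c *: u + (d *: v + x)))) {2}E3.
apply: ltW; apply: (le_lt_trans (ler_normD _ _)).
by rewrite [ltRHS]splitr ltrD // distrC.
Qed.

End Schwarz.

Section MatrixCalculus.
Variables (R : realType) (V : normedModType R).
Implicit Types (x u v : V).

Lemma derive_swap p q (U : set V) (F : V -> 'M[R]_(p, q)) x u v :
  open U -> smooth_on U F -> U x ->
  'D_u (fun y => 'D_v F y) x = 'D_v (fun y => 'D_u F y) x.
Proof.
move=> oU sF Ux; apply/matrixP => i j.
have dF y : U y -> differentiable F y by exact: smooth_differentiable.
have dD w y : U y -> differentiable (fun z => 'D_w F z) y.
  by apply: smooth_differentiable; exact: smooth_derive.
have cD w w' : {for x, continuous (fun y => ('D_w' (fun z => 'D_w F z) y) i j)}.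
  apply: differentiable_continuous; apply: differentiable_entry.
  apply: smooth_differentiable Ux; apply: smooth_derive.
  exact: smooth_derive.
apply: (@schwarz _ _ (fun y => F y i j) (fun y => ('D_v F y) i j)
  (fun y => ('D_u F y) i j) (fun y => ('D_v (fun z => 'D_u F z) y) i j)
  (fun y => ('D_u (fun z => 'D_v F z) y) i j) U v u x) => //.
- by move=> y /dF; exact: differentiable_entry.
- by move=> y /dF; exact: derive_entry.
- by move=> y /dF; exact: derive_entry.
- by move=> y /(dD v) d; split; [exact: differentiable_entry|exact: derive_entry].
- by move=> y /(dD u) d; split; [exact: differentiable_entry|exact: derive_entry].
Qed.

Lemma differentiable_scale p q (s : V -> R) (f : V -> 'M[R]_(p, q)) x :
  differentiable s x -> differentiable f x ->
  differentiable (fun y => s y *: f y) x.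
Proof.
move=> ds df; apply: differentiable_mx => i j.
under [X in differentiable X _]funext do rewrite mxE.
by apply: differentiableM => //; exact: differentiable_entry.
Qed.

Lemma derive_scale p q (s : V -> R) (f : V -> 'M[R]_(p, q)) x v :
  differentiable s x -> differentiable f x ->
  'D_v (fun y => s y *: f y) x = 'D_v s x *: f x + s x *: 'D_v f x.
Proof.
move=> ds df; apply/matrixP => i j.
rewrite -derive_entry; last exact: differentiable_scale.
under [X in derive X _ _]funext do rewrite mxE.
rewrite derive_mul //; last exact: differentiable_entry.
by rewrite derive_entry // !mxE.
Qed.

Lemma differentiable_invmx n (M : V -> 'M[R]_n) x :
  (\forall y \near x, M y \in unitmx) -> differentiable M x ->
  differentiable (fun y => invmx (M y)) x.
Proof.
move=> Mu dM.
(* [invmx] is given by the adjugate on invertible matrices only, hence the detour through a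
   neighbourhood. *)
apply: (@near_eq_differentiable _ _ _ (fun y => (\det (M y))^-1 *: \adj (M y))).
  by near=> y; rewrite /invmx ifT //; near: y.
have ddet := differentiable_det dM.
apply: differentiable_scale.
  apply: (@differentiableV _ _ (fun y => \det (M y))) => //.
  by have := nbhs_singleton Mu; rewrite unitmxE unitfE.
apply: differentiable_mx => i j; under [X in differentiable X _]funext do rewrite mxE.
apply: differentiableM; first exact: differentiable_cst.
apply: differentiable_det; apply: differentiable_mx => k l.
under [X in differentiable X _]funext do rewrite !mxE.
exact: differentiable_entry.
Unshelve. all: by end_near. Qed.

End MatrixCalculus.

Section BilinearField.
Variables (R : realType) (V Y : normedModType R) (D : set Y) (p : nat).
Variable Phi : Y -> 'rV[R]_p -> 'rV[R]_p -> 'rV[R]_p.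
Hypothesis D_open : open D.
Hypothesis Phi_linl : forall z, D z -> forall t a a' b,
  Phi z (t *: a + a') b = t *: Phi z a b + Phi z a' b.
Hypothesis Phi_linr : forall z, D z -> forall t a b b',
  Phi z a (t *: b + b') = t *: Phi z a b + Phi z a b'.
Hypothesis Phi_diff : forall z, D z -> forall a b,
  differentiable (fun z => Phi z a b) z.

Lemma bilinear_field_expand z a b : D z ->
  Phi z a b = \sum_i \sum_j (a 0 i * b 0 j) *: Phi z (delta_mx 0 i) (delta_mx 0 j).
Proof.
move=> Dz.
have l0 b' : Phi z 0 b' = 0.
  by have := Phi_linl Dz (-1) 0 0 b'; rewrite scaler0 addr0 scaleN1r addNr.
have r0 a' : Phi z a' 0 = 0.
  by have := Phi_linr Dz (-1) a' 0 0; rewrite scaler0 addr0 scaleN1r addNr.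
have lD b' a1 a2 : Phi z (a1 + a2) b' = Phi z a1 b' + Phi z a2 b'.
  by rewrite -{1}[a1]scale1r Phi_linl // scale1r.
have rD a' b1 b2 : Phi z a' (b1 + b2) = Phi z a' b1 + Phi z a' b2.
  by rewrite -{1}[b1]scale1r Phi_linr // scale1r.
rewrite [in LHS](row_sum_delta a) (big_morph (Phi z ^~ b) (lD b) (l0 b)).
apply: eq_bigr => i _; rewrite -[_ *: _]addr0 Phi_linl // l0 addr0.
rewrite [in LHS](row_sum_delta b) (big_morph (Phi z _) (rD _) (r0 _)) scaler_sumr.
apply: eq_bigr => j _; rewrite -[b 0 j *: _]addr0 Phi_linr // r0 addr0.
by rewrite scalerA.
Qed.

Variables (F : V -> Y) (a b : V -> 'rV[R]_p) (x : V).
Hypotheses (dF : differentiable F x) (da : differentiable a x).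
Hypotheses (db : differentiable b x) (Fx : D (F x)).

Let near_expand : \forall y \near x,
  \sum_i \sum_j (a y 0 i * b y 0 j) *: Phi (F y) (delta_mx 0 i) (delta_mx 0 j)
  = Phi (F y) (a y) (b y).
Proof.
have cF : {for x, continuous F} by exact: differentiable_continuous.
have DF : \forall y \near x, D (F y).
  by apply: cF; exact: open_nbhs_nbhs.
by near=> y; rewrite -bilinear_field_expand //; near: y.
Unshelve. all: by end_near. Qed.

Let dab i j : differentiable (fun y => a y 0 i * b y 0 j) x.
Proof. by apply: differentiableM; exact: differentiable_entry. Qed.

Let dPhiF e e' : differentiable (fun y => Phi (F y) e e') x.
Proof.
apply: (@differentiable_comp _ _ _ _ F (fun z => Phi z e e')) => //.
exact: Phi_diff.
Qed.

(** Meant for the Christoffel symbols of the target, evaluated along the immersion on its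
    derivatives. Since [Phi] is bilinear only over [D], the coordinate expansion is available only
    near x. *)
Lemma differentiable_bilinear_field :
  differentiable (fun y => Phi (F y) (a y) (b y)) x.
Proof.
apply: near_eq_differentiable near_expand _.
do 2!apply: differentiable_bigsum => ?.
exact: differentiable_scale.
Qed.

Lemma derive_bilinear_field v :
  'D_v (fun y => Phi (F y) (a y) (b y)) x =
  'D_('D_v F x) (fun z => Phi z (a x) (b x)) (F x)
  + Phi (F x) ('D_v a x) (b x) + Phi (F x) (a x) ('D_v b x).
Proof.
rewrite -(near_eq_derive v near_expand) derive_bigsum => [|i]; last first.
  by apply: differentiable_bigsum => j; exact: differentiable_scale.
rewrite (near_eq_derive (g := fun z => \sum_i \sum_j (a x 0 i * b x 0 j) *:
    Phi z (delta_mx 0 i) (delta_mx 0 j))); last first.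
  have : \forall z \near F x, D z by exact: open_nbhs_nbhs.
  by apply: filter_app; near=> z => Dz; exact: bilinear_field_expand.
rewrite derive_bigsum => [|i]; last first.
  apply: differentiable_bigsum => j; apply: differentiable_scale.
    exact: differentiable_cst.
  exact: Phi_diff.
rewrite (bilinear_field_expand ('D_v a x)) // (bilinear_field_expand (a x)) //.
rewrite -!big_split; apply: eq_bigr => i _ /=.
rewrite derive_bigsum => [|j]; last exact: differentiable_scale.
rewrite derive_bigsum => [|j]; last first.
  by apply: differentiable_scale; [exact: differentiable_cst|exact: Phi_diff].
rewrite -!big_split; apply: eq_bigr => j _ /=.
rewrite derive_scale // derive_scale; [|exact: differentiable_cst|exact: Phi_diff].
rewrite derive_cst scale0r add0r derive_mul; [|exact: differentiable_entry..].
rewrite !derive_entry // (@derive_comp _ _ _ _ F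
  (fun z => Phi z (delta_mx 0 i) (delta_mx 0 j)) x v dF (Phi_diff Fx _ _)).
by rewrite scalerDl -[RHS]addrA [RHS]addrC.
Unshelve. all: by end_near. Qed.

End BilinearField.

(** * The Levi-Civita connection in a chart *)

Section FormMatrix.
Variables (R : realType) (n : nat).

Lemma formDm (G H : 'M[R]_n) u v : form (G + H) u v = form G u v + form H u v.
Proof. by rewrite /form mulmxDr mulmxDl mxE. Qed.

Lemma formZm a (G : 'M[R]_n) u v : form (a *: G) u v = a * form G u v.
Proof. by rewrite /form -scalemxAr -scalemxAl mxE. Qed.

End FormMatrix.

(* Locked copies: comparing two instances of derive or christoffel up to
   conversion unfolds limits and does not terminate in practice. *)
Definition pd (R : realType) (V W : normedModType R)
    : (V -> W) -> V -> V -> W := locked (fun f v x => 'D_v f x).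

Definition chr (R : realType) (n : nat)
    : ('rV[R]_n -> 'M[R]_n) -> 'rV[R]_n -> 'rV[R]_n -> 'rV[R]_n -> 'rV[R]_n :=
  locked (@christoffel R n).

Lemma pdE (R : realType) (V W : normedModType R) (f : V -> W) v x :
  'D_v f x = pd f v x.
Proof. by rewrite /pd -lock. Qed.

Lemma chrE (R : realType) n (g : 'rV[R]_n -> 'M[R]_n) : christoffel g = chr g.
Proof. by rewrite /chr -lock. Qed.

Section Locked.
Variables (R : realType) (V W : normedModType R).
Implicit Types (x u v : V).

Lemma pd_cst (c : W) v x : pd (fun=> c) v x = 0.
Proof. by rewrite -pdE derive_cst. Qed.

Lemma near_eq_pd (f g : V -> W) v x : (\near x, f x = g x) -> pd f v x = pd g v x.
Proof. by move=> fg; rewrite -!pdE; exact: near_eq_derive. Qed.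

Lemma pd_dir (f : V -> W) x : differentiable f x ->
  forall a u v, pd f (a *: u + v) x = a *: pd f u x + pd f v x.
Proof. by move=> df a u v; rewrite -!pdE derive_dirP. Qed.

Lemma pd_add (f g : V -> W) v x : differentiable f x -> differentiable g x ->
  pd (fun y => f y + g y) v x = pd f v x + pd g v x.
Proof. by move=> df dg; rewrite -!pdE derive_add. Qed.

Lemma pd_sub (f g : V -> W) v x : differentiable f x -> differentiable g x ->
  pd (fun y => f y - g y) v x = pd f v x - pd g v x.
Proof. by move=> df dg; rewrite -!pdE; apply: deriveB; exact: diff_derivable. Qed.

Lemma pd_comp (Y : normedModType R) (f : V -> W) (g : W -> Y) v x :
  differentiable f x -> differentiable g (f x) ->
  pd (fun y => g (f y)) v x = pd g (pd f v x) (f x).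
Proof. by move=> df dg; rewrite -!pdE; exact: derive_comp. Qed.

End Locked.

Section LockedForm.
Variables (R : realType) (V : normedModType R).

Lemma pd_mulcst (c : R) (f : V -> R) v x : differentiable f x ->
  pd (fun y => c * f y) v x = c * pd f v x.
Proof.
move=> df; rewrite -!pdE (@derive_mul _ _ (cst c)) //.
by rewrite derive_cst mul0r add0r.
Qed.

Lemma pd_form n (G : V -> 'M[R]_n) (a b : V -> 'rV[R]_n) v x :
  differentiable G x -> differentiable a x -> differentiable b x ->
  pd (fun y => form (G y) (a y) (b y)) v x =
  form (pd G v x) (a x) (b x) + form (G x) (pd a v x) (b x)
  + form (G x) (a x) (pd b v x).
Proof. by move=> *; rewrite -!pdE derive_form. Qed.

Lemma pd_form_cst n (G : V -> 'M[R]_n) (a b : 'rV[R]_n) v x : differentiable G x ->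
  pd (fun y => form (G y) a b) v x = form (pd G v x) a b.
Proof.
move=> dG; rewrite (@pd_form _ _ (fun=> a) (fun=> b)) //; do ?exact: differentiable_cst.
by rewrite !pd_cst form0l form0r !addr0.
Qed.

Lemma smooth_pd (W : normedModType R) (U : set V) (f : V -> W) v :
  smooth_on U f -> smooth_on U (fun x => pd f v x).
Proof.
move=> sf; rewrite (_ : (fun x => _) = fun x => 'D_v f x); first exact: smooth_derive.
by apply/funext => x; rewrite pdE.
Qed.

Lemma pd_swap p q (U : set V) (F : V -> 'M[R]_(p, q)) u v x :
  open U -> smooth_on U F -> U x ->
  pd (fun y => pd F v y) u x = pd (fun y => pd F u y) v x.
Proof.
move=> oU sF Ux; rewrite -!pdE.
have E w : pd F w = fun y => 'D_w F y by apply/funext => y; rewrite pdE.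
by rewrite !E; exact: derive_swap Ux.
Qed.

End LockedForm.

(** Phrased for any open set of coordinates, so that it applies to the part of a chart of the
    submanifold that is mapped into one chart of the ambient space. *)
Definition chart_metric (R : realType) (n : nat) (g : 'rV[R]_n -> 'M[R]_n)
    (U : set 'rV[R]_n) : Prop :=
  [/\ open U, smooth_on U g,
      forall x, U x -> forall u v, form (g x) u v = form (g x) v u &
      forall x, U x -> forall u, u != 0 -> 0 < form (g x) u u].

Section LeviCivita.
Variables (R : realType) (n : nat) (g : 'rV[R]_n -> 'M[R]_n) (U : set 'rV[R]_n).
Hypothesis gU : chart_metric g U.

Let U_open : open U. Proof. by case: gU. Qed.

Let g_smooth : smooth_on U g. Proof. by case: gU. Qed.

Let g_sym x : U x -> forall u v, form (g x) u v = form (g x) v u.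
Proof. by case: gU => _ _ + _; apply. Qed.

Let g_pos x : U x -> forall u, u != 0 -> 0 < form (g x) u u.
Proof. by case: gU => _ _ _; apply. Qed.

Let near_U x : U x -> \forall y \near x, U y.
Proof. by move=> Ux; exact: open_nbhs_nbhs. Qed.

Let g_diff x : U x -> differentiable g x.
Proof. by move=> Ux; exact: smooth_differentiable g_smooth Ux. Qed.

Let Dg_diff v x : U x -> differentiable (fun y => pd g v y) x.
Proof. by apply: smooth_differentiable; exact: smooth_pd. Qed.

Lemma pd_metric_sym x u a b : U x -> form (pd g u x) a b = form (pd g u x) b a.
Proof.
move=> Ux; rewrite -!pd_form_cst; do ?exact: g_diff.
apply: near_eq_pd; have := near_U Ux; apply: filter_app; near=> y => Uy.
exact: g_sym.
Unshelve. all: by end_near. Qed.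

(** Christoffel symbols of the first kind. *)
Definition koszul x u v w : R :=
  2^-1 * (form (pd g u x) v w + form (pd g v x) u w - form (pd g w x) u v).

Lemma koszul_lin x a w w' u v : U x ->
  koszul x u v (a *: w + w') = a * koszul x u v w + koszul x u v w'.
Proof.
move=> Ux; rewrite /koszul pd_dir; last exact: g_diff.
by rewrite formDm formZm !(formDr, formZr); ring.
Qed.

Lemma chrP x u v w : U x -> form (g x) (chr g x u v) w = koszul x u v w.
Proof.
move=> Ux.
have E z : 2^-1 * ('D_u (fun y => form (g y) v z) x + 'D_v (fun y => form (g y) u z) x
    - 'D_z (fun y => form (g y) u v) x) = koszul x u v z.
  by rewrite !pdE !pd_form_cst //; exact: g_diff.
rewrite -chrE /christoffel (_ : (fun w => _) = koszul x u v).
  by rewrite sharpP //; [move=> *; exact: g_pos|move=> *; exact: koszul_lin].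
by apply/funext => z; exact: E.
Qed.

Lemma chrC x u v : U x -> chr g x u v = chr g x v u.
Proof.
move=> Ux; apply: (form_nondeg (g_pos Ux)) => w; rewrite !chrP //.
by rewrite /koszul (pd_metric_sym w u v) //; ring.
Qed.

Lemma chr_linl x a u u' v : U x ->
  chr g x (a *: u + u') v = a *: chr g x u v + chr g x u' v.
Proof.
move=> Ux; apply: (form_nondeg (g_pos Ux)) => w.
rewrite formDl formZl !chrP // /koszul pd_dir; last exact: g_diff.
by rewrite formDm formZm !(formDl, formZl); ring.
Qed.

Lemma chr_linr x a u v v' : U x ->
  chr g x u (a *: v + v') = a *: chr g x u v + chr g x u v'.
Proof. by move=> Ux; rewrite chrC // chr_linl // !(chrC u). Qed.

Lemma chr_differentiable x u v : U x -> differentiable (fun y => chr g y u v) x.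
Proof.
move=> Ux.
have nU := near_U Ux.
apply: (@near_eq_differentiable _ _ _
  (fun y => (\row_j koszul y u v (delta_mx 0 j)) *m invmx (g y))).
  apply: filter_app nU; near=> y => Uy.
  apply: (form_nondeg (g_pos Uy)) => w; rewrite chrP //.
  rewrite -[LHS]/(form (g y) (sharp (g y) (koszul y u v)) w).
  by rewrite sharpP //; [move=> *; exact: g_pos|move=> *; exact: koszul_lin].
apply: differentiable_mulmx.
  apply: differentiable_mx => i j.
  under [X in differentiable X _]funext do rewrite mxE.
  rewrite /koszul; apply: differentiableM; first exact: differentiable_cst.
  have dd a b c : differentiable (fun y => form (pd g a y) b c) x.
    by apply: differentiable_form; [exact: Dg_diff|exact: differentiable_cst..].
  by apply: differentiableB => //; apply: differentiableD.
apply: differentiable_invmx; last exact: g_diff.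
by apply: filter_app nU; near=> y => Uy; exact: form_unit (g_pos Uy).
Unshelve. all: by end_near. Qed.

Lemma metric_compatible x u a b : U x -> form (pd g u x) a b =
  form (g x) (chr g x u a) b + form (g x) a (chr g x u b).
Proof.
move=> Ux; rewrite (g_sym Ux a) !chrP // /koszul.
by rewrite (pd_metric_sym u b a) //; field.
Qed.

Lemma curvatureE x u v w : U x -> curvature g x u v w =
  pd (fun y => chr g y v w) u x - pd (fun y => chr g y u w) v x
  + chr g x u (chr g x v w) - chr g x v (chr g x u w).
Proof.
move=> Ux; rewrite /curvature /curvature_field.
have nablaE a b : nabla g (cst a) (cst b) = fun y => chr g y a b.
  by apply/funext => y; rewrite /nabla derive_cst add0r chrE.
rewrite -!/(cst _) !nablaE.
have -> : nabla g (lie_bracket (cst u) (cst v)) (cst w) x = 0.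
  rewrite /nabla /lie_bracket !derive_cst subrr add0r chrE.
  have := chr_linl (-1) 0 0 w Ux.
  by rewrite scaler0 addr0 scaleN1r addNr.
by rewrite /nabla subr0 chrE !pdE opprD !addrA; congr (_ - _); rewrite addrAC.
Qed.

Lemma form_pd_chr x u v w z : U x ->
  form (g x) (pd (fun y => chr g y v w) u x) z =
  pd (fun y => koszul y v w z) u x - form (pd g u x) (chr g x v w) z.
Proof.
move=> Ux.
have -> : pd (fun y => koszul y v w z) u x
    = pd (fun y => form (g y) (chr g y v w) z) u x.
  apply: near_eq_pd; have := near_U Ux; apply: filter_app; near=> y => Uy.
  by rewrite chrP.
rewrite (@pd_form _ _ _ g (fun y => chr g y v w) (fun=> z));
  [|exact: g_diff|exact: chr_differentiable|exact: differentiable_cst].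
by rewrite pd_cst form0r addr0 addrAC subrr add0r.
Unshelve. all: by end_near. Qed.

(** Lowering the index replaces derivatives of [chr] by derivatives of [koszul]; the derivative of
    the metric that this costs is turned into products of Christoffel symbols by
    [metric_compatible]. *)
Lemma form_curvature x u v w z : U x ->
  form (g x) (curvature g x u v w) z =
  pd (fun y => koszul y v w z) u x - pd (fun y => koszul y u w z) v x
  - form (g x) (chr g x v w) (chr g x u z)
  + form (g x) (chr g x u w) (chr g x v z).
Proof.
move=> Ux; rewrite curvatureE // !(formDl, formNl) !form_pd_chr //.
by rewrite (metric_compatible u) // (metric_compatible v) //; ring.
Qed.

Lemma pd_koszul x u v w z : U x -> pd (fun y => koszul y v w z) u x =
  2^-1 * (form (pd (fun y => pd g v y) u x) w z
          + form (pd (fun y => pd g w y) u x) v z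
          - form (pd (fun y => pd g z y) u x) v w).
Proof.
move=> Ux.
have dd a b c : differentiable (fun y => form (pd g a y) b c) x.
  by apply: differentiable_form; [exact: Dg_diff|exact: differentiable_cst..].
have dD : differentiable (fun y => form (pd g v y) w z + form (pd g w y) v z) x.
  exact: differentiableD.
rewrite /koszul pd_mulcst; last exact: differentiableB.
rewrite pd_sub // pd_add // !pd_form_cst //; exact: Dg_diff.
Qed.

Lemma hessian_sym x u v a b : U x ->
  form (pd (fun y => pd g v y) u x) a b = form (pd (fun y => pd g v y) u x) b a.
Proof.
move=> Ux; rewrite -!pd_form_cst; do ?exact: Dg_diff.
apply: near_eq_pd; have := near_U Ux; apply: filter_app; near=> y => Uy.
exact: pd_metric_sym.
Unshelve. all: by end_near. Qed.

(** The lowered curvature is a combination of second derivatives [H] of the metric and products [Q]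
    of Christoffel symbols. [H] is symmetric in its first pair by Schwarz and in its second pair as
    the metric is; [Q] is symmetric within the pairs and under their exchange. *)
Lemma curvature_symmetries x : U x ->
  let T u v w z := form (g x) (curvature g x u v w) z in
  [/\ forall u v w z, T u v w z = - T v u w z,
      forall u v w z, T u v w z = T w z u v &
      forall u v w z, T u v w z + T v w u z + T w u v z = 0].
Proof.
move=> Ux T.
pose H a b c d := form (pd (fun y => pd g b y) a x) c d.
pose Q a b c d := form (g x) (chr g x a b) (chr g x c d).
have HC a b c d : H a b c d = H b a c d.
  by rewrite /H (pd_swap _ _ U_open g_smooth Ux).
have HS a b c d : H a b c d = H a b d c by exact: hessian_sym.
have QC a b c d : Q a b c d = Q b a c d by rewrite /Q (chrC a b).
have QS a b c d : Q a b c d = Q c d a b by rewrite /Q g_sym.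
have TE u v w z : T u v w z =
    2^-1 * (H u w v z - H u z v w - H v w u z + H v z u w)
    - Q v w u z + Q u w v z.
  rewrite /T form_curvature // !pd_koszul // -!/(H _ _ _ _) -!/(Q _ _ _ _).
  by rewrite (HC v u); clearbody H Q; field.
clearbody H Q; split=> u v w z; rewrite !TE.
- by field.
- have -> : H w u z v = H u w v z by rewrite HC HS.
  have -> : H w v z u = H v w u z by rewrite HC HS.
  have -> : H z u w v = H u z v w by rewrite HC HS.
  have -> : H z v w u = H v z u w by rewrite HC HS.
  have -> : Q z u w v = Q v w u z by rewrite QC QS QC.
  have -> : Q w u z v = Q u w v z by rewrite QC QS QC QS.
  by field.
- rewrite (HC w u) (HC w v) (HC v u) (HS v z w) (HS w z v) (HS u z w).
  by rewrite (QC w u) (QC v u) (QC w v); field.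
Qed.

End LeviCivita.

(** * The Gauss equation *)

Section ConstantSectional.
Variables (R : realType) (n : nat) (G : 'M[R]_n) (T : tensor4 R n) (k : R).
Hypothesis G_pos : forall u, u != 0 -> 0 < form G u u.
Hypothesis G_sym : forall u v, form G u v = form G v u.
Hypothesis T_lin : forall a u u' v w z,
  T (a *: u + u') v w z = a * T u v w z + T u' v w z.
Hypothesis T_skew : forall u v w z, T u v w z = - T v u w z.
Hypothesis T_pair : forall u v w z, T u v w z = T w z u v.
Hypothesis T_bianchi : forall u v w z, T u v w z + T v w u z + T w u v z = 0.
Local Notation g := (form G).
Hypothesis T_sec : forall X Y, g X X * g Y Y - g X Y ^+ 2 != 0 ->
  T X Y Y X / (g X X * g Y Y - g X Y ^+ 2) = k.

(** The difference D of the two sides has the curvature symmetries and vanishes on all planes.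
    Polarization makes it alternating in the middle arguments, hence invariant under cyclic
    permutation of the first three, and the Bianchi identity becomes 3 D = 0. *)
Lemma constant_sectional u v w z :
  T u v w z = k * (g v w * g u z - g u w * g v z).
Proof.
have T0 a b c : T 0 a b c = 0.
  by have := T_lin (-1) 0 0 a b c; rewrite scaler0 addr0; lra.
have Tsec X Y : T X Y Y X = k * (g X X * g Y Y - g X Y ^+ 2).
  (* For dependent X and Y the hypothesis is silent, but X is then a multiple of Y (or Y = 0) and
     both sides vanish by skew symmetry. *)
  have [d0|d0] := eqVneq (g X X * g Y Y - g X Y ^+ 2) 0; last first.
    by rewrite -(T_sec d0) divfK.
  rewrite d0 mulr0; have [->|Y0] := eqVneq Y 0; first by rewrite T_skew T0 oppr0.
  have gY := G_pos Y0.
  have XY : X = (g X Y / g Y Y) *: Y.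
    apply/eqP; rewrite -subr_eq0; apply: contraT => /G_pos.
    rewrite !(formDl, formNl, formDr, formNr, formZl, formZr) (G_sym Y X).
    rewrite (_ : g X X = g X Y ^+ 2 / g Y Y).
      rewrite (_ : _ - _ = 0) ?ltxx //; by field; rewrite gt_eqF.
    by apply: (mulIf (lt0r_neq0 gY)); rewrite divfK ?gt_eqF //; lra.
  have TYY a b : T Y Y a b = 0 by have := T_skew Y Y a b; lra.
  by rewrite {1}XY -[_ *: Y]addr0 T_lin T0 TYY mulr0 addr0.
pose D a b c d := T a b c d - k * (g b c * g a d - g a c * g b d).
have D_lin a u1 u2 b c d : D (a *: u1 + u2) b c d = a * D u1 b c d + D u2 b c d.
  by rewrite /D T_lin !(formDl, formZl); ring.
have D_skew a b c d : D a b c d = - D b a c d.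
  by rewrite /D T_skew; ring.
have D_pair a b c d : D a b c d = D c d a b.
  by rewrite /D T_pair (G_sym d a) (G_sym c b) (G_sym c a) (G_sym d b); ring.
have D_bianchi a b c d : D a b c d + D b c a d + D c a b d = 0.
  rewrite /D; have := T_bianchi a b c d.
  by rewrite (G_sym c a) (G_sym b a) (G_sym c b); lra.
have D_sec a b : D a b b a = 0.
  by rewrite /D Tsec (G_sym b a); ring.
suff D0 : D u v w z = 0 by move: D0; rewrite /D; lra.
clearbody D.
have DD a1 a2 b c d : D (a1 + a2) b c d = D a1 b c d + D a2 b c d.
  by rewrite -[a1]scale1r D_lin mul1r scale1r.
have D_skew' a b c d : D a b c d = - D a b d c by rewrite D_pair D_skew D_pair.
have D2 a b1 b2 c d : D a (b1 + b2) c d = D a b1 c d + D a b2 c d.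
  by rewrite D_skew DD opprD -!(D_skew a).
have D3 a b c1 c2 d : D a b (c1 + c2) d = D a b c1 d + D a b c2 d.
  by rewrite D_pair DD !(D_pair _ d).
have D4 a b c d1 d2 : D a b c (d1 + d2) = D a b c d1 + D a b c d2.
  by rewrite D_skew' D3 opprD -!D_skew'.
have Dmid p q r : D p q q r = 0.
  have := D_sec (p + r) q; rewrite DD !D4 !D_sec.
  have -> : D r q q p = D p q q r by rewrite D_pair D_skew D_skew' opprK.
  by lra.
have Dalt p q c r : D p q c r = - D p c q r.
  by have := Dmid p (q + c) r; rewrite D2 !D3 !Dmid; lra.
have Dcyc p q c r : D p q c r = D c p q r by rewrite Dalt D_skew opprK.
have := D_bianchi u v w z; have := Dcyc u v w z; have := Dcyc v w u z; lra.
Qed.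
End ConstantSectional.

Lemma pd_bilinear_field (R : realType) (V Y : normedModType R) (D : set Y) p
    (Phi : Y -> 'rV[R]_p -> 'rV[R]_p -> 'rV[R]_p)
    (F : V -> Y) (a b : V -> 'rV[R]_p) (x : V) v :
  open D ->
  (forall z, D z -> forall t a a' b,
    Phi z (t *: a + a') b = t *: Phi z a b + Phi z a' b) ->
  (forall z, D z -> forall t a b b',
    Phi z a (t *: b + b') = t *: Phi z a b + Phi z a b') ->
  (forall z, D z -> forall a b, differentiable (fun z => Phi z a b) z) ->
  differentiable F x -> differentiable a x -> differentiable b x -> D (F x) ->
  differentiable (fun y => Phi (F y) (a y) (b y)) x /\
  pd (fun y => Phi (F y) (a y) (b y)) v x =
  pd (fun z => Phi z (a x) (b x)) (pd F v x) (F x)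
  + Phi (F x) (pd a v x) (b x) + Phi (F x) (a x) (pd b v x).
Proof.
move=> Do l r d dF da db Fx; split.
  exact: (@differentiable_bilinear_field R V Y D p Phi).
rewrite -!pdE; exact: (@derive_bilinear_field R V Y D p Phi).
Qed.

(** * The Gauss equation in a pair of charts *)

Section Gauss.
Variables (R : realType) (n N : nat).
Variables (gM : 'rV[R]_n -> 'M[R]_n) (U : set 'rV[R]_n).
Hypothesis gMU : chart_metric gM U.
Variables (gN : 'rV[R]_N -> 'M[R]_N) (D : set 'rV[R]_N).
Hypothesis gND : chart_metric gN D.
Variable F : 'rV[R]_n -> 'rV[R]_N.
Hypothesis F_smooth : smooth_on U F.
Hypothesis F_D : forall x, U x -> D (F x).
Hypothesis F_isom : forall x, U x -> forall u v,
  form (gM x) u v = form (gN (F x)) (pd F u x) (pd F v x).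

Let near_U x : U x -> \forall y \near x, U y.
Proof. by move=> Ux; apply: open_nbhs_nbhs; case: gMU. Qed.

Let gM_diff x : U x -> differentiable gM x.
Proof. by case: gMU => _ + _ _; exact: smooth_differentiable. Qed.

Let gN_diff x : D x -> differentiable gN x.
Proof. by case: gND => _ + _ _; exact: smooth_differentiable. Qed.

Let gN_sym x : D x -> forall u v, form (gN x) u v = form (gN x) v u.
Proof. by case: gND => _ _ + _; apply. Qed.

Let F_diff x : U x -> differentiable F x.
Proof. exact: smooth_differentiable F_smooth. Qed.

Let dF_smooth v : smooth_on U (fun x => pd F v x).
Proof. exact: smooth_pd. Qed.

Let dF_diff v x : U x -> differentiable (fun y => pd F v y) x.
Proof. exact: smooth_differentiable (dF_smooth v). Qed.

Let ddF_diff v w x : U x -> differentiable (fun y => pd (fun z => pd F w z) v y) x.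
Proof. by apply: smooth_differentiable; exact: smooth_pd. Qed.

Let gNF_diff x : U x -> differentiable (fun y => gN (F y)) x.
Proof.
move=> Ux; apply: (@differentiable_comp _ _ _ _ F gN); first exact: F_diff.
by apply: gN_diff; exact: F_D.
Qed.

Let chr_comp_diff x a b v : U x -> differentiable a x -> differentiable b x ->
  differentiable (fun y => chr gN (F y) (a y) (b y)) x /\
  pd (fun y => chr gN (F y) (a y) (b y)) v x =
  pd (fun z => chr gN z (a x) (b x)) (pd F v x) (F x)
  + chr gN (F x) (pd a v x) (b x) + chr gN (F x) (a x) (pd b v x).
Proof.
move=> Ux da db; apply: (pd_bilinear_field (D := D)) => //.
- by case: gND.
- by move=> z Dz t c c' e; exact: (chr_linl gND).
- by move=> z Dz t c c' e; exact: (chr_linr gND).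
- by move=> z Dz c c'; exact: (chr_differentiable gND).
- exact: F_diff.
- exact: F_D.
Qed.

(* Covariant derivative along F, in the target, of dF(w) in the direction v. *)
Definition along (v w x : 'rV[R]_n) : 'rV[R]_N :=
  pd (fun z => pd F w z) v x + chr gN (F x) (pd F v x) (pd F w x).

Let alongC v w x : U x -> along v w x = along w v x.
Proof.
move=> Ux; rewrite /along (chrC gND) //; last exact: F_D.
by rewrite (pd_swap _ _ _ F_smooth Ux) //; case: gMU.
Qed.

Let along_diff v w x : U x -> differentiable (along v w) x.
Proof.
move=> Ux; apply: differentiableD; first exact: ddF_diff.
by have [] := @chr_comp_diff x (fun y => pd F v y) (fun y => pd F w y) 0 Ux
  (dF_diff v Ux) (dF_diff w Ux).
Qed.

(** Differentiating the isometry condition writes the Koszul expression of the induced metric in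
    terms of F: the tangential part of the ambient covariant derivative is the Levi-Civita
    connection. *)
Lemma form_along v w z x : U x ->
  form (gN (F x)) (along v w x) (pd F z x) = koszul gM x v w z.
Proof.
move=> Ux; have Dx := F_D Ux.
have E a b c : form (pd gM a x) b c = form (pd gN (pd F a x) (F x)) (pd F b x) (pd F c x)
    + form (gN (F x)) (pd (fun y => pd F b y) a x) (pd F c x)
    + form (gN (F x)) (pd F b x) (pd (fun y => pd F c y) a x).
  rewrite -pd_form_cst; last exact: gM_diff.
  rewrite -(@pd_comp _ _ _ _ F gN); [|exact: F_diff|exact: gN_diff].
  rewrite -(@pd_form _ _ _ (fun y => gN (F y)) (fun y => pd F b y) (fun y => pd F c y));
    [|exact: gNF_diff|exact: dF_diff..].
  apply: near_eq_pd; have := near_U Ux; apply: filter_app; near=> y => Uy.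
  exact: F_isom.
have sw a b : pd (fun y => pd F b y) a x = pd (fun y => pd F a y) b x.
  by apply: (pd_swap _ _ _ F_smooth Ux); case: gMU.
rewrite /along formDl (chrP gND) // /koszul !E (sw w v) (sw z v) (sw z w).
rewrite (gN_sym Dx (pd F w x) (pd _ _ _)) (gN_sym Dx (pd F v x) (pd _ _ _)).
by field.
Unshelve. all: by end_near. Qed.

Lemma pd_koszul_along u v w z x : U x -> pd (fun y => koszul gM y v w z) u x =
  form (gN (F x)) (pd (along v w) u x + chr gN (F x) (pd F u x) (along v w x)) (pd F z x)
  + form (gN (F x)) (along v w x) (along u z x).
Proof.
move=> Ux; have Dx := F_D Ux.
have -> : pd (fun y => koszul gM y v w z) u x
    = pd (fun y => form (gN (F y)) (along v w y) (pd F z y)) u x.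
  apply: near_eq_pd; have := near_U Ux; apply: filter_app; near=> y => Uy.
  by rewrite form_along.
rewrite (@pd_form _ _ _ (fun y => gN (F y)) (along v w) (fun y => pd F z y));
  [|exact: gNF_diff|exact: along_diff|exact: dF_diff].
rewrite (@pd_comp _ _ _ _ F gN); [|exact: F_diff|exact: gN_diff].
rewrite (metric_compatible gND) // [in RHS]formDl [along u z x]/along formDr.
by ring.
Unshelve. all: by end_near. Qed.

(** Commuting covariant derivatives along F produces the ambient curvature: the third derivatives of
    F cancel by Schwarz, and the mixed terms by the symmetry of its second derivatives. *)
Lemma along_curvature u v w x : U x ->
  (pd (along v w) u x + chr gN (F x) (pd F u x) (along v w x))
  - (pd (along u w) v x + chr gN (F x) (pd F v x) (along u w x))
  = curvature gN (F x) (pd F u x) (pd F v x) (pd F w x).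
Proof.
move=> Ux; have Dx := F_D Ux.
have chrDr a b b' : chr gN (F x) a (b + b') = chr gN (F x) a b + chr gN (F x) a b'.
  by have := chr_linr gND 1 a b b' Dx; rewrite !scale1r.
have sw a b : pd (fun y => pd F b y) a x = pd (fun y => pd F a y) b x.
  by apply: (pd_swap _ _ _ F_smooth Ux); case: gMU.
have E a b c : pd (along b c) a x = pd (fun y => pd (fun z => pd F c z) b y) a x
    + (pd (fun z => chr gN z (pd F b x) (pd F c x)) (pd F a x) (F x)
       + chr gN (F x) (pd (fun y => pd F b y) a x) (pd F c x)
       + chr gN (F x) (pd F b x) (pd (fun y => pd F c y) a x)).
  have [dc <-] := @chr_comp_diff x (fun y => pd F b y) (fun y => pd F c y) a Ux
    (dF_diff b Ux) (dF_diff c Ux).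
  by rewrite -pd_add //; exact: ddF_diff.
have sw3 : pd (fun y => pd (fun z => pd F w z) v y) u x
    = pd (fun y => pd (fun z => pd F w z) u y) v x.
  by apply: (pd_swap _ _ _ (dF_smooth w) Ux); case: gMU.
rewrite !E /along !chrDr sw3 (sw v u) (curvatureE gND) //.
move: (pd (fun y => pd (fun z => pd F w z) u y) v x) => a.
move: (pd (fun z => chr _ z (pd F v x) _) _ _) => b.
move: (pd (fun z => chr _ z (pd F u x) _) _ _) => c.
move: (chr gN (F x) (pd (fun y => pd F u y) v x) (pd F w x)) => d.
move: (chr gN (F x) (pd F v x) (pd (fun y => pd F w y) u x)) => e.
move: (chr gN (F x) (pd F u x) (pd (fun y => pd F w y) v x)) => f.
move: (chr gN (F x) (pd F u x) (chr _ _ _ _)) => p.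
move: (chr gN (F x) (pd F v x) (chr _ _ _ _)) => q.
by apply/rowP => i; rewrite !mxE; ring.
Qed.

Definition sff (v w x : 'rV[R]_n) : 'rV[R]_N :=
  along v w x - pd F (chr gM x v w) x.

Lemma sffC v w x : U x -> sff v w x = sff w v x.
Proof. by move=> Ux; rewrite /sff alongC // (chrC gMU). Qed.

Lemma sff_linl a u v w x : U x -> sff (a *: u + v) w x = a *: sff u w x + sff v w x.
Proof.
move=> Ux; rewrite /sff /along (chr_linl gMU) // !(pd_dir (F_diff Ux)).
rewrite (pd_dir (dF_diff w Ux)) (chr_linl gND); last exact: F_D.
rewrite scalerBr scalerDr; apply/rowP => i; rewrite !mxE; ring.
Qed.

Lemma sff_normal v w z x : U x -> form (gN (F x)) (sff v w x) (pd F z x) = 0.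
Proof.
move=> Ux; rewrite /sff formDl formNl form_along // -(chrP gMU) // F_isom //.
exact: subrr.
Qed.

(** [pd_koszul_along] makes the derivatives in [form_curvature] ambient. Splitting the resulting
    products of [along] into normal and tangential parts, the tangential ones cancel the products of
    Christoffel symbols. *)
Theorem gauss_equation u v w z x : U x ->
  form (gM x) (curvature gM x u v w) z =
  form (gN (F x)) (curvature gN (F x) (pd F u x) (pd F v x) (pd F w x)) (pd F z x)
  + form (gN (F x)) (sff v w x) (sff u z x) - form (gN (F x)) (sff u w x) (sff v z x).
Proof.
move=> Ux; have Dx := F_D Ux.
have split_along a b c d : form (gN (F x)) (along a b x) (along c d x)
    = form (gN (F x)) (sff a b x) (sff c d x)
      + form (gM x) (chr gM x a b) (chr gM x c d).
  have -> : along a b x = sff a b x + pd F (chr gM x a b) x by rewrite subrK.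
  have -> : along c d x = sff c d x + pd F (chr gM x c d) x by rewrite subrK.
  rewrite (formDl _ (sff a b x)) !(formDr _ (sff c d x)) sff_normal // (gN_sym Dx (pd F _ x) (sff _ _ _)).
  by rewrite sff_normal // F_isom // addr0 add0r.
have := along_curvature u v w Ux.
move=> /(congr1 (fun V => form (gN (F x)) V (pd F z x))) <-.
by rewrite (form_curvature gMU) // !pd_koszul_along // !split_along /=
  (formBl _ (pd (along v w) u x + chr gN (F x) (pd F u x) (along v w x))); ring.
Qed.

End Gauss.

Lemma chart_metric_atlas (R : realType) n (M : riemannian R n) (c : chart R M n) :
  atlas c -> chart_metric (metric c) (cimg c).
Proof.
move=> ac; split.
- exact: cimg_open.
- exact: metric_smooth.
- by move=> x cx; exact: metric_sym.
- by move=> x cx; exact: metric_pos.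
Qed.

Lemma gram_sym (R : realType) n (M : riemannian R n) (c : chart R M n) p :
  atlas c -> cdom c p -> forall u v, form (gram c p) u v = form (gram c p) v u.
Proof. by move=> ac cp; apply: metric_sym => //; have [] := cmapP cp. Qed.

Lemma gram_pos (R : realType) n (M : riemannian R n) (c : chart R M n) p :
  atlas c -> cdom c p -> forall u, u != 0 -> 0 < form (gram c p) u u.
Proof. by move=> ac cp; apply: metric_pos => //; have [] := cmapP cp. Qed.

Section ConstantCurvature.
Variables (R : realType) (n : nat) (k : R) (N : riemannian R n).
Hypothesis hN : constant_curvature N k.

Lemma constant_curvature_tensor (d : chart R N n) q : atlas d -> cdom d q ->
  forall u v w z, Rtensor d q u v w z =
    k * (form (gram d q) v w * form (gram d q) u z
         - form (gram d q) u w * form (gram d q) v z).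
Proof.
move=> ad dq; have [Dx _] := cmapP dq.
have gN := chart_metric_atlas ad.
have [_ _ gsym gpos] := gN.
have [skew pair bianchi] := curvature_symmetries gN Dx.
apply: (constant_sectional (gpos _ Dx) (gsym _ Dx)).
(* Linearity is immediate in the last argument; the symmetries transport it to the first. *)
- have lin4 a u v w z z' : Rtensor d q u v w (a *: z + z')
      = a * Rtensor d q u v w z + Rtensor d q u v w z'.
    by rewrite /Rtensor /lower formDr formZr.
  have swap u v w z : Rtensor d q u v w z = - Rtensor d q w z v u.
    have := pair u v w z; rewrite /= => E.
    rewrite [LHS]E; have := pair w z u v => /= ->.
    have := skew u v w z => /= ->; congr (- _); exact: (pair v u w z).
  by move=> a u u' v w z; rewrite !(swap _ v) lin4; ring.
- exact: skew.
- exact: pair.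
- exact: bianchi.
- exact: hN.
Qed.

End ConstantCurvature.

Section Pointwise.
Variables (R : realType) (n m : nat) (k : R).
Variables (M : riemannian R n) (N : riemannian R (n + m)) (f : M -> N).
Hypothesis hN : constant_curvature N k.
Hypothesis hf : isometric_immersion f.
Variables (c : chart R M n) (d : chart R N (n + m)) (p : M).
Hypotheses (ac : atlas c) (cp : cdom c p) (ad : atlas d) (dp : cdom d (f p)).

Let x := cmap c p.
Let F := local_rep f c d.
Let U := cmap c @` (cdom c `&` f @^-1` cdom d).
Local Notation G := (gram c p).
Local Notation GN := (gram d (f p)).
Local Notation dF u := ('D_u F x).
Local Notation h := (second_ff f c d p).

Let FE q : cdom c q -> F (cmap c q) = cmap d (f q).
Proof. by move=> cq; rewrite /F /local_rep /=; have [_ ->] := cmapP cq. Qed.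

Let Ux : U x.
Proof. by exists p. Qed.

Let U_open : open U.
Proof.
rewrite openE => _ [q [cq dq] <-]; rewrite /interior.
have [iq qE] := cmapP cq.
have n1 : \forall y \near cmap c q, cimg c y.
  by apply: open_nbhs_nbhs; split => //; exact: cimg_open.
have n2 : \forall y \near cmap c q, cdom d (f (cinv c y)).
  have nf : nbhs (cinv c (cmap c q)) (f @^-1` cdom d).
    rewrite qE; have [fc _] := hf; apply: fc.
    by apply: open_nbhs_nbhs; split => //; exact: cdom_open.
  exact: (cinv_continuous iq nf).
near=> y.
have iy : cimg c y by near: y.
have [cy yE] := cinvP iy.
exists (cinv c y) => //; split => //=.
by near: y.
Unshelve. all: by end_near. Qed.

Let gMU : chart_metric (metric c) U.
Proof.
have [_ sm gs gp] := chart_metric_atlas ac.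
have UC : U `<=` cimg c by move=> _ [q [cq _] <-]; have [] := cmapP cq.
by split => // [|y /UC|y /UC]; [exact: smooth_sub sm|exact: gs|exact: gp].
Qed.

Let gND : chart_metric (metric d) (cimg d) := chart_metric_atlas ad.

Let F_smooth : smooth_on U F.
Proof. by have [_ /(_ c d ac ad)[]] := hf. Qed.

Let F_D y : U y -> cimg d (F y).
Proof. by move=> [q [cq dq] <-]; rewrite FE //; have [] := cmapP dq. Qed.

Let F_isom y : U y -> forall u v,
  form (metric c y) u v = form (metric d (F y)) (pd F u y) (pd F v y).
Proof.
move=> [q [cq dq] <-] u v; rewrite FE // -!pdE.
by have [_ /(_ c d ac ad)[_ /(_ q cq dq u v)]] := hf.
Qed.

Let GNE : metric d (F x) = GN.
Proof. by rewrite FE. Qed.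

Let sffE u v : h u v = sff (metric c) (metric d) F u v x.
Proof.
rewrite /second_ff /sff /along -/F -/x !chrE !pdE -(FE cp).
by congr (_ + _ - _); congr (pd _ _ _); apply/funext => y; rewrite pdE.
Qed.

Lemma second_ffC u v : h u v = h v u.
Proof. by rewrite !sffE (sffC gMU gND F_smooth F_D). Qed.

Lemma second_ff_linl a u u' v : h (a *: u + u') v = a *: h u v + h u' v.
Proof. by rewrite !sffE (sff_linl gMU gND F_smooth F_D). Qed.

Lemma second_ff_normal u v z : form GN (h u v) (dF z) = 0.
Proof. by rewrite sffE pdE -GNE (sff_normal gMU gND F_smooth F_D F_isom). Qed.

Lemma differential_isometry u v : form GN (dF u) (dF v) = form G u v.
Proof. by rewrite !pdE -GNE -F_isom. Qed.

Lemma differential_lin a u v : dF (a *: u + v) = a *: dF u + dF v.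
Proof. by apply: derive_dirP; exact: smooth_differentiable F_smooth Ux. Qed.

Lemma gauss_constant_curvature u v w z : Rtensor c p u v w z =
  k * (form G v w * form G u z - form G u w * form G v z)
  + form GN (h v w) (h u z) - form GN (h u w) (h v z).
Proof.
have := gauss_equation gMU gND F_smooth F_D F_isom u v w z Ux.
rewrite -!sffE GNE => E; rewrite -[LHS]/(form (metric c x) (curvature (metric c) x u v w) z).
rewrite E; congr (_ + _ - _).
transitivity (Rtensor d (f p) (dF u) (dF v) (dF w) (dF z)); last first.
  rewrite (constant_curvature_tensor hN ad dp).
  by congr (k * (_ * _ - _ * _)); exact: differential_isometry.
by rewrite /Rtensor /lower /Rop -(FE cp) !pdE.
Qed.

End Pointwise.

Local Close Scope classical_set_scope.

(** * Wintgen ideal submanifolds *)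

Lemma sum_lt_half (R : realFieldType) n (F : 'I_n -> 'I_n -> R) :
  (forall i j, F i j = F j i) -> (forall i, F i i = 0) ->
  \sum_(i < n) \sum_(j < n | (i < j)%N) F i j = 2^-1 * \sum_i \sum_j F i j.
Proof.
move=> Fs F0; set L := LHS.
have -> : \sum_i \sum_j F i j = L + \sum_(i < n) \sum_(j < n | (j < i)%N) F i j.
  rewrite -big_split; apply: eq_bigr => i _ /=.
  rewrite (bigID (fun j : 'I_n => (i < j)%N)) /=; congr (_ + _).
  rewrite (bigD1 i) /= ?ltnn // F0 add0r; apply: eq_bigl => j.
  by rewrite -leqNgt ltn_neqAle andbC.
have -> : \sum_(i < n) \sum_(j < n | (j < i)%N) F i j = L.
  rewrite (exchange_big_dep xpredT) //=; apply: eq_bigr => i _.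
  by apply: eq_bigr => j _; rewrite Fs.
by field.
Qed.

Section Frame.
Variables (R : realType) (n : nat) (G : 'M[R]_n).
Hypothesis G_pos : forall u, u != 0 -> 0 < form G u u.
Hypothesis G_sym : forall u v, form G u v = form G v u.
Local Notation g := (form G).

Lemma gram_tr : G^T = G.
Proof.
apply/matrixP => i j; rewrite mxE.
have E k l : g (delta_mx 0 k) (delta_mx 0 l) = G k l.
  by rewrite /form trmx_delta -rowE -colE !mxE.
by rewrite -!E G_sym.
Qed.

Lemma frame_exists : exists E : 'I_n -> 'rV[R]_n,
  forall i j, g (E i) (E j) = (i == j)%:R.
Proof.
have [|W [WW _]] := @orthonormal_completion R n G gram_tr G_pos n 0 0 (leqnn _).
  by apply/matrixP => -[].
exists (fun i => row i W) => i j.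
rewrite /form tr_row mul_mx_col -!row_mul WW !mxE; reflexivity.
Qed.

Lemma normal_frame_exists m (V : 'M[R]_(m, n)) q : (m + q <= n)%N ->
  (forall i j, g (row i V) (row j V) = (i == j)%:R) ->
  exists W : 'I_q -> 'rV[R]_n,
    (forall a b, g (W a) (W b) = (a == b)%:R) /\
    (forall a i, g (W a) (row i V) = 0).
Proof.
move=> mq VV.
have rowE p r (A : 'M[R]_(p, n)) (B : 'M[R]_(r, n)) i j :
    g (row i A) (row j B) = (A *m G *m B^T) i j.
  by rewrite /form tr_row mul_mx_col -!row_mul mxE.
have [|W [WW WV]] := @orthonormal_completion R n G gram_tr G_pos q m V mq.
  by apply/matrixP => i j; rewrite -rowE VV mxE.
exists (fun a => row a W); split => a b; rewrite rowE ?WW ?WV mxE //.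
Qed.

Variable E : 'I_n -> 'rV[R]_n.
Hypothesis E_on : forall i j, g (E i) (E j) = (i == j)%:R.

Lemma frame_expand u : u = \sum_k g (E k) u *: E k.
Proof.
apply: (form_nondeg G_pos) => w; rewrite form_suml -(parseval G_sym E_on).
by apply: eq_bigr => k _; rewrite formZl.
Qed.

Lemma bilinear_frame_expand (W : lmodType R) (b : 'rV[R]_n -> 'rV[R]_n -> W) :
  (forall a u u' v, b (a *: u + u') v = a *: b u v + b u' v) ->
  (forall a u v v', b u (a *: v + v') = a *: b u v + b u v') ->
  forall u v, b u v = \sum_i \sum_j (g (E i) u * g (E j) v) *: b (E i) (E j).
Proof.
move=> bl br u v.
have l0 v' : b 0 v' = 0.
  by have := bl (-1) 0 0 v'; rewrite scaler0 addr0 scaleN1r addNr.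
have r0 u' : b u' 0 = 0.
  by have := br (-1) u' 0 0; rewrite scaler0 addr0 scaleN1r addNr.
have lD v' u1 u2 : b (u1 + u2) v' = b u1 v' + b u2 v'.
  by rewrite -{1}[u1]scale1r bl scale1r.
have rD u' v1 v2 : b u' (v1 + v2) = b u' v1 + b u' v2.
  by rewrite -{1}[v1]scale1r br scale1r.
rewrite {1}(frame_expand u) (big_morph (b ^~ v) (lD v) (l0 v)).
apply: eq_bigr => i _; rewrite -[_ *: E i]addr0 bl l0 addr0.
rewrite {1}(frame_expand v) (big_morph (b (E i)) (rD _) (r0 _)) scaler_sumr.
apply: eq_bigr => j _; rewrite -[_ *: E j]addr0 br r0 addr0.
by rewrite scalerA.
Qed.

Lemma rotated_frame (P : 'M[R]_n) : P *m P^T = 1%:M ->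
  forall i j, g (\sum_k P i k *: E k) (\sum_k P j k *: E k) = (i == j)%:R.
Proof.
move=> PP i j; rewrite form_suml.
under eq_bigr do rewrite form_sumr.
transitivity (\sum_k P i k * P j k).
  apply: eq_bigr => k _; rewrite (bigD1 k) //= formZl formZr E_on eqxx mulr1.
  rewrite big1 ?addr0 // => l lk.
  by rewrite formZl formZr E_on eq_sym (negbTE lk) !mulr0.
have -> : \sum_k P i k * P j k = (P *m P^T) i j.
  by rewrite mxE; apply: eq_bigr => k _; rewrite mxE.
by rewrite PP mxE.
Qed.

End Frame.

(** Together [e] and [xi] form an orthonormal frame of the whole space, in which a normal vector has
    no component along [e]. *)
Lemma normal_parseval (R : realType) n m (G : 'M[R]_(n + m))
    (e : 'I_n -> 'rV[R]_(n + m)) (xi : 'I_m -> 'rV[R]_(n + m)) :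
  (forall u v, form G u v = form G v u) ->
  (forall u, u != 0 -> 0 < form G u u) ->
  (forall i j, form G (e i) (e j) = (i == j)%:R) ->
  (forall a b, form G (xi a) (xi b) = (a == b)%:R) ->
  (forall a i, form G (xi a) (e i) = 0) ->
  forall u, (forall i, form G u (e i) = 0) ->
  u = \sum_a form G (xi a) u *: xi a.
Proof.
move=> G_sym G_pos ee xx xe u ue.
pose E k := match fintype.split k with inl i => e i | inr a => xi a end.
have E_on k l : form G (E k) (E l) = (k == l)%:R.
  rewrite /E -(inj_eq (can_inj fintype.splitK)); case: (fintype.split k) => i; case: (fintype.split l) => j.
  - by rewrite ee.
  - by rewrite G_sym xe.
  - by rewrite xe.
  - by rewrite xx.
rewrite {1}(frame_expand G_pos G_sym E_on u) big_split_ord /=.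
rewrite big1 ?add0r => [|i _]; last first.
  by rewrite /E (unsplitK (inl i)) G_sym ue scale0r.
by apply: eq_bigr => a _; rewrite /E (unsplitK (inr a)).
Qed.

(** * The Wintgen equality for shape matrices *)

Section WintgenAlgebra.
Variables (R : rcfType) (n m : nat) (A : 'I_m -> 'M[R]_n) (k : R).
Hypothesis n_gt1 : (1 < n)%N.
Hypothesis A_sym : forall a, (A a)^T = A a.

Definition traceless (M : 'M[R]_n) : 'M[R]_n := M - (n%:R^-1 * \tr M)%:M.

Let n0 : n%:R != 0 :> R.
Proof. by rewrite pnatr_eq0; case: n n_gt1. Qed.

Let n1 : n%:R - 1 != 0 :> R.
Proof. by rewrite subr_eq0 (eqr_nat _ n 1); case: n n_gt1 => [|[]]. Qed.

Lemma mxdot_traceless (M : 'M[R]_n) :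
  mxdot (traceless M) (traceless M) = mxdot M M - n%:R^-1 * \tr M ^+ 2.
Proof.
have sc e (X : 'M[R]_n) : mxdot e%:M X = e * \tr X.
  by rewrite /mxdot mul_scalar_mx mxtraceZ mxtrace_tr.
rewrite /traceless mxdotBl !mxdotBr (mxdotC M) !sc mxtrace_scalar -mulr_natr.
by field.
Qed.

Lemma commutator_traceless (M M' : 'M[R]_n) :
  commutator (traceless M) (traceless M') = commutator M M'.
Proof.
rewrite /commutator /traceless; set e := _%:M; set e' := _%:M.
have eC X : e *m X = X *m e by rewrite mul_scalar_mx mul_mx_scalar.
have eC' X : e' *m X = X *m e' by rewrite mul_scalar_mx mul_mx_scalar.
rewrite !mulmxBl !mulmxBr (eC M') (eC' M) (eC e').
by apply/matrixP => i j; rewrite !mxE; ring.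
Qed.

Let comm_tr a b : (commutator (A a) (A b))^T = - commutator (A a) (A b).
Proof. by rewrite /commutator linearB /= !trmx_mul !A_sym opprB. Qed.

Let skew_entry (X : 'M[R]_n) i j : X^T = - X -> X i j = - X j i.
Proof. by move=> /matrixP/(_ j i); rewrite !mxE. Qed.

(** Let C be the sum of |[A_a, A_b]|^2 over ordered pairs. Halving the sums over i, j and over a, b
    turns the radicand into C / 4; after clearing n (n - 1) the equality says that the traceless
    parts have total squared norm 2 sqrt(C / 4). *)
Lemma wintgen_equality :
  2 / (n%:R * (n%:R - 1)) * (\sum_(i < n) \sum_(j < n | (i < j)%N)
      (k + \sum_a (A a j j * A a i i - A a i j * A a j i)))
  = n%:R^-1 ^+ 2 * \sum_a \tr (A a) ^+ 2
    - 2 / (n%:R * (n%:R - 1)) * Num.sqrt (\sum_(i < n) \sum_(j < n | (i < j)%N)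
        \sum_(a < m) \sum_(b < m | (a < b)%N) commutator (A a) (A b) i j ^+ 2)
    + k ->
  (\sum_a mxdot (traceless (A a)) (traceless (A a))) ^+ 2 =
  \sum_a \sum_b mxdot (commutator (traceless (A a)) (traceless (A b)))
                      (commutator (traceless (A a)) (traceless (A b))).
Proof.
have AC a i j : A a i j = A a j i by rewrite -{1}(A_sym a) mxE.
have sumk : \sum_(i < n) \sum_(j < n) k * (i != j)%:R = k * (n%:R * (n%:R - 1)).
  have row i : \sum_(j < n) k * (i != j)%:R = k * (n%:R - 1).
    rewrite -mulr_sumr; congr (_ * _).
    rewrite (eq_bigr (fun j => 1 - (i == j)%:R)) => [|j _]; last first.
      by case: eqP => _; rewrite ?subrr ?subr0.
    rewrite sumrB sumr_const card_ord (bigD1 i) //= eqxx big1 ?addr0 // => j ji.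
    by rewrite eq_sym (negbTE ji).
  by under eq_bigr do rewrite row; rewrite sumr_const card_ord -mulr_natr; ring.
have -> : \sum_(i < n) \sum_(j < n | (i < j)%N)
      (k + \sum_a (A a j j * A a i i - A a i j * A a j i))
    = 2^-1 * (k * (n%:R * (n%:R - 1))
              + (\sum_a \tr (A a) ^+ 2 - \sum_a mxdot (A a) (A a))).
  (* The factor at k makes [F] vanish on the diagonal, as [sum_lt_half] requires. *)
  pose F (i j : 'I_n) := k * (i != j)%:R
    + \sum_a (A a j j * A a i i - A a i j * A a j i).
  transitivity (\sum_(i < n) \sum_(j < n | (i < j)%N) F i j).
    apply: eq_bigr => i _; apply: eq_bigr => j ij; rewrite /F.
    by rewrite (_ : i != j) ?mulr1 // neq_ltn ij.
  rewrite sum_lt_half; last 2 first.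
  - move=> i j; rewrite /F eq_sym; congr (_ + _); apply: eq_bigr => a _; ring.
  - by move=> i; rewrite /F eqxx mulr0 add0r big1 // => a _; rewrite subrr.
  congr (_ * _); rewrite -sumk.
  transitivity (\sum_(i < n) \sum_(j < n) k * (i != j)%:R
    + \sum_i \sum_j \sum_a (A a j j * A a i i - A a i j * A a j i)).
    rewrite -big_split; apply: eq_bigr => i _ /=; rewrite -big_split.
    by apply: eq_bigr => j _.
  congr (_ + _); rewrite -sumrB.
  under eq_bigr do rewrite exchange_big /=.
  rewrite exchange_big; apply: eq_bigr => a _ /=.
  rewrite mxdotE expr2 {1}/mxtrace mulr_suml -sumrB; apply: eq_bigr => i _.
  rewrite /mxtrace mulr_sumr -sumrB; apply: eq_bigr => j _.
  by rewrite (AC a j i) mulrC.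
pose C := \sum_a \sum_b mxdot (commutator (A a) (A b)) (commutator (A a) (A b)).
have -> : \sum_(i < n) \sum_(j < n | (i < j)%N)
    \sum_(a < m) \sum_(b < m | (a < b)%N) commutator (A a) (A b) i j ^+ 2 = C / 4.
  have inner i j : \sum_(a < m) \sum_(b < m | (a < b)%N) commutator (A a) (A b) i j ^+ 2
      = 2^-1 * \sum_a \sum_b commutator (A a) (A b) i j ^+ 2.
    rewrite sum_lt_half // => [a b|a]; first by rewrite commutatorC mxE sqrrN.
    by rewrite /commutator subrr mxE expr0n.
  under eq_bigr do under eq_bigr do rewrite inner.
  rewrite sum_lt_half; last 2 first.
  - move=> i j; congr (_ * _); apply: eq_bigr => a _; apply: eq_bigr => b _.
    by rewrite (skew_entry i j (comm_tr a b)) sqrrN.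
  - move=> i; rewrite big1 ?mulr0 // => a _; rewrite big1 // => b _.
    apply/eqP; rewrite sqrf_eq0; apply/eqP.
    by have := skew_entry i i (comm_tr a b); lra.
  under eq_bigr do rewrite -mulr_sumr.
  rewrite -mulr_sumr mulrA.
  have -> : \sum_i \sum_j \sum_a \sum_b commutator (A a) (A b) i j ^+ 2 = C.
    under eq_bigr do rewrite exchange_big /=.
    rewrite exchange_big; apply: eq_bigr => a _ /=.
    under eq_bigr do rewrite exchange_big /=.
    rewrite exchange_big; apply: eq_bigr => b _ /=.
    by rewrite mxdotE; apply: eq_bigr => i _; apply: eq_bigr => j _; rewrite expr2.
  by field.
have C0 : 0 <= C / 4.
  by rewrite divr_ge0 //; do 2!apply: sumr_ge0 => ? _; exact: mxdot_ge0.
set s := Num.sqrt _; have s2 : s ^+ 2 = C / 4 by exact: sqr_sqrtr.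
set S := \sum_a mxdot (A a) (A a); set t := \sum_a \tr (A a) ^+ 2.
move=> W.
under [RHS]eq_bigr do under eq_bigr do rewrite commutator_traceless.
rewrite (eq_bigr _ (fun a _ => mxdot_traceless (A a))).
rewrite sumrB -mulr_sumr -/S -/t -/C.
have -> : S - n%:R^-1 * t = 2 * s.
  have D0 : n%:R * (n%:R - 1) != 0 :> R by rewrite mulf_neq0.
  apply/eqP; rewrite -subr_eq0; apply/eqP.
  have : n%:R * (n%:R - 1) * ((n%:R^-1 ^+ 2 * t - 2 / (n%:R * (n%:R - 1)) * s + k)
      - 2 / (n%:R * (n%:R - 1)) * (2^-1 * (k * (n%:R * (n%:R - 1)) + (t - S)))) = 0.
    by rewrite W subrr mulr0.
  by move=> <-; field; rewrite n0 n1.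
by rewrite exprMn s2; field.
Qed.
End WintgenAlgebra.

(** * Wintgen ideal submanifolds at one point, as pure linear algebra *)

Section PointwiseSubmanifold.
Variables (R : realType) (n m : nat) (k : R).
Variables (G : 'M[R]_n) (GN : 'M[R]_(n + m)).
Variables (h : 'rV[R]_n -> 'rV[R]_n -> 'rV[R]_(n + m)).
Variables (dF : 'rV[R]_n -> 'rV[R]_(n + m)) (Rt : tensor4 R n).
Local Notation g := (form G).
Hypothesis n_gt1 : (1 < n)%N.
Hypothesis G_sym : forall u v, g u v = g v u.
Hypothesis G_pos : forall u, u != 0 -> 0 < g u u.
Hypothesis GN_sym : forall u v, form GN u v = form GN v u.
Hypothesis GN_pos : forall u, u != 0 -> 0 < form GN u u.
Hypothesis hC : forall u v, h u v = h v u.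
Hypothesis hl : forall a u u' v, h (a *: u + u') v = a *: h u v + h u' v.
Hypothesis h_normal : forall u v z, form GN (h u v) (dF z) = 0.
Hypothesis dF_isom : forall u v, form GN (dF u) (dF v) = g u v.
Hypothesis dF_lin : forall a u v, dF (a *: u + v) = a *: dF u + dF v.
Hypothesis gauss : forall u v w z, Rt u v w z =
  k * (g v w * g u z - g u w * g v z)
  + form GN (h v w) (h u z) - form GN (h u w) (h v z).

Let hr a u v v' : h u (a *: v + v') = a *: h u v + h u v'.
Proof. by rewrite hC hl !(hC u). Qed.

Definition orthonormal (E : 'I_n -> 'rV[R]_n) :=
  forall i j, g (E i) (E j) = (i == j)%:R.

Definition orthonormal_normal (xi : 'I_m -> 'rV[R]_(n + m)) :=
  (forall a b, form GN (xi a) (xi b) = (a == b)%:R) /\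
  (forall a u, form GN (xi a) (dF u) = 0).

Let shp xi X := sharp G (fun Y => form GN xi (h X Y)).

Section NormalFrame.
Variables (E : 'I_n -> 'rV[R]_n) (xi : 'I_m -> 'rV[R]_(n + m)).
Hypothesis E_on : orthonormal E.
Hypothesis xi_on : orthonormal_normal xi.

Lemma normal_expand v : (forall z, form GN v (dF z) = 0) ->
  v = \sum_a form GN (xi a) v *: xi a.
Proof.
have [xx xe] := xi_on => vn.
apply: (@normal_parseval _ _ _ GN (fun i => dF (E i)) xi) => //.
by move=> i j; rewrite dF_isom E_on.
Qed.

Lemma normal_form u v : (forall z, form GN u (dF z) = 0) ->
  (forall z, form GN v (dF z) = 0) ->
  form GN u v = \sum_a form GN (xi a) u * form GN (xi a) v.
Proof.
move=> un vn; rewrite {1}(normal_expand un) form_suml.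
by apply: eq_bigr => a _; rewrite formZl.
Qed.

Definition shape_mx a : 'M[R]_n := \matrix_(i, j) form GN (xi a) (h (E i) (E j)).

Lemma shape_mx_sym a : (shape_mx a)^T = shape_mx a.
Proof. by apply/matrixP => i j; rewrite !mxE hC. Qed.

Lemma rho_shape : \sum_(i < n) \sum_(j < n | (i < j)%N) Rt (E i) (E j) (E j) (E i) =
  \sum_(i < n) \sum_(j < n | (i < j)%N) (k + \sum_a
    (shape_mx a j j * shape_mx a i i - shape_mx a i j * shape_mx a j i)).
Proof.
apply: eq_bigr => i _; apply: eq_bigr => j ij.
rewrite gauss !E_on !eqxx.
have ji : (i == j) = false by apply: negbTE; rewrite neq_ltn ij.
rewrite ji /= mul0r subr0 !mulr1 -addrA; congr (_ + _).
rewrite (normal_form (h_normal (E j) (E j)) (h_normal (E i) (E i))).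
rewrite (normal_form (h_normal (E i) (E j)) (h_normal (E j) (E i))).
rewrite -sumrB; apply: eq_bigr => a _.
by rewrite !mxE.
Qed.

Lemma mean_curv_shape :
  let H := n%:R^-1 *: \sum_i h (E i) (E i) in
  Num.sqrt (form GN H H) ^+ 2 = n%:R^-1 ^+ 2 * \sum_a \tr (shape_mx a) ^+ 2.
Proof.
move=> H; have pos0 u : 0 <= form GN u u.
  have [->|u0] := eqVneq u 0; first by rewrite form0l.
  exact: ltW (GN_pos u0).
rewrite sqr_sqrtr // /H formZl formZr mulrA -expr2.
have Hn z : form GN (\sum_i h (E i) (E i)) (dF z) = 0.
  by rewrite form_suml big1 // => i _; exact: h_normal.
congr (_ * _); rewrite (normal_form Hn Hn).
apply: eq_bigr => a _; rewrite -expr2 form_sumr; congr (_ ^+ 2).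
by apply: eq_bigr => i _; rewrite mxE.
Qed.

Lemma shapeE a u v : g (shp (xi a) u) v = form GN (xi a) (h u v).
Proof. by rewrite /shp sharpP // => b w w'; rewrite hr formDr formZr. Qed.

Lemma shape_shape a b i j :
  g (shp (xi a) (shp (xi b) (E i))) (E j)
  = (shape_mx b *m shape_mx a) i j.
Proof.
rewrite shapeE hC -shapeE -(parseval G_sym E_on) mxE; apply: eq_bigr => l _.
rewrite mulrC; congr (_ * _); rewrite G_sym shapeE mxE //.
by rewrite hC.
Qed.

Lemma rho_perp_shape :
  \sum_(i < n) \sum_(j < n | (i < j)%N) \sum_(a < m) \sum_(b < m | (a < b)%N)
    g (shp (xi a) (shp (xi b) (E i)) - shp (xi b) (shp (xi a) (E i))) (E j) ^+ 2
  = \sum_(i < n) \sum_(j < n | (i < j)%N) \sum_(a < m) \sum_(b < m | (a < b)%N)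
    commutator (shape_mx a) (shape_mx b) i j ^+ 2.
Proof.
do 2!(apply: eq_bigr => ? _); do 2!(apply: eq_bigr => ? _).
(* Operators compose in the order opposite to their matrices; the square absorbs the sign. *)
rewrite formBl !shape_shape -sqrrN opprB.
by congr (_ ^+ 2); rewrite /commutator [RHS]mxE; congr (_ + _); rewrite [RHS]mxE.
Qed.

End NormalFrame.

Lemma normal_basis_exists E : orthonormal E ->
  exists xi : 'I_m -> 'rV[R]_(n + m), orthonormal_normal xi.
Proof.
move=> E_on.
pose V := \matrix_i dF (E i).
have VV i j : form GN (row i V) (row j V) = (i == j)%:R.
  by rewrite !rowK dF_isom E_on.
have [xi [xx xV]] := normal_frame_exists GN_pos GN_sym (leqnn (n + m)) VV.
exists xi; split=> // a u.
have dF0 : dF 0 = 0.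
  by have := dF_lin (-1) 0 0; rewrite scaler0 addr0 scaleN1r addNr.
have dFD v w : dF (v + w) = dF v + dF w.
  by rewrite -{1}[v]scale1r dF_lin scale1r.
rewrite (frame_expand G_pos G_sym E_on u).
rewrite (big_morph (fun v => dF v) dFD dF0) form_sumr big1 // => i _.
rewrite -[_ *: E i]addr0 dF_lin dF0 addr0 formZr.
by have := xV a i; rewrite rowK => ->; rewrite mulr0.
Qed.

(** Written out so that [wintgen_ideal], specialized to two charts and a point, is convertible to
    it. *)
Definition wintgen_equality_at : Prop :=
  forall E xi, orthonormal E -> orthonormal_normal xi ->
    2 / (n%:R * (n%:R - 1)) *
      (\sum_(i < n) \sum_(j < n | (i < j)%N) Rt (E i) (E j) (E j) (E i)) =
    Num.sqrt (form GN (n%:R^-1 *: \sum_i h (E i) (E i))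
                      (n%:R^-1 *: \sum_i h (E i) (E i))) ^+ 2
    - 2 / (n%:R * (n%:R - 1)) * Num.sqrt (\sum_(i < n) \sum_(j < n | (i < j)%N)
        \sum_(a < m) \sum_(b < m | (a < b)%N)
        g (shp (xi a) (shp (xi b) (E i)) - shp (xi b) (shp (xi a) (E i))) (E j) ^+ 2)
    + k.

(** The equality is read off in an arbitrary frame, which the orthogonal matrix from [ddvv_equality]
    then rotates into [E]. The numbers t_a are the normalized traces of the shape operators, and
    r_a, s_a are the coordinates of their traceless parts. *)
Lemma wintgen_shape : wintgen_equality_at ->
  exists (E : 'I_n -> 'rV[R]_n) (xi : 'I_m -> 'rV[R]_(n + m)) (i j : 'I_n)
    (t r s : 'I_m -> R),
    [/\ orthonormal E, orthonormal_normal xi, i != j &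
      forall a u v, form GN (xi a) (h u v)
        = t a * g u v + plane_form G E i j (r a) (s a) u v].
Proof.
move=> hW; have [E0 E0_on] := frame_exists G_pos G_sym.
have [xi xi_on] := normal_basis_exists E0_on.
pose A a := shape_mx E0 xi a.
have := hW E0 xi E0_on xi_on.
rewrite (rho_shape E0_on xi_on) (mean_curv_shape E0_on xi_on).
rewrite (rho_perp_shape xi E0_on) => W.
have A_sym a : (A a)^T = A a by exact: shape_mx_sym.
have B_sym a : (traceless (A a))^T = traceless (A a).
  by rewrite /traceless linearB /= A_sym tr_scalar_mx.
have BW := wintgen_equality n_gt1 A_sym W.
have [|P [i [j [PP ij Bpq]]]] := ddvv_equality n_gt1 B_sym; first by rewrite BW.
have Bpq2 a : exists rs : R * R, cjmx P (traceless (A a)) =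
    rs.1 *: (delta_mx i i - delta_mx j j) + rs.2 *: (delta_mx i j + delta_mx j i).
  by have [r [s e]] := Bpq a; exists (r, s).
have [rs rsE] := fin_all_exists Bpq2.
pose E l := \sum_q P l q *: E0 q.
have E_on : orthonormal E by move=> q l; exact: (rotated_frame E0_on PP).
pose t a := n%:R^-1 * \tr (A a).
exists E, xi, i, j, t, (fun a => (rs a).1), (fun a => (rs a).2).
split=> // a u v.
have PA : cjmx P (A a) = (t a)%:M + ((rs a).1 *: (delta_mx i i - delta_mx j j)
    + (rs a).2 *: (delta_mx i j + delta_mx j i)).
  have {1}-> : A a = (t a)%:M + traceless (A a) by rewrite /traceless addrC subrK.
  by rewrite cjmxD rsE /cjmx mul_mx_scalar -scalemxAl PP scalemx1.
have hxl b w w' z : form GN (xi a) (h (b *: w + w') z)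
    = b * form GN (xi a) (h w z) + form GN (xi a) (h w' z).
  by rewrite hl formDr formZr.
have hxr b w z z' : form GN (xi a) (h w (b *: z + z'))
    = b * form GN (xi a) (h w z) + form GN (xi a) (h w z').
  by rewrite hr formDr formZr.
have hEE q l : form GN (xi a) (h (E q) (E l)) = cjmx P (A a) q l.
  rewrite (@bilinear_frame_expand _ _ _ G_pos G_sym _ E0_on R^o _ hxl hxr).
  have coef z y : g (E0 y) (E z) = P z y.
    rewrite /E form_sumr (bigD1 y) //= formZr E0_on eqxx mulr1 big1 ?addr0 //.
    by move=> l' ly; rewrite formZr E0_on eq_sym (negbTE ly) mulr0.
  rewrite /cjmx -mulmxA mxE; apply: eq_bigr => y _.
  rewrite mxE mulr_sumr; apply: eq_bigr => z _.
  rewrite !coef !mxE /GRing.scale /= mulrAC mulrA; ring.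
rewrite (@bilinear_frame_expand _ _ _ G_pos G_sym _ E_on R^o _ hxl hxr).
pose b w z : R^o := t a * g w z + plane_form G E i j (rs a).1 (rs a).2 w z.
have bl e w w' z : b (e *: w + w') z = e *: b w z + b w' z.
  rewrite /b /plane_form /GRing.scale /=.
  by rewrite !(formDl, formZl, formDr, formZr); ring.
have br e w z z' : b w (e *: z + z') = e *: b w z + b w z'.
  rewrite /b /plane_form /GRing.scale /=.
  by rewrite !(formDl, formZl, formDr, formZr); ring.
rewrite -/(b u v) (bilinear_frame_expand G_pos G_sym E_on bl br).
apply: eq_bigr => q _; apply: eq_bigr => l _; congr (_ *: _).
rewrite hEE PA /b /plane_form !E_on !mxE.
have E2 (b1 b2 : bool) : (b1 && b2)%:R = b1%:R * b2%:R :> R by rewrite -natrM mulnb.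
rewrite !E2 -[_ *+ _]mulr_natr !(eq_sym q) !(eq_sym l).
by ring.
Qed.

Variable Rm : endo2 R n.
Hypothesis RmE : Rt = lower G Rm.

Lemma umbilical_weyl H0 : (2 < n)%N -> (forall u v, h u v = g u v *: H0) ->
  forall X Y Z W, lower G (weyl_op G Rm) X Y Z W = 0.
Proof.
move=> n_gt2 hu; have [E E_on] := frame_exists G_pos G_sym.
(* Any plane serves here, since its terms get the coefficients 0. *)
have ij : Ordinal (ltnW n_gt1) != Ordinal n_gt1 by [].
apply: (@weyl_constant R n G G_pos G_sym E E_on _ _ ij Rm
  (k + form GN H0 H0) 0 0 0) => // X Y Z W.
have := gauss X Y Z W; rewrite RmE /lower => ->.
by rewrite !hu !formZl !formZr /plane_form; ring.
Qed.

(** Inserting t_a g + T_a into the Gauss equation, the squares of t_a join k, the cross terms form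
    the product of g with sum t_a T_a, and the terms quadratic in T_a reduce to its determinant
    -(r_a^2 + s_a^2) times the squared area form. *)
Lemma wintgen_rigidity : (3 < n)%N -> 0 < k -> wintgen_equality_at ->
  lin_dep6 (dot Rm (lower G (weyl_op G Rm))) (dot (wedge g) Rt) ->
  exists H0, forall u v, h u v = g u v *: H0.
Proof.
move=> n_gt3 k0 /wintgen_shape[E [xi [i [j [t [r [s [E_on xi_on ij hE]]]]]]]].
rewrite RmE => dep.
pose al := \sum_a t a * r a; pose be := \sum_a t a * s a.
pose P := - \sum_a (r a ^+ 2 + s a ^+ 2).
pose K := k + \sum_a t a ^+ 2.
have K0 : 0 < K by rewrite ltr_pwDl // sumr_ge0 // => a _; rewrite sqr_ge0.
have RmK X Y Z W : g (Rm X Y Z) W = K * (g Y Z * g X W - g X Z * g Y W)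
  + (g Y Z * plane_form G E i j al be X W + plane_form G E i j al be Y Z * g X W
     - g X Z * plane_form G E i j al be Y W - plane_form G E i j al be X Z * g Y W)
  + P * (plane_vol G E i j X Y * plane_vol G E i j W Z).
  have := gauss X Y Z W; rewrite RmE /lower => ->.
  rewrite !(normal_form E_on xi_on (h_normal _ _) (h_normal _ _)).
  under eq_bigr do rewrite !hE.
  under [X in _ - X]eq_bigr do rewrite !hE.
  rewrite -addrA -sumrB.
  have PE : P = \sum_a - (r a ^+ 2 + s a ^+ 2) by rewrite /P sumrN.
  have pfE X' Y' : plane_form G E i j al be X' Y'
      = \sum_a t a * plane_form G E i j (r a) (s a) X' Y'.
    rewrite /plane_form /al /be !mulr_suml -big_split; apply: eq_bigr => a _ /=.
    by ring.
  rewrite PE /K !pfE !mulr_sumr !mulr_suml mulrDl mulr_suml -!addrA.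
  congr (_ + _).
  rewrite -!sumrN -!big_split; apply: eq_bigr => a _ /=.
  by rewrite /plane_form /plane_vol; ring.
(* The hypothesis n >= 4 supplies two directions orthogonal to the plane. *)
have [q [l [qi qj li lj ql]]] : exists q l : 'I_n,
    [/\ q != i, q != j, l != i, l != j & q != l].
  have card3 (S : {set 'I_n}) : (#|S| <= 3)%N -> exists q, q \notin S.
    move=> S3; have : (0 < #|~: S|)%N.
      by rewrite cardsCs finset.setCK card_ord subn_gt0 (leq_ltn_trans S3).
    by rewrite card_gt0 => /set0Pn[q]; rewrite finset.in_setC; exists q.
  have [|q] := card3 [set i; j]%SET; first by rewrite cards2; case: (_ != _).
  rewrite !in_set2 negb_or => /andP[qi qj].
  have [|l] := card3 (q |: [set i; j])%SET.
    by rewrite cardsU1 cards2; case: (_ \notin _); case: (_ != _).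
  rewrite !inE !negb_or => /and3P[lq li lj].
  by exists q, l; rewrite eq_sym in lq.
have P0 : P = 0.
  exact: (plane_rigidity G_pos G_sym E_on ij RmK (ltnW n_gt3) qi qj li lj ql K0 dep).
have rs0 a : r a = 0 /\ s a = 0.
  have : r a ^+ 2 + s a ^+ 2 = 0.
    apply/eqP; move: P0 => /eqP; rewrite /P oppr_eq0 psumr_eq0 => [/allP|b _].
      by move=> /(_ a (mem_index_enum _)).
    by rewrite addr_ge0 ?sqr_ge0.
  by move=> E0; split; apply/eqP; rewrite -sqrf_eq0; apply/eqP;
    have := sqr_ge0 (r a); have := sqr_ge0 (s a); lra.
exists (\sum_a t a *: xi a) => u v.
rewrite (normal_expand E_on xi_on (h_normal u v)) scaler_sumr.
apply: eq_bigr => a _; rewrite hE /plane_form; have [-> ->] := rs0 a.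
by rewrite !mul0r !addr0 scalerA mulrC.
Qed.

Lemma umbilical_mean H0 E : orthonormal E -> (forall u v, h u v = g u v *: H0) ->
  n%:R^-1 *: \sum_i h (E i) (E i) = H0.
Proof.
move=> E_on hu; under eq_bigr do rewrite hu E_on eqxx scale1r.
rewrite sumr_const card_ord -(scaler_nat n H0) scalerA mulVf ?scale1r //.
by rewrite pnatr_eq0; case: n n_gt1.
Qed.

End PointwiseSubmanifold.

Theorem theorem5 (R : realType) (n m : nat) (k : R)
    (M : riemannian R n) (N : riemannian R (n + m)) (f : M -> N)
    (hn : (4 <= n)%N) (hm : (2 <= m)%N)
    (hN : constant_curvature N k)
    (hf : isometric_immersion f)
    (hW : wintgen_ideal f k)
    (hk : 0 < k) :
  (linearly_dependent (@RdotC R n M) (@QgR R n M) <-> totally_umbilical f)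
  /\ (totally_umbilical f -> conformally_flat M).
Proof.
have n_gt2 : (2 < n)%N := ltnW hn.
have n_gt1 : (1 < n)%N := ltnW n_gt2.
have flat : totally_umbilical f -> conformally_flat M.
  (* Umbilicity is expressed through ambient charts and tangent frames, so a chart around f p and a
     frame at p have to be chosen. *)
  move=> hu c p ac cp; have [d ad dp] := atlas_cover (f p).
  have G_sym := gram_sym ac cp; have G_pos := gram_pos ac cp.
  have [E E_on] := frame_exists G_pos G_sym.
  exact: (umbilical_weyl n_gt1 G_sym G_pos
    (gauss_constant_curvature hN hf ac cp ad dp) (erefl _) n_gt2
    (hu c d p ac cp ad dp E E_on)).
split; last exact: flat; split => [dep|hu] c; last first.
  (* Since C = 0, already R.C vanishes. *)
  move=> p ac cp; exists 1, 0; split; first by left; rewrite oner_eq0.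
  move=> X1 X2 X3 X4 X Y; rewrite mul0r addr0 mul1r /RdotC /dot.
  by rewrite !(flat hu c p ac cp) !addr0 oppr0.
move=> d p ac cp ad dp E E_on X Y.
have G_sym := gram_sym ac cp; have G_pos := gram_pos ac cp.
have GN_sym := gram_sym ad dp; have GN_pos := gram_pos ad dp.
have [H0 hH] := wintgen_rigidity n_gt1 G_sym G_pos GN_sym GN_pos
  (second_ffC hf ac cp ad dp) (second_ff_linl hf ac cp ad dp)
  (second_ff_normal hf ac cp ad dp) (differential_isometry hf ac cp ad dp)
  (differential_lin hf ac cp ad dp) (gauss_constant_curvature hN hf ac cp ad dp)
  (erefl _) hn hk (hW c d p ac cp ad dp) (dep c p ac cp).
rewrite hH; congr (_ *: _); apply/esym.
exact: (umbilical_mean n_gt1 E_on hH).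
Qed.
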